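(* For arbitrary local rings $R_1$ and $R_2$ the categories $\textup{mod-}R_1$ and $\textup{mod-}R_2$ are elementarily equivalent if and only if the structures $\langle \mathrm{Cn},R_1\rangle$ and $\langle \mathrm{Cn},R_2\rangle$ are equivalent in the second-order logic $L_2$.
   Context: The ambient set theory is NBG (von Neumann--Bernays--G\''odel, with choice). $\mathrm{Cn}$ is the class of all cardinal numbers (initial ordinals; a cardinal is identified with the set of smaller ordinals). Rings are associative with unit, not necessarily commutative. A ring is local if the set of all its noninvertible elements is a left ideal. $\textup{mod-}R$ is the category of all left $R$-modules and all homomorphisms. The first order language of category theory has variables for objects and for morphisms, equality, and expressions for ''$f\in \mathrm{Mor}(X,Y)$'', ''$h=f\circ g$'' and ''$f=1_X$''. Two categories are elementarily equivalent if the same sentences of this language hold in both. The second-order logic $L_2$ of the structure $\langle \mathrm{Cn},\mathsf{ring}\rangle$ (where $\mathsf{ring}$ stands for a ring, with its operations $+$ and $\cdot$): formulas are built by the logical connectives from: quantifiers $\forall r\in\mathsf{ring}$, $\exists r\in \mathsf{ring}$; quantifiers $\forall\varkappa\in\mathrm{Cn}$, $\exists\varkappa\in\mathrm{Cn}$; quantifiers $\forall\alpha\in\varkappa$, $\exists\alpha\in\varkappa$, where $\varkappa$ is a free or previously introduced cardinal variable; atomic formulas $r_1=r_2+r_3$, $r_1=r_2\cdot r_3$, $r_1=r_2$, $\varkappa_1=\varkappa_2$, $\alpha_1=\alpha_2$; quantifiers $\forall$, $\exists$ over predicate variables $P_{\varkappa_1,\dots,\varkappa_k}(c_1,\dots,c_k;v_1,\dots,v_n)$,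 where $\varkappa_1,\dots,\varkappa_k$ are free or previously introduced cardinal variables, ranging over arbitrary relations $P\subseteq \varkappa_1\times\dots\times\varkappa_k\times \mathsf{ring}^n$; and atomic formulas $P_{\varkappa_1,\dots,\varkappa_k}(\alpha_1,\dots,\alpha_k;r_1,\dots,r_n)$ with $\alpha_i\in\varkappa_i$, $r_j\in \mathsf{ring}$. Structures $\langle \mathrm{Cn},R\rangle$ and $\langle \mathrm{Cn},S\rangle$ are equivalent in $L_2$ if the same sentences of this language are true in both. *)

(* Defs.v *)
From HB Require Import structures.
From mathcomp Require Import all_boot all_algebra.
From mathcomp Require Import boolp classical_sets functions cardinality.
From mathcomp Require Import wochoice.

Set Implicit Arguments.
Unset Strict Implicit.
Unset Printing Implicit Defensive.

Import GRing.Theory.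

Local Open Scope classical_set_scope.
Local Open Scope quotient_scope.
Local Open Scope ring_scope.

(** The sets of the ambient NBG are the well-founded trees branching over
    arbitrary types (of one fixed universe), up to bisimulation, so that
    equality of sets is Leibniz equality.  Its classes are the predicates
    [set V]. *)

Inductive tree : Type := Tree (A : Type) (f : A -> tree).

HB.instance Definition _ := gen_eqMixin tree.
HB.instance Definition _ := gen_choiceMixin tree.

Fixpoint bisim (s t : tree) : Prop :=
  match s, t with
  | Tree A f, Tree B g =>
      (forall a, exists b, bisim (f a) (g b)) /\
      (forall b, exists a, bisim (f a) (g b))
  end.

Lemma bisim_refl s : bisim s s.
Proof. by elim: s => A f IH; split=> a; exists a. Qed.

Lemma bisim_sym s t : bisim s t -> bisim t s.
Proof.
elim: s t => A f IH [B g] /= [fg gf]; split=> [b|a].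
  by have [a /IH] := gf b; exists a.
by have [b /IH] := fg a; exists b.
Qed.

Lemma bisim_trans t s u : bisim s t -> bisim t u -> bisim s u.
Proof.
elim: s t u => A f IH [B g] [C h] /= [fg gf] [gh hg]; split=> [a|c].
  have [b fab] := fg a; have [c gbc] := gh b.
  by exists c; apply: IH fab gbc.
have [b gbc] := hg c; have [a fab] := gf b.
by exists a; apply: IH fab gbc.
Qed.

Definition bisimb : rel tree := fun s t => `[< bisim s t >].

Lemma bisimb_refl : reflexive bisimb.
Proof. by move=> s; apply/asboolP/bisim_refl. Qed.

Lemma bisimb_sym : symmetric bisimb.
Proof. by move=> s t; apply/asboolP/asboolP; apply: bisim_sym. Qed.

Lemma bisimb_trans : transitive bisimb.
Proof.
by move=> t s u /asboolP st /asboolP tu; apply/asboolP/(bisim_trans st tu).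
Qed.

Canonical bisim_equiv := EquivRel bisimb bisimb_refl bisimb_sym bisimb_trans.

Definition V := {eq_quot bisim_equiv}.
HB.instance Definition _ := Choice.on V.
HB.instance Definition _ := EqQuotient.on V.

Definition tree_mem (s t : tree) : Prop :=
  let: Tree B g := t in exists b, bisim s (g b).

Definition members (x : V) : set V := [set y | tree_mem (repr y) (repr x)].

Lemma pi_bisim (s t : tree) : \pi_V s = \pi_V t <-> bisim s t.
Proof. by split=> [/eqmodP/asboolP|st]; last exact/eqmodP/asboolP. Qed.

Lemma members_Tree (A : Type) (f : A -> tree) :
  members (\pi_V (Tree f)) = range (fun a => \pi_V (f a)).
Proof.
have /pi_bisim := reprK (\pi_V (Tree f)).
rewrite /members; case: (repr _) => B g /= [gf fg].
apply/seteqP; split=> y /=.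
  move=> [b yb]; have [a gba] := gf b; exists a => //.
  rewrite -[RHS]reprK; apply/pi_bisim/bisim_sym.
  exact: bisim_trans yb gba.
move=> [a _ <-]; have [b gba] := fg a; exists b.
by apply: bisim_trans (bisim_sym gba); apply/pi_bisim; rewrite reprK.
Qed.

Lemma members_inj : injective members.
Proof.
move=> x y; rewrite -[x]reprK -[y]reprK.
case: (repr x) (repr y) => [A f] [B g]; rewrite !members_Tree => fg.
apply/pi_bisim; split=> [a|b].
  have [b _ /esym/pi_bisim] : range (fun b => \pi_V (g b)) (\pi_V (f a)).
    by rewrite -fg; exists a.
  by exists b.
have [a _ /pi_bisim] : range (fun a => \pi_V (f a)) (\pi_V (g b)).
  by rewrite fg; exists b.
by exists a.
Qed.

Lemma tree_mem_irr s : ~ tree_mem s s.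
Proof.
elim: s => A f IH [a /= sfa]; apply: (IH a).
have [t e] : exists t, t = f a by exists (f a).
move: sfa; rewrite -e.
case: t e => B g e /= [fg gf].
have [b fab] := fg a; exists b => //.
by rewrite -e in fab.
Qed.

(** In NBG a ring is carried by a set, not by a proper class.  By [type_is_set]
    below, this only excludes types of a universe larger than that over which
    [V] is built. *)
Definition is_set (T : Type) : Prop :=
  exists (x : V) (f : T -> V), injective f /\ range f = members x.

Lemma type_is_set (T : Type) : is_set T.
Proof.
have [R woR] := well_ordering_principle {classic T}.
have woR' : wo_chain R predT by move=> A _; apply: woR.
have tot := wo_chainW woR'; have anti := wo_chain_antisymmetric woR'.
pose lt (x y : T) := R x y /\ x <> y.
have wf_lt : well_founded lt.
  move=> x0; apply: contrapT => nAx.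
  have [|m [[/asboolP mn mmin] _]] :=
      woR [pred x : {classic T} | `[< ~ Acc lt x >]].
    by exists x0; apply/asboolP.
  apply: mn; constructor => y [Rym ynm]; apply: contrapT => ny.
  by apply: ynm; apply: anti => //; rewrite Rym mmin //; apply/asboolP.
pose F (x : T) (h : forall y, lt y x -> tree) :=
  Tree (fun y : {y | lt y x} => h (sval y) (svalP y)).
pose f := Fix wf_lt (fun _ => tree) F.
have fE x : f x = Tree (fun y : {y | lt y x} => f (sval y)).
  rewrite /f Fix_eq // => {}x h k hk; rewrite /F; congr Tree.
  by apply: funext => y; apply: hk.
have fmem x y : lt x y -> ~ bisim (f x) (f y).
  move=> xy b; apply: (@tree_mem_irr (f x)).
  move: b; rewrite [in X in bisim _ X -> _]fE => b.
  have : tree_mem (f x) (f y).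
    by rewrite [f y]fE; exists (exist _ x xy); apply: bisim_refl.
  rewrite [f y]fE [f x]fE in b *.
  move=> [z xz]; case: b => _ /(_ z) [w wz]; exists w.
  exact: bisim_trans xz (bisim_sym wz).
exists (\pi_V (Tree f)), (fun x => \pi_V (f x)).
split; last by rewrite members_Tree.
move=> x y /pi_bisim bxy; apply: contrapT => nxy.
have /orP[Rxy|Ryx] := tot x y isT isT; first exact: (@fmem x y).
by apply: (@fmem y x); [split=> // /esym|apply: bisim_sym].
Qed.

Definition transitive_set (x : V) : Prop :=
  forall y, y \in members x -> members y `<=` members x.

(** Since membership is well-founded on [V], these are the von Neumann
    ordinals. *)
Definition ordinal (x : V) : Prop :=
  transitive_set x /\ (forall y, y \in members x -> transitive_set y).

Definition Cn : set V :=
  [set x | ordinal x /\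
           forall y, y \in members x -> ~ (members y #= members x)%card].

Definition invertible (R : pzRingType) (r : R) : Prop :=
  exists s, s * r = 1 /\ r * s = 1.

Definition left_ideal (R : pzRingType) (I : set R) : Prop :=
  [/\ I 0, forall x y, I x -> I y -> I (x + y) & forall a x, I x -> I (a * x)].

Definition local_ring (R : pzRingType) : Prop :=
  left_ideal [set r : R | ~ invertible r].

Record category := Category {
  Ob : Type;
  Hom : Ob -> Ob -> Type;
  idm : forall X, Hom X X;
  compm : forall X Y Z, Hom Y Z -> Hom X Y -> Hom X Z;
  compmA : forall W X Y Z (f : Hom Y Z) (g : Hom X Y) (h : Hom W X),
    compm f (compm g h) = compm (compm f g) h;
  compm1 : forall X Y (f : Hom X Y), compm f (idm X) = f;
  comp1m : forall X Y (f : Hom X Y), compm (idm Y) f = f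
}.

Record mor (C : category) := Mor {
  dom : Ob C;
  cod : Ob C;
  arrow : Hom dom cod
}.
Arguments Mor {C dom cod} arrow.

Inductive is_comp (C : category) : mor C -> mor C -> mor C -> Prop :=
  IsComp (X Y Z : Ob C) (f : Hom Y Z) (g : Hom X Y) :
    is_comp (Mor (compm f g)) (Mor f) (Mor g).

(** Object variables and morphism variables are two separate sorts, each
    named by natural numbers. *)
Inductive cat_formula : Type :=
  | CatEqOb (X Y : nat)
  | CatEqMor (f g : nat)
  | CatMor (f X Y : nat)               (* f \in Mor(X, Y) *)
  | CatComp (h f g : nat)              (* h = f \o g *)
  | CatId (f X : nat)                  (* f = 1_X *)
  | CatNot (A : cat_formula)
  | CatAnd (A B : cat_formula)
  | CatOr (A B : cat_formula)
  | CatImp (A B : cat_formula)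
  | CatAllOb (X : nat) (A : cat_formula)
  | CatExOb (X : nat) (A : cat_formula)
  | CatAllMor (f : nat) (A : cat_formula)
  | CatExMor (f : nat) (A : cat_formula).

(** [os] and [ms] list the object and morphism variables in scope. *)
Fixpoint cat_scoped (os ms : seq nat) (A : cat_formula) : bool :=
  match A with
  | CatEqOb X Y => (X \in os) && (Y \in os)
  | CatEqMor f g => (f \in ms) && (g \in ms)
  | CatMor f X Y => [&& f \in ms, X \in os & Y \in os]
  | CatComp h f g => [&& h \in ms, f \in ms & g \in ms]
  | CatId f X => (f \in ms) && (X \in os)
  | CatNot A => cat_scoped os ms A
  | CatAnd A B | CatOr A B | CatImp A B =>
      cat_scoped os ms A && cat_scoped os ms B
  | CatAllOb X A | CatExOb X A => cat_scoped (X :: os) ms A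
  | CatAllMor f A | CatExMor f A => cat_scoped os (f :: ms) A
  end.

Definition cat_sentence (A : cat_formula) : bool := cat_scoped [::] [::] A.

Fixpoint cat_sat (C : category) (vo : nat -> Ob C) (vm : nat -> mor C)
    (A : cat_formula) : Prop :=
  match A with
  | CatEqOb X Y => vo X = vo Y
  | CatEqMor f g => vm f = vm g
  | CatMor f X Y => dom (vm f) = vo X /\ cod (vm f) = vo Y
  | CatComp h f g => is_comp (vm h) (vm f) (vm g)
  | CatId f X => vm f = Mor (idm (vo X))
  | CatNot A => ~ cat_sat vo vm A
  | CatAnd A B => cat_sat vo vm A /\ cat_sat vo vm B
  | CatOr A B => cat_sat vo vm A \/ cat_sat vo vm B
  | CatImp A B => cat_sat vo vm A -> cat_sat vo vm B
  | CatAllOb X A => forall x : Ob C, cat_sat [eta vo with X |-> x] vm A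
  | CatExOb X A => exists x : Ob C, cat_sat [eta vo with X |-> x] vm A
  | CatAllMor f A => forall u : mor C, cat_sat vo [eta vm with f |-> u] A
  | CatExMor f A => exists u : mor C, cat_sat vo [eta vm with f |-> u] A
  end.

(** The values given to variables are irrelevant for a sentence; as usual in
    first-order logic, both sorts are meant to be inhabited. *)
Definition cat_true (C : category) (A : cat_formula) : Prop :=
  forall (vo : nat -> Ob C) (vm : nat -> mor C), cat_sat vo vm A.

Definition elementarily_equivalent (C D : category) : Prop :=
  forall A, cat_sentence A -> (cat_true C A <-> cat_true D A).

(** The carrier of a module is a set in [V], so that two modules are equal
    exactly when they have the same underlying set and the same operations,
    and every isomorphism class of modules is a proper class.  (How many
    values of [lmodType R] are isomorphic to a given one is not determined
    in Rocq, because equality of types is not.) *)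

Record lmodule (R : pzRingType) := LModule {
  carrier : V;
  lm_zero : members carrier;
  lm_opp : members carrier -> members carrier;
  lm_add : members carrier -> members carrier -> members carrier;
  lm_scale : R -> members carrier -> members carrier;
  lm_addA : associative lm_add;
  lm_addC : commutative lm_add;
  lm_add0 : left_id lm_zero lm_add;
  lm_addN : left_inverse lm_zero lm_opp lm_add;
  lm_scaleA : forall a b v, lm_scale a (lm_scale b v) = lm_scale (a * b) v;
  lm_scale1 : left_id 1 lm_scale;
  lm_scaleDr : right_distributive lm_scale lm_add;
  lm_scaleDl : forall v a b,
    lm_scale (a + b) v = lm_add (lm_scale a v) (lm_scale b v)
}.

Definition elements (R : pzRingType) (M : lmodule R) : Type :=
  members (carrier M).

Section Elements.
Variables (R : pzRingType) (M : lmodule R).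

HB.instance Definition _ := Choice.on (elements M).
HB.instance Definition _ := GRing.isZmodule.Build (elements M)
  (@lm_addA R M) (@lm_addC R M) (@lm_add0 R M) (@lm_addN R M).
HB.instance Definition _ := GRing.Zmodule_isLmodule.Build R (elements M)
  (@lm_scaleA R M) (@lm_scale1 R M) (@lm_scaleDr R M) (@lm_scaleDl R M).

End Elements.

Lemma linear_ext (R : pzRingType) (U W : lmodType R) (f g : {linear U -> W}) :
  f =1 g -> f = g.
Proof.
case: f g => [f [[f1] [f2]]] [g [[g1] [g2]]] /= /funext fg; subst g.
by rewrite (Prop_irrelevance f1 g1) (Prop_irrelevance f2 g2).
Qed.

Section ModuleCategory.
Variable R : pzRingType.

Definition lhom (X Y : lmodule R) : Type := {linear elements X -> elements Y}.

Definition lhom_id (X : lmodule R) : lhom X X := idfun.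

Definition lhom_comp (X Y Z : lmodule R) (f : lhom Y Z) (g : lhom X Y) :
  lhom X Z := f \o g.

Program Definition Mod : category :=
  @Category (lmodule R) lhom lhom_id lhom_comp _ _ _.
Next Obligation. by move=> *; apply: linear_ext. Qed.
Next Obligation. by move=> *; apply: linear_ext. Qed.
Next Obligation. by move=> *; apply: linear_ext. Qed.

End ModuleCategory.

(** The variable [(i, k)] is the [i]-th one ranging over the cardinal
    variable [k]. *)
Definition ord_var : Type := (nat * nat)%type.

(** The variable [(i, ks, n)] is the [i]-th one ranging over the relations
    included in the product of the cardinal variables [ks] and of [ring^n]. *)
Definition pred_var : Type := (nat * seq nat * nat)%type.

(** In the atomic formula [L2Pred i as rs], the predicate variable is
    determined by its index [i] and the sorts and number of its arguments. *)
Inductive l2_formula : Type :=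
  | L2Add (r1 r2 r3 : nat)             (* r1 = r2 + r3 *)
  | L2Mul (r1 r2 r3 : nat)             (* r1 = r2 * r3 *)
  | L2EqRing (r1 r2 : nat)
  | L2EqCard (k1 k2 : nat)
  | L2EqOrd (a1 a2 : ord_var)
  | L2Pred (i : nat) (alphas : seq ord_var) (rs : seq nat)
  | L2Not (A : l2_formula)
  | L2And (A B : l2_formula)
  | L2Or (A B : l2_formula)
  | L2Imp (A B : l2_formula)
  | L2AllRing (r : nat) (A : l2_formula)
  | L2ExRing (r : nat) (A : l2_formula)
  | L2AllCard (k : nat) (A : l2_formula)
  | L2ExCard (k : nat) (A : l2_formula)
  | L2AllOrd (a : ord_var) (A : l2_formula)
  | L2ExOrd (a : ord_var) (A : l2_formula)
  | L2AllPred (p : pred_var) (A : l2_formula)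
  | L2ExPred (p : pred_var) (A : l2_formula).

Definition pred_of (i : nat) (alphas : seq ord_var) (rs : seq nat) : pred_var :=
  (i, [seq a.2 | a <- alphas], size rs).

(** The lists are those of the variables in scope.  A cardinal variable is not
    quantified again within its own scope, since it may be a subscript of
    ordinal and predicate variables that are in scope. *)
Fixpoint l2_scoped (rings cards : seq nat) (ords : seq ord_var)
    (preds : seq pred_var) (A : l2_formula) : bool :=
  match A with
  | L2Add r1 r2 r3 | L2Mul r1 r2 r3 =>
      [&& r1 \in rings, r2 \in rings & r3 \in rings]
  | L2EqRing r1 r2 => (r1 \in rings) && (r2 \in rings)
  | L2EqCard k1 k2 => (k1 \in cards) && (k2 \in cards)
  | L2EqOrd a1 a2 => (a1 \in ords) && (a2 \in ords)
  | L2Pred i alphas rs =>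
      [&& pred_of i alphas rs \in preds,
          all [in ords] alphas & all [in rings] rs]
  | L2Not A => l2_scoped rings cards ords preds A
  | L2And A B | L2Or A B | L2Imp A B =>
      l2_scoped rings cards ords preds A && l2_scoped rings cards ords preds B
  | L2AllRing r A | L2ExRing r A => l2_scoped (r :: rings) cards ords preds A
  | L2AllCard k A | L2ExCard k A =>
      (k \notin cards) && l2_scoped rings (k :: cards) ords preds A
  | L2AllOrd a A | L2ExOrd a A =>
      (a.2 \in cards) && l2_scoped rings cards (a :: ords) preds A
  | L2AllPred p A | L2ExPred p A =>
      all [in cards] p.1.2 && l2_scoped rings cards ords (p :: preds) A
  end.

Definition l2_sentence (A : l2_formula) : bool :=
  l2_scoped [::] [::] [::] [::] A.

Section L2Semantics.
Variable R : pzRingType.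

Definition l2_relation : Type := seq V -> seq R -> Prop.

Definition relation_on (kappas : seq V) (n : nat) : set l2_relation :=
  [set P | forall alphas rs, P alphas rs ->
     all2 (fun alpha kappa => alpha \in members kappa) alphas kappas /\
     size rs = n].

Fixpoint l2_sat (vr : nat -> R) (vc : nat -> V) (vo : ord_var -> V)
    (vp : pred_var -> l2_relation) (A : l2_formula) : Prop :=
  match A with
  | L2Add r1 r2 r3 => vr r1 = vr r2 + vr r3
  | L2Mul r1 r2 r3 => vr r1 = vr r2 * vr r3
  | L2EqRing r1 r2 => vr r1 = vr r2
  | L2EqCard k1 k2 => vc k1 = vc k2
  | L2EqOrd a1 a2 => vo a1 = vo a2
  | L2Pred i alphas rs => vp (pred_of i alphas rs) (map vo alphas) (map vr rs)
  | L2Not A => ~ l2_sat vr vc vo vp A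
  | L2And A B => l2_sat vr vc vo vp A /\ l2_sat vr vc vo vp B
  | L2Or A B => l2_sat vr vc vo vp A \/ l2_sat vr vc vo vp B
  | L2Imp A B => l2_sat vr vc vo vp A -> l2_sat vr vc vo vp B
  | L2AllRing r A => forall x : R, l2_sat [eta vr with r |-> x] vc vo vp A
  | L2ExRing r A => exists x : R, l2_sat [eta vr with r |-> x] vc vo vp A
  | L2AllCard k A =>
      forall kappa : V, kappa \in Cn ->
        l2_sat vr [eta vc with k |-> kappa] vo vp A
  | L2ExCard k A =>
      exists2 kappa : V, kappa \in Cn &
        l2_sat vr [eta vc with k |-> kappa] vo vp A
  | L2AllOrd a A =>
      forall alpha : V, alpha \in members (vc a.2) ->
        l2_sat vr vc [eta vo with a |-> alpha] vp A
  | L2ExOrd a A =>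
      exists2 alpha : V, alpha \in members (vc a.2) &
        l2_sat vr vc [eta vo with a |-> alpha] vp A
  | L2AllPred p A =>
      forall P : l2_relation, relation_on (map vc p.1.2) p.2 P ->
        l2_sat vr vc vo [eta vp with p |-> P] A
  | L2ExPred p A =>
      exists2 P : l2_relation, relation_on (map vc p.1.2) p.2 P &
        l2_sat vr vc vo [eta vp with p |-> P] A
  end.

Definition l2_true (A : l2_formula) : Prop :=
  forall vr vc vo vp, l2_sat vr vc vo vp A.

End L2Semantics.

Definition l2_equivalent (R S : pzRingType) : Prop :=
  forall A, l2_sentence A -> (l2_true R A <-> l2_true S A).

(* Main.v *)
(* In one direction, a module is a cardinal with relations for its operations
   and a morphism is a relation between two cardinals.

   In the other direction, let [U] be the free module of rank one.  As [R] is
   local, [U] is characterized as a generator that is a retract of every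
   generator, and its endomorphisms are the elements of [R].  A well-ordered set
   [W] yields a ruler: the free module [U^(W)] together with a definable set of
   endomorphisms, the triangular ones.  The rank one idempotents [x p] such that
   [x c p] is triangular for all [c] correspond to the elements of [W], since the
   lowest component of [x] is a unit; [x <= x'] is definable as [x' = T x] with
   [T] triangular.  A function [F : W -> W'] is coded by a linear map sending the
   basis element at [w] to the one at [F w] in the [w]-th copy of [U^(W')]; then
   [F w] is the greatest point reached from [w].  Relations are images of tuples
   of functions, so second-order logic on the points of rulers is expressible,
   and cardinals are recovered by the Mostowski collapse.

   To have ring elements as arguments of relations, [r] is related to the points
   of a further ruler as follows.  Ladders with stationary labels provide a well-
   order on which every ladder-preserving triangular [T] over right
   multiplication by [r] agrees, at some [d] labelled [r], with the diagonal map
   of the labels; and [T = r] does so only at points labelled [r]. *)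

Require Import Defs.
From HB Require Import structures.
From Stdlib Require Import Eqdep.
From Stdlib Require List.
From mathcomp Require Import all_boot all_algebra.
From mathcomp Require Import boolp classical_sets functions cardinality.
From mathcomp Require Import wochoice.
Import Defs.

Set Implicit Arguments.
Unset Strict Implicit.
Unset Printing Implicit Defensive.

Import GRing.Theory.

Local Open Scope classical_set_scope.
Local Open Scope quotient_scope.
Local Open Scope ring_scope.

(** * Category formulas with typed morphism variables *)

(** A point of a ruler matters only up to triangular maps: the components above its lowest one and a
    unit factor cannot be seen. Coded functions thus carry points to points but lose all scalars,
    and labels have to tie ring elements to points. The map multiplying every basis element by [r]
    depends on the basis, so it is not named; labels quantify over all endomorphisms that share some
    definable features with it. The ladders make these features strong enough: such an endomorphism
    has no freedom left at suitable basis elements, and stationarity provides such elements with any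
    prescribed label. All auxiliary data with the stated properties yield the same truth value, so
    they need not be unique. In the other direction, the language of categories distinguishes
    isomorphic modules, while a cardinal with operations determines a module only up to isomorphism.
    As isomorphic copies can be found outside any finite list, a quantified object is either one of
    the finitely many named before or a fresh one. *)

Section Form.
Variables (O : Type) (M : O -> O -> Type).

(* Parametric higher-order abstract syntax: [FComp f g k] and [FId X k] name
   the composite of [f] and [g] and the identity of [X] in [k]. *)
Inductive form : Type :=
  | FEq X Y (f g : M X Y)
  | FNot (A : form)
  | FAnd (A B : form)
  | FOr (A B : form)
  | FImp (A B : form)
  | FAllO (k : O -> form)
  | FExO (k : O -> form)
  | FAll X Y (k : M X Y -> form)
  | FEx X Y (k : M X Y -> form)
  | FComp X Y Z (f : M Y Z) (g : M X Y) (k : M X Z -> form)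
  | FId X (k : M X X -> form).

End Form.
Arguments FEq {O M X Y} f g.
Arguments FComp {O M X Y Z} f g k.
Arguments FId {O M} X k.
Arguments FAll {O M} X Y k.
Arguments FEx {O M} X Y k.
Arguments FAllO {O M} k.
Arguments FExO {O M} k.

Fixpoint denote (C : category) (A : form (@Hom C)) : Prop :=
  match A with
  | FEq X Y f g => f = g
  | FNot A => ~ denote A
  | FAnd A B => denote A /\ denote B
  | FOr A B => denote A \/ denote B
  | FImp A B => denote A -> denote B
  | FAllO k => forall X, denote (k X)
  | FExO k => exists X, denote (k X)
  | FAll X Y k => forall f, denote (k f)
  | FEx X Y k => exists f, denote (k f)
  | FComp X Y Z f g k => denote (k (compm f g))
  | FId X k => denote (k (idm X))
  end.

(** With this sort of morphisms a parametric formula becomes syntax: objects and morphisms are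
    variable numbers, and the endpoints are phantom arguments. *)
Definition name (x y : nat) : Type := nat.

(** The two sorts of variables can share the counter [n]. Composites and identities are introduced
    by existential quantifiers, which is harmless because they exist and are unique. *)
Fixpoint compile (A : form name) (n : nat) : cat_formula :=
  match A with
  | FEq X Y f g => CatEqMor f g
  | FNot A => CatNot (compile A n)
  | FAnd A B => CatAnd (compile A n) (compile B n)
  | FOr A B => CatOr (compile A n) (compile B n)
  | FImp A B => CatImp (compile A n) (compile B n)
  | FAllO k => CatAllOb n (compile (k n) n.+1)
  | FExO k => CatExOb n (compile (k n) n.+1)
  | FAll X Y k => CatAllMor n (CatImp (CatMor n X Y) (compile (k n) n.+1))
  | FEx X Y k => CatExMor n (CatAnd (CatMor n X Y) (compile (k n) n.+1))
  | FComp X Y Z f g k =>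
      CatExMor n (CatAnd (CatComp n f g) (compile (k n) n.+1))
  | FId X k => CatExMor n (CatAnd (CatId n X) (compile (k n) n.+1))
  end.

(** Uniqueness of identity proofs recovers the arrow from a dependent pair over its endpoints. *)
Lemma Mor_inj (C : category) (X Y : Ob C) (f g : Hom X Y) :
  Mor f = Mor g -> f = g.
Proof. by move=> e; injection e => h; apply: (inj_pair2 _ _ _ _ _ (inj_pair2 _ _ _ _ _ h)). Qed.

Lemma is_comp_Mor (C : category) (X Y Z : Ob C) (f : Hom Y Z) (g : Hom X Y)
    (u : mor C) : is_comp u (Mor f) (Mor g) <-> u = Mor (compm f g).
Proof.
split=> [|->]; last exact: IsComp.
move ef : (Mor f) => f'; move eg : (Mor g) => g' c.
case: c ef eg => X' Y' Z' {f'}f' {g'}g' ef eg.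
have [eY eZ] : Y = Y' /\ Z = Z' by split; [exact: (congr1 (@dom C) ef)|exact: (congr1 (@cod C) ef)].
have eX : X = X' := congr1 (@dom C) eg.
by subst; rewrite (Mor_inj ef) (Mor_inj eg).
Qed.

(** * Adequacy of the compilation to first-order formulas *)

Section Adequacy.
Variable C : category.

Definition entry : Type := ((nat * Ob C) + (nat * mor C))%type.

Definition inO (G : list entry) (x : nat) (X : Ob C) := List.In (inl (x, X)) G.
Definition inM (G : list entry) (X Y : Ob C) (f : nat) (u : Hom X Y) :=
  List.In (inr (f, Mor u)) G.

Inductive wf : list entry -> form name -> form (@Hom C) -> Prop :=
  | wf_Eq G x y X Y f g (u v : Hom X Y) :
      inM G f u -> inM G g v -> wf G (@FEq _ name x y f g) (FEq u v)
  | wf_Not G A A' : wf G A A' -> wf G (FNot A) (FNot A')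
  | wf_And G A A' B B' : wf G A A' -> wf G B B' -> wf G (FAnd A B) (FAnd A' B')
  | wf_Or G A A' B B' : wf G A A' -> wf G B B' -> wf G (FOr A B) (FOr A' B')
  | wf_Imp G A A' B B' : wf G A A' -> wf G B B' -> wf G (FImp A B) (FImp A' B')
  | wf_AllO G k k' : (forall x X, wf (inl (x, X) :: G) (k x) (k' X)) ->
      wf G (FAllO k) (FAllO k')
  | wf_ExO G k k' : (forall x X, wf (inl (x, X) :: G) (k x) (k' X)) ->
      wf G (FExO k) (FExO k')
  | wf_All G x y X Y k k' : inO G x X -> inO G y Y ->
      (forall f (u : Hom X Y), wf (inr (f, Mor u) :: G) (k f) (k' u)) ->
      wf G (@FAll _ name x y k) (FAll X Y k')
  | wf_Ex G x y X Y k k' : inO G x X -> inO G y Y ->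
      (forall f (u : Hom X Y), wf (inr (f, Mor u) :: G) (k f) (k' u)) ->
      wf G (@FEx _ name x y k) (FEx X Y k')
  | wf_Comp G x y z X Y Z f g (u : Hom Y Z) (v : Hom X Y) k k' :
      inM G f u -> inM G g v ->
      (forall h (w : Hom X Z), wf (inr (h, Mor w) :: G) (k h) (k' w)) ->
      wf G (@FComp _ name x y z f g k) (FComp u v k')
  | wf_Id G x X k k' : inO G x X ->
      (forall h (w : Hom X X), wf (inr (h, Mor w) :: G) (k h) (k' w)) ->
      wf G (@FId _ name x k) (FId X k').

(** The bound by [n] makes the next variable fresh, so that assigning it leaves the earlier entries
    intact. *)
Definition entry_ok n (os ms : seq nat) (vo : nat -> Ob C) (vm : nat -> mor C)
    (e : entry) : Prop :=
  match e with
  | inl (x, X) => [/\ (x < n)%N, x \in os & vo x = X]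
  | inr (f, u) => [/\ (f < n)%N, f \in ms & vm f = u]
  end.

Definition ctx_ok n os ms vo vm (G : list entry) : Prop :=
  forall e, List.In e G -> entry_ok n os ms vo vm e.

Lemma ctx_ok_ob n os ms vo vm G X : ctx_ok n os ms vo vm G ->
  ctx_ok n.+1 (n :: os) ms [eta vo with n |-> X] vm (inl (n, X) :: G).
Proof.
move=> ok e [<-|/ok]; first by split; rewrite ?mem_head //= eqxx.
case: e => -[x y] [xn xo <-]; split=> //; try exact: ltnW; try exact: ltnS.
- by rewrite inE xo orbT.
- by rewrite /= ltn_eqF.
Qed.

Arguments ctx_ok_ob {n os ms vo vm G} X _.

Lemma ctx_ok_mor n os ms vo vm G u : ctx_ok n os ms vo vm G ->
  ctx_ok n.+1 os (n :: ms) vo [eta vm with n |-> u] (inr (n, u) :: G).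
Proof.
move=> ok e [<-|/ok]; first by split; rewrite ?mem_head //= eqxx.
case: e => -[x y] [xn xo <-]; split=> //; try exact: ltnW; try exact: ltnS.
- by rewrite inE xo orbT.
- by rewrite /= ltn_eqF.
Qed.

Arguments ctx_ok_mor {n os ms vo vm G} u _.

Section Scoped.
Hypothesis hom0 : forall X Y : Ob C, Hom X Y.

(** Bodies of binders are related for every value of the bound variable, so descending below a
    binder takes some morphism; [hom0] supplies one. *)
Lemma compile_scoped G A A' : wf G A A' -> forall n os ms vo vm,
  ctx_ok n os ms vo vm G -> cat_scoped os ms (compile A n).
Proof.
elim=> {G A A'} /=.
- by move=> G x y X Y f g u v fu gv n os ms vo vm ok;
    have [_ -> _] := ok _ fu; have [_ -> _] := ok _ gv.
- by move=> G A A' _ IH n os ms vo vm /IH.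
- by move=> G A A' B B' _ IA _ IB n os ms vo vm ok;
    rewrite (IA _ _ _ _ _ ok) (IB _ _ _ _ _ ok).
- by move=> G A A' B B' _ IA _ IB n os ms vo vm ok;
    rewrite (IA _ _ _ _ _ ok) (IB _ _ _ _ _ ok).
- by move=> G A A' B B' _ IA _ IB n os ms vo vm ok;
    rewrite (IA _ _ _ _ _ ok) (IB _ _ _ _ _ ok).
- move=> G k k' _ IH n os ms vo vm ok.
  exact: IH (ctx_ok_ob (vo 0%N) ok).
- move=> G k k' _ IH n os ms vo vm ok.
  exact: IH (ctx_ok_ob (vo 0%N) ok).
- move=> G x y X Y k k' xX yY _ IH n os ms vo vm ok.
  have [_ -> _] := ok _ xX; have [_ -> _] := ok _ yY; rewrite mem_head.
  exact: IH (ctx_ok_mor (Mor (hom0 X Y)) ok).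
- move=> G x y X Y k k' xX yY _ IH n os ms vo vm ok.
  have [_ -> _] := ok _ xX; have [_ -> _] := ok _ yY; rewrite mem_head.
  exact: IH (ctx_ok_mor (Mor (hom0 X Y)) ok).
- move=> G x y z X Y Z f g u v k k' fu gv _ IH n os ms vo vm ok.
  have [_ fm _] := ok _ fu; have [_ gm _] := ok _ gv.
  rewrite mem_head !inE fm gm !orbT.
  exact: IH (ctx_ok_mor (Mor (hom0 X Z)) ok).
- move=> G x X k k' xX _ IH n os ms vo vm ok.
  have [_ -> _] := ok _ xX; rewrite mem_head.
  exact: IH (ctx_ok_mor (Mor (hom0 X X)) ok).
Qed.

End Scoped.

Lemma compile_sat G A A' : wf G A A' -> forall n os ms vo vm,
  ctx_ok n os ms vo vm G -> (cat_sat vo vm (compile A n) <-> denote A').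
Proof.
elim=> {G A A'} /=.
- move=> G x y X Y f g u v fu gv n os ms vo vm ok.
  have [_ _ ->] := ok _ fu; have [_ _ ->] := ok _ gv.
  by split=> [/Mor_inj|->].
- by move=> G A A' _ IH n os ms vo vm /IH ->.
- by move=> G A A' B B' _ IA _ IB n os ms vo vm ok;
    rewrite (IA _ _ _ _ _ ok) (IB _ _ _ _ _ ok).
- by move=> G A A' B B' _ IA _ IB n os ms vo vm ok;
    rewrite (IA _ _ _ _ _ ok) (IB _ _ _ _ _ ok).
- by move=> G A A' B B' _ IA _ IB n os ms vo vm ok;
    rewrite (IA _ _ _ _ _ ok) (IB _ _ _ _ _ ok).
- move=> G k k' _ IH n os ms vo vm ok.
  by split=> h X; apply/(IH _ _ _ _ _ _ _ (ctx_ok_ob X ok)).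
- move=> G k k' _ IH n os ms vo vm ok.
  by split=> -[X h]; exists X; apply/(IH _ _ _ _ _ _ _ (ctx_ok_ob X ok)).
- move=> G x y X Y k k' xX yY _ IH n os ms vo vm ok.
  have [_ _ eX] := ok _ xX; have [_ _ eY] := ok _ yY.
  rewrite eqxx eX eY; split=> [h u|h [X' Y' u]].
    by apply/(IH _ _ _ _ _ _ _ (ctx_ok_mor (Mor u) ok)); exact: h (Mor u) _.
  move=> [/= eX' eY']; subst X' Y'.
  exact/(IH _ _ _ _ _ _ _ (ctx_ok_mor (Mor u) ok)).
- move=> G x y X Y k k' xX yY _ IH n os ms vo vm ok.
  have [_ _ eX] := ok _ xX; have [_ _ eY] := ok _ yY.
  rewrite eqxx eX eY; split=> [[[X' Y' u] [[/= eX' eY'] h]]|[u h]].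
    subst X' Y'; exists u.
    exact/(IH _ _ _ _ _ _ _ (ctx_ok_mor (Mor u) ok)).
  exists (Mor u); split=> //.
  exact/(IH _ _ _ _ _ _ _ (ctx_ok_mor (Mor u) ok)).
- move=> G x y z X Y Z f g u v k k' fu gv _ IH n os ms vo vm ok.
  have [fn _ ef] := ok _ fu; have [gn _ eg] := ok _ gv.
  rewrite eqxx !ltn_eqF // ef eg; split=> [[w [/is_comp_Mor ->]]|h].
    by move/(IH _ _ _ _ _ _ _ (ctx_ok_mor (Mor (compm u v)) ok)).
  exists (Mor (compm u v)); split; first exact/is_comp_Mor.
  exact/(IH _ _ _ _ _ _ _ (ctx_ok_mor (Mor (compm u v)) ok)).
- move=> G x X k k' xX _ IH n os ms vo vm ok.
  have [_ _ eX] := ok _ xX; rewrite eqxx eX; split=> [[w [->]]|h].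
    by move/(IH _ _ _ _ _ _ _ (ctx_ok_mor (Mor (idm X)) ok)).
  exists (Mor (idm X)); split=> //.
  exact/(IH _ _ _ _ _ _ _ (ctx_ok_mor (Mor (idm X)) ok)).
Qed.

Lemma compile_sentence A A' (X0 : Ob C) : (forall X Y : Ob C, Hom X Y) ->
    wf [::] A A' ->
  cat_sentence (compile A 0) /\ (cat_true C (compile A 0) <-> denote A').
Proof.
move=> hom0 AA'.
have ok vo vm : ctx_ok 0 [::] [::] vo vm [::] by [].
pose vo (_ : nat) := X0; pose vm (_ : nat) := Mor (idm X0).
split; first exact: (compile_scoped hom0 AA' (ok vo vm)).
split=> [/(_ vo vm)|A'h vo' vm']; last exact/(compile_sat AA' (ok vo' vm')).
by move/(compile_sat AA' (ok vo vm)).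
Qed.

End Adequacy.

(** * Small types and well-orders *)

(* [small] pins the universe of [tree], in which the index types of the free
   modules below must live. *)
Definition small (T : Type) : Prop :=
  exists t : tree, let: Tree A _ := t in exists f : T -> A, injective f.

Definition leaf : tree := Tree (fun e : False => match e with end).

Lemma small_inj (T U : Type) (f : T -> U) : injective f -> small U -> small T.
Proof.
move=> fI [[A t] [g gI]]; exists (Tree t), (g \o f).
by move=> x y /gI/fI.
Qed.

Lemma small_nat : small nat.
Proof. by exists (Tree (fun _ : nat => leaf)), id. Qed.

Lemma small_bool : small bool.
Proof. by exists (Tree (fun _ : bool => leaf)), id. Qed.

Lemma small_prod (T U : Type) : small T -> small U -> small (T * U).
Proof.
move=> [[A t] [f fI]] [[B u] [g gI]].
exists (Tree (fun _ : A * B => leaf)), (fun x => (f x.1, g x.2)).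
by move=> [x y] [x' y'] /= [/fI -> /gI ->].
Qed.

Lemma small_sum (T U : Type) : small T -> small U -> small (T + U).
Proof.
move=> [[A t] [f fI]] [[B u] [g gI]].
exists (Tree (fun _ : A + B => leaf)).
exists (fun x => match x with inl x => inl (f x) | inr y => inr (g y) end).
by move=> [x|x] [y|y] //= [] => [/fI|/gI] ->.
Qed.

(** A function is sent to the characteristic function of its graph on codes; extending it to all
    codes would take a default value. *)
Lemma small_fun (T U : Type) : small T -> small U -> small (T -> U).
Proof.
move=> [[A t] [f fI]] [[B u] [g gI]].
exists (Tree (fun _ : A -> B -> bool => leaf)).
exists (fun h a b => `[< exists x, f x = a /\ g (h x) = b >]) => h k e.
apply: funext => x; have /asboolP : `[< exists y, f y = f x /\ g (k y) = g (h x) >].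
  by move/(congr1 (fun F => F (f x) (g (h x)))): e => /= <-; apply/asboolP; exists x.
by move=> [y [/fI -> /gI ->]].
Qed.

Lemma small_set (T : Type) : small T -> small (set T).
Proof.
move=> sT; apply: (@small_inj _ (T -> bool) (fun A x => `[< A x >])).
  move=> A B e; apply/predeqP => x.
  have exy : `[< A x >] = `[< B x >] := congr1 (fun F => F x) e.
  by split=> /asboolP; [rewrite exy|rewrite -exy] => /asboolP.
exact: small_fun sT small_bool.
Qed.

Lemma small_seq (T : Type) : small T -> small (seq T).
Proof.
move=> [[A t] [f fI]]; exists (Tree (fun _ : seq A => leaf)), (map f).
exact: inj_map.
Qed.

Lemma small_sig (T : Type) (P : T -> Prop) : small T -> small {x | P x}.
Proof.
apply: (@small_inj _ _ (@sval T P)) => -[x Px] [y Py] /= exy; subst y.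
by congr exist; apply: Prop_irrelevance.
Qed.

(** This is replacement. The index type is cut down to the image of [g], so that no branch of the
    tree lacks a value. *)
Lemma small_set_of (T : Type) (f : T -> V) : small T ->
  exists x, members x = range f.
Proof.
move=> [[A t] [g gI]].
pose B := {a : A | exists x, g x = a}.
pose F (b : B) := f (projT1 (cid (svalP b))).
have FE x (p : exists y, g y = g x) : F (exist _ (g x) p) = f x.
  by rewrite /F; case: (cid _) => y /= /gI ->.
exists (\pi_V (Tree (fun b => repr (F b)))); rewrite members_Tree.
apply/seteqP; split=> v [].
  move=> b _ <-; rewrite reprK; case: b => a p; have [x gx] := p.
  by subst a; exists x; rewrite ?FE.
move=> x _ <-; exists (exist _ (g x) (ex_intro _ x erefl)) => //.
by rewrite reprK FE.
Qed.

Lemma small_members (x : V) : small (members x).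
Proof.
have : small {y | members x y}.
  rewrite -[x]reprK; case: (repr x) => A f; rewrite members_Tree.
  have ex (y : {y | range (fun a => \pi_V (f a)) y}) :
      exists a, \pi_V (f a) = sval y.
    by case: y => y p; have [a _ ya] := p; exists a.
  have [h hP] := boolp.choice ex.
  exists (Tree f), h => -[y py] [z pz] e.
  by apply: eq_exist; have := hP (exist _ y py); rewrite e hP.
apply: (@small_inj _ _ (fun y : members x =>
  exist (members x) (\val y) (set_mem (valP y)))).
by move=> y z [/val_inj].
Qed.

Lemma is_set_small (T : Type) : is_set T -> small T.
Proof.
move=> [x [f [fI fx]]].
have fm t : f t \in members x by rewrite -fx; apply/mem_set; exists t.
apply: (@small_inj _ _ (fun t => SigSub (fm t) : members x) _ (small_members x)).
by move=> s t /(congr1 \val) /= /fI.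
Qed.

Definition strict_wo (T : Type) (lt : T -> T -> Prop) : Prop :=
  [/\ well_founded lt, (forall x y z, lt x y -> lt y z -> lt x z) &
      forall x y, [\/ lt x y, x = y | lt y x]].

Lemma wf_min (T : Type) (lt : T -> T -> Prop) (P : T -> Prop) :
  well_founded lt -> (exists x, P x) ->
  exists2 x, P x & forall y, lt y x -> ~ P y.
Proof.
move=> wf [x0]; elim/(well_founded_ind wf): x0 => x IH Px.
have [[y yx Py]|nP] := pselect (exists2 y, lt y x & P y); first exact: IH yx Py.
by exists x => // y yx Py; apply: nP; exists y.
Qed.

Lemma wf_irr (T : Type) (lt : T -> T -> Prop) x : well_founded lt -> ~ lt x x.
Proof.
move=> wf; by elim/(well_founded_ind wf): x => x IH xx; apply: (IH x xx xx).
Qed.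

Lemma min_wf (T : Type) (lt : T -> T -> Prop) :
  (forall P : T -> Prop, (exists x, P x) ->
     exists2 x, P x & forall y, lt y x -> ~ P y) -> well_founded lt.
Proof.
move=> mn x; apply: contrapT => nx.
have [y ny ymin] := mn (fun x => ~ Acc lt x) (ex_intro _ x nx).
by apply: ny; constructor=> z /ymin/contrapT.
Qed.

Lemma wo_exists (T : Type) : exists lt : T -> T -> Prop, strict_wo lt.
Proof.
have [R woR] := well_ordering_principle {classic T}.
have woR' : wo_chain R predT by move=> A _; apply: woR.
have tot := wo_chainW woR'; have anti := wo_chain_antisymmetric woR'.
pose lt (x y : T) := R x y /\ x <> y.
have min P : (exists x, P x) -> exists2 x, P x & forall y, lt y x -> ~ P y.
  move=> [x0 Px0].
  have [|m [[/asboolP mn mmin] _]] := woR [pred x : {classic T} | `[< P x >]].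
    by exists x0; apply/asboolP.
  exists m => // y [Rym ynm] Py; apply: ynm; apply: anti => //.
  by rewrite Rym mmin //; apply/asboolP.
have tri x y : [\/ lt x y, x = y | lt y x].
  have [->|nxy] := pselect (x = y); first by constructor 2.
  have /orP[Rxy|Ryx] := tot x y isT isT; first by constructor 1.
  by constructor 3; split=> // /esym.
have wf := min_wf min; exists lt; split=> // x y z xy yz.
have [//|xz|zx] := tri x z.
  by subst z; case: xy yz => Rxy nxy [Ryx _]; case: nxy; apply: anti => //; rewrite Rxy.
(* A failure of transitivity is now a cycle of three elements, which has no least member. *)
have [w [->|[->|->]] wmin] := wf_min wf (ex_intro (fun w => w = x \/ w = y \/ w = z) x (or_introl erefl)).
- by case: (wmin _ zx); auto.
- by case: (wmin _ xy); auto.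
- by case: (wmin _ yz); auto.
Qed.

Lemma strict_wo_pull (T U : Type) (f : T -> U) (lt : U -> U -> Prop) :
  injective f -> strict_wo lt -> strict_wo (fun x y => lt (f x) (f y)).
Proof.
move=> fI [wf tr tri]; split.
- move=> x; move: {2}(f x) (erefl (f x)) => u.
  elim/(well_founded_ind wf): u x => u IH x fx; constructor=> y yx.
  by apply: IH (erefl _); rewrite -fx.
- by move=> x y z; apply: tr.
- move=> x y; have [xy|/fI xy|yx] := tri (f x) (f y).
  + by constructor 1.
  + by constructor 2.
  + by constructor 3.
Qed.

(** * Ladders with stationary labels *)

(* The Hartogs number of [Y := nat -> bool + Q], which is regular and larger
   than [Q].  By Solovay's argument, some position [n] of a ladder system on the
   points of cofinality omega takes unboundedly many values stationarily
   often; these values serve as labels. *)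
Section Ladder.
Variables (Q : Type) (q0 : Q).

(** This type absorbs pairs, an extra point, [nat] and [Q], so being of size at most [Y] is
    preserved by all the constructions below. *)
Let Y : Type := nat -> bool + Q.

Let subY (T : Type) : Prop := exists f : T -> Y, injective f.

Let subY_inj (T U : Type) (f : T -> U) : injective f -> subY U -> subY T.
Proof. by move=> fI [g gI]; exists (g \o f) => x y /gI/fI. Qed.

Let subY_prod (T U : Type) : subY T -> subY U -> subY (T * U).
Proof.
move=> [f fI] [g gI].
exists (fun p n => if odd n then f p.1 n./2 else g p.2 n./2) => -[x y] [x' y'] e.
have ex n : f x n = f x' n.
  by have /= := congr1 (fun h => h n.*2.+1) e; rewrite odd_double /= uphalf_double.
have ey n : g y n = g y' n.
  by have /= := congr1 (fun h => h n.*2) e; rewrite odd_double doubleK.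
by congr pair; [apply: fI|apply: gI]; apply: funext.
Qed.

Let subY_option (T : Type) : subY T -> subY (option T).
Proof.
move=> [f fI].
exists (fun o => match o with
  | Some x => fun n => if n is n'.+1 then f x n' else inl true
  | None => fun _ => inl false end).
case=> [x|] [y|] // e; try by have /= := congr1 (fun h => h 0%N) e.
by congr Some; apply/fI/funext => n; have := congr1 (fun h => h n.+1) e.
Qed.

Let subY_nat : subY nat.
Proof.
exists (fun n m => inl (m == n)) => m n e.
by have [] := congr1 (fun h => h m) e; rewrite eqxx => /esym/eqP.
Qed.

Let subYQ : subY Q.
Proof. by exists (fun q _ => inr q) => p q /(congr1 (fun h => h 0%N)) []. Qed.

Let not_subY_set : ~ subY (set Y).
Proof.
move=> [f fI]; pose D : set Y := [set y | exists2 A, y = f A & ~ A y].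
have [DfD|nDfD] := pselect (D (f D)); last by apply: (nDfD); exists D.
by have [A /fI <-] := DfD.
Qed.

Lemma ladder_exists : small Q -> exists (W : Type) (lt : W -> W -> Prop)
    (ladder : nat -> W -> W) (label : W -> Q) (w0 : W),
  [/\ strict_wo lt, small W,
      forall n x, ladder n x = x \/ lt (ladder n x) x,
      forall x y, lt y x -> exists n0, forall n, (n0 <= n)%N -> lt y (ladder n x) &
      forall (f : W -> W) q, exists d, [/\ label d = q,
        forall n, lt (ladder n d) d & forall c, lt c d -> lt (f c) d]].
Proof.
move=> smallQ.
have [lt0 wo0] := wo_exists (set Y).
(* The Hartogs number as an initial segment of a well-order of [set Y]: the points with at most [Y]
   predecessors. *)
pose W := {x | subY {y | lt0 y x}}.
pose lt (x y : W) := lt0 (sval x) (sval y).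
have svI : injective (fun x : W => sval x).
  by move=> [x px] [y py] /= xy; apply: eq_exist.
have wo : strict_wo lt := strict_wo_pull svI wo0.
have [wf tr tri] := wo.
have irr x : ~ lt x x := @wf_irr _ _ x wf.
have seg (w : W) : subY {v | lt v w}.
  have h (v : {v : W | lt v w}) : lt0 (sval (sval v)) (sval w) by case: v.
  apply: (@subY_inj _ _
    (fun v => exist (fun y => lt0 y (sval w)) (sval (sval v)) (h v)) _ (svalP w)).
  by move=> [u pu] [v pv] /= [/svI uv]; apply: eq_exist.
(* If every point lies in [W], then [W] is as large as [set Y]; otherwise the least point outside
   has all its predecessors in [W]. *)
have nW : ~ subY W.
  have [allW|/existsNP nall] := pselect (forall x, subY {y | lt0 y x}).
    move=> sW; apply: not_subY_set.
    by apply: (@subY_inj _ W (fun x => exist _ x (allW x)) _ sW) => x y [].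
  have [wf0 _ _] := wo0.
  have [x nx xmin] := wf_min wf0 nall; move=> sW; apply: nx.
  have h (y : {y | lt0 y x}) : subY {z | lt0 z (sval y)}.
    by apply: contrapT; apply: xmin; case: y.
  apply: (@subY_inj _ W (fun y => exist _ (sval y) (h y)) _ sW).
  by move=> [u pu] [v pv] /= [uv]; apply: eq_exist.
have [w0 _] : exists w0 : W, True.
  apply: contrapT => nw; apply: nW; exists (fun w => match nw (ex_intro _ w I) with end).
  by move=> x; case: (nw (ex_intro _ x I)).
have [code codeI] : exists code : W -> W -> Y, forall w u v,
    lt u w -> lt v w -> code w u = code w v -> u = v.
  have /boolp.choice[F FI] w : exists f : W -> Y, forall u v,
      lt u w -> lt v w -> f u = f v -> u = v.
    have [f fI] := seg w.
    exists (fun u => if pselect (lt u w) is left p then f (exist _ u p)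
              else fun _ => inl true) => u v uw vw.
    by case: pselect => // p; case: pselect => // p' /fI [].
  by exists F.
(* Regularity: if [g] were unbounded, each [b] would lie at or below some [g (t b)], and [t b]
   together with the code of [b] below [g (t b)] would embed [W] into [Y]. *)
have bound (T : Type) (g : T -> W) : subY T -> exists b, forall t, lt (g t) b.
  move=> sT; apply: contrapT => nb; apply: nW.
  have /boolp.choice[t tP] b : exists t, ~ lt (g t) b.
    by apply/existsNP => h; apply: nb; exists b.
  have tP' b : b <> g (t b) -> lt b (g (t b)).
    by move=> ne; case: (tri b (g (t b))) => // /tP.
  have sY : subY Y by exists id.
  apply: (@subY_inj _ _ (fun b => (t b,
      if pselect (b = g (t b)) is left _ then None else Some (code (g (t b)) b)))
    _ (subY_prod sT (subY_option sY))).
  move=> b b' []; case: pselect => [e|/tP' lb]; case: pselect => [e'|/tP' lb'] //.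
    by move=> tt _; rewrite e e' tt.
  by move=> tt []; rewrite -tt in lb' *; apply: codeI.
pose le x y := x = y \/ lt x y.
have le_lt x y z : le x y -> lt y z -> lt x z by move=> [->//|]; apply: tr.
have lt_le x y z : lt x y -> le y z -> lt x z by move=> xy [<-//|]; apply: tr xy.
have nlt x y : ~ lt x y -> le y x.
  by case: (tri x y) => // [->|]; [left|right].
have segle (w : W) : subY {v | le v w}.
  apply: (@subY_inj _ _ (fun v : {v | le v w} =>
      if pselect (lt (sval v) w) is left p then
        Some (exist (fun v => lt v w) (sval v) p) else None)
    _ (subY_option (seg w))).
  move=> [u pu] [v pv]; case: pselect => /= p; case: pselect => //= p'.
    by move=> [uv]; apply: eq_exist.
  move=> _; apply: eq_exist.
  by case: pu => // ->; case: pv.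
have subY_bool : subY bool.
  by apply: (@subY_inj _ _ nat_of_bool _ subY_nat) => -[] [].
have bound1 (f : W -> W) c : exists b, lt c b /\ forall c', le c' c -> lt (f c') b.
  have [b1 h1] := bound _ (fun v : {v | le v c} => f (sval v)) (segle c).
  have [b2 h2] := bound _ (fun o : bool => if o then c else b1)
    subY_bool.
  exists b2; split; first exact: h2 true.
  by move=> c' c'c; apply: tr (h1 (exist _ c' c'c)) (h2 false).
pose omega d := exists s : nat -> W, (forall n, lt (s n) d) /\
  forall y, lt y d -> exists n0, forall n, (n0 <= n)%N -> lt y (s n).
(* The supremum of the iterates of [next] has cofinality omega and is closed under [f]. *)
have closed (f : W -> W) g : exists d, [/\ omega d, lt g d &
    forall c, lt c d -> lt (f c) d].
  have /boolp.choice[next nextP] := bound1 f.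
  pose s n := iter n next g.
  have s1 n : lt (s n) (s n.+1) by have [] := nextP (s n).
  have sm m n : (m <= n)%N -> le (s m) (s n).
    move=> /subnK <-; elim: (n - m)%N => [|k IH]; first by left.
    by right; apply: le_lt IH (s1 _).
  have [d dP dmin] := wf_min wf (bound _ s subY_nat).
  have cof y : lt y d -> exists n, le y (s n).
    move=> /dmin/existsNP[n nn]; exists n; exact: nlt.
  exists d; split; last 2 first.
  - exact: dP 0%N.
  - move=> c /cof[n cn]; apply: tr (dP n.+1).
    by have [_] := nextP (s n); apply.
  - exists s; split=> // y /cof[n yn]; exists n.+1 => m nm.
    apply: lt_le (le_lt _ _ _ yn (s1 n)) (sm _ _ nm).
(* Where the cofinality is not omega, the ladder is constantly [d], which still satisfies the
   cofinality clause. *)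
have /boolp.choice[lad ladP] d : exists s : nat -> W,
    [/\ forall n, le (s n) d, omega d -> forall n, lt (s n) d &
     forall y, lt y d -> exists n0, forall n, (n0 <= n)%N -> lt y (s n)].
  have [[s [s1 s2]]|no] := pselect (omega d).
    by exists s; split=> // n; right.
  by exists (fun _ => d); split=> // [n|y yd]; [left|exists 0%N].
(* Stationarity of the set of points whose rung [n] is [b], with the closed unbounded sets given by
   closure under a function. *)
pose stat n b := forall f : W -> W, exists d, [/\ omega d, lad d n = b &
  forall c, lt c d -> lt (f c) d].
(* Suppose each position [n] has a bound [g n] beyond which no value is stationary, and let [F]
   dominate the functions that witness this. A point [d] closed under [F] and above all bounds has a
   rung above the bound of its position, yet [d] is closed under the very function that refutes this
   rung. *)
have [n unb] : exists n, forall g, exists2 b, le g b & stat n b.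
  apply: contrapT => no.
  have /boolp.choice[g gP] n : exists g, forall b, le g b -> ~ stat n b.
    apply: contrapT => h; apply: no; exists n => g; apply: contrapT => h'.
    by apply: h; exists g => b gb sb; apply: h'; exists b.
  have ex (p : nat * W) : exists f : W -> W, le (g p.1) p.2 ->
      forall d, omega d -> lad d p.1 = p.2 -> ~ (forall c, lt c d -> lt (f c) d).
    have [/gP/existsNP[f fP]|] := pselect (le (g p.1) p.2); last by exists id.
    by exists f => _ d od dp h; apply: fP; exists d.
  have [f fP] := boolp.choice ex.
  have [gb gbP] := bound _ g subY_nat.
  have /boolp.choice[F FP] c : exists b, forall n b' c', le b' c -> le c' c ->
      lt (f (n, b') c') b.
    have [b bP] := bound _ (fun p : nat * {v | le v c} * {v | le v c} =>
      f (p.1.1, sval p.1.2) (sval p.2))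
      (subY_prod (subY_prod subY_nat (segle c)) (segle c)).
    by exists b => m b' c' h h'; apply: (bP (m, exist _ b' h, exist _ c' h')).
  have [d [od gd Fd]] := closed F gb.
  have [_ /(_ od) ld /(_ _ gd) [m /(_ m (leqnn m)) gm]] := ladP d.
  apply: (fP (m, lad d m) _ d od erefl) => [|c cd /=].
    by right; apply: tr (gbP m) gm.
  have [cl|lc|cl] := tri c (lad d m).
  - apply: tr (FP (lad d m) m _ c _ _) (Fd _ (ld m)); [by left|by right].
  - by apply: tr (FP c m _ c _ _) (Fd _ cd); [rewrite lc; left|left].
  - by apply: tr (FP c m _ c _ _) (Fd _ cd); [right|left].
(* Recursion along a well-order of [Q] picks stationary values, each above the earlier ones;
   regularity keeps the recursion going. *)
have [ltQ [wfQ trQ triQ]] := wo_exists Q.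
have ex q (i : forall p, ltQ p q -> W) : exists b, stat n b /\ forall p h, lt (i p h) b.
  have [b bP] := bound {p | ltQ p q} (fun p => i (sval p) (proj2_sig p))
    (@subY_inj _ _ sval (fun x y => @eq_sig_hprop _ _
       (fun _ => @Prop_irrelevance _) x y) subYQ).
  have [b' bb' sb'] := unb b; exists b'; split=> // p h.
  exact: (lt_le _ _ _ (bP (exist _ p h)) bb').
pose i := Fix wfQ (fun _ => W) (fun q i => projT1 (cid (ex q i))).
have iE q : i q = projT1 (cid (ex q (fun p _ => i p))).
  rewrite /i Fix_eq // => {}q j k jk; congr (projT1 (cid (ex q _))).
  by apply: functional_extensionality_dep => p; apply: funext => h; apply: jk.
have iP q : stat n (i q) /\ forall p, ltQ p q -> lt (i p) (i q).
  by rewrite iE; case: cid => b [].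
have iI p q : i p = i q -> p = q.
  move=> pq; have [h|//|h] := triQ p q.
    by have := (iP q).2 p h; rewrite pq => /irr.
  by have := (iP p).2 q h; rewrite pq => /irr.
pose label d := if pselect (exists q, i q = lad d n) is left h then projT1 (cid h) else q0.
exists W, lt, (fun n d => lad d n), label, w0; split=> //.
- by apply: small_sig; apply/small_set/small_fun/small_sum/smallQ/small_bool/small_nat.
- by move=> m x; have [h _ _] := ladP x; case: (h m); auto.
- by move=> x y yx; have [_ _] := ladP x; apply.
- move=> f q; have [d [od ld fd]] := (iP q).1 f; exists d; split=> //.
    rewrite /label; case: pselect => [h|[]]; last by exists q.
    by case: cid => p /= pd; apply: iI; rewrite pd.
  by have [_ h _] := ladP d; apply: h.
Qed.

End Ladder.

(** * Modules carried by sets *)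

Lemma mem_wf : well_founded (fun y x : V => members x y).
Proof.
move=> x; rewrite -[x]reprK; elim: (repr x) => A f IH.
by constructor=> y; rewrite members_Tree => -[a _ <-].
Qed.

(** The elements are the pairs of [h t] and [y], where [y] has all bad sets as elements. If they
    formed a bad set [c], then [c] in [y] in [j t] in [c] would contradict foundation. *)
Lemma fresh_set (T : Type) (bad : seq V) : small T ->
  exists j : T -> V, injective j /\ forall c, range j = members c ->
    (exists t : T, True) -> ~ List.In c bad.
Proof.
move=> sT; have [h hI] : exists h : T -> V, injective h.
  have [[A t] [f fI]] := sT; have [x [g [gI _]]] := type_is_set A.
  by exists (g \o f) => u v /gI/fI.
have [y yE] : exists y, forall c, List.In c bad -> members y c.
  have sb : small {c | List.In c bad}.
    apply: (@small_inj _ _ (fun c : {c | List.In c bad} => index (sval c) bad) _ small_nat).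
    move=> [c pc] [d pd] /= e; apply: eq_exist.
    have inb z : List.In z bad -> z \in bad.
      elim: bad {pc pd e} => //= b s IH [->|/IH]; rewrite inE ?eqxx // => ->.
      by rewrite orbT.
    by rewrite -(nth_index c (inb _ pc)) e nth_index // inb.
  have [y yE] := small_set_of sval sb; exists y => c pc.
  by rewrite yE; exists (exist _ c pc).
have pair t : exists p, members p = range (fun b : bool => if b then h t else y).
  exact: small_set_of small_bool.
have [j jE] := boolp.choice pair.
have inj t : members (j t) (h t) by rewrite jE; exists true.
have jy t : members (j t) y by rewrite jE; exists false.
have jP t z : members (j t) z -> z = h t \/ z = y.
  by rewrite jE => -[[] _ <-]; auto.
exists j; split=> [s t st|c jc [t _] cb].
  apply: hI; have := inj s; rewrite st => /jP[//|hs].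
  by have := inj t; rewrite -st => /jP[->//|->].
have ct : members c (j t) by rewrite -jc; exists t.
have yc := yE c cb; have jty := jy t.
have [z [zc|[zy|zt]] zmin] :=
    wf_min mem_wf (ex_intro (fun z => z = c \/ z = y \/ z = j t) c (or_introl erefl)).
- by apply: (zmin (j t)); [rewrite zc|auto].
- by apply: (zmin c); [rewrite zy|auto].
- by apply: (zmin y); [rewrite zt|auto].
Qed.

Section Modules.
Variable R : pzRingType.

Lemma linear_exists (U W : lmodType R) (f : U -> W) :
  (forall a u v, f (a *: u + v) = a *: f u + f v) ->
  exists h : {linear U -> W}, h =1 f.
Proof.
move=> lf.
pose h : {linear U -> W} := HB.pack f (GRing.isLinear.Build R U W *:%R f lf).
by exists h.
Qed.

(** Transport of structure to a set of fresh elements. Avoiding [bad] serves the interpretation of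
    equality between objects, where a new module has to differ from those already named. *)
Lemma lmodule_exists (T : lmodType R) (bad : seq (lmodule R)) : small T ->
  exists (X : lmodule R) (f : {linear T -> elements X}) (g : {linear elements X -> T}),
    [/\ cancel f g, cancel g f & ~ List.In X bad].
Proof.
move=> sT; have [j [jI jbad]] := fresh_set (map (@carrier R) bad) sT.
have [c cE] := small_set_of j sT.
have jc t : j t \in members c by apply/mem_set; rewrite cE; exists t.
have cs v : members c v -> range j v by rewrite cE.
pose f t : members c := SigSub (jc t).
have fI : injective f by move=> s t /(congr1 \val) /= /jI.
have ex (x : members c) : exists t, f t = x.
  by have [t _ tx] := cs _ (set_mem (valP x)); exists t; apply: val_inj.
have [g gK] := boolp.choice ex.
have fK : cancel f g by move=> t; apply: fI; rewrite gK.
pose add x y := f (g x + g y); pose opp x := f (- g x).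
pose scale a x := f (a *: g x).
have addA : associative add by move=> x y z; rewrite /add !fK addrA.
have addC : commutative add by move=> x y; rewrite /add addrC.
have add0 : left_id (f 0) add by move=> x; rewrite /add fK add0r gK.
have addN : left_inverse (f 0) opp add by move=> x; rewrite /add fK addNr.
have scaleA a b v : scale a (scale b v) = scale (a * b) v.
  by rewrite /scale fK scalerA.
have scale1 : left_id 1 scale by move=> x; rewrite /scale scale1r gK.
have scaleDr : right_distributive scale add.
  by move=> a x y; rewrite /scale /add !fK scalerDr.
have scaleDl v a b : scale (a + b) v = add (scale a v) (scale b v).
  by rewrite /scale /add !fK scalerDl.
pose X := LModule addA addC add0 addN scaleA scale1 scaleDr scaleDl.
have [f' f'E] : exists h : {linear T -> elements X}, h =1 f.
  by apply: linear_exists => a u v; congr f; rewrite !fK.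
have [g' g'E] : exists h : {linear elements X -> T}, h =1 g.
  apply: linear_exists => a u v; apply: fI; rewrite gK.
  by congr f; rewrite fK.
exists X, f', g'; split=> [x|x|Xbad].
- by rewrite f'E g'E fK.
- by rewrite f'E g'E gK.
- apply: (jbad c); rewrite ?cE //; first by exists 0.
  exact: (List.in_map (@carrier R) _ _ Xbad).
Qed.

Lemma zero_hom (X Y : lmodule R) : exists h : lhom X Y, forall x, h x = 0.
Proof. by apply: linear_exists => a u v; rewrite scaler0 addr0. Qed.

(** * Finite sums and copowers *)

Section FiniteSums.
Variables (I : Type) (W : lmodType R).

Let J : eqType := {classic I}.

Definition fin_supp (F : I -> W) := exists s : seq J, forall i, F i <> 0 -> (i : J) \in s.

(** The support is chosen, but by [fsumE] the value does not depend on it; without finite support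
    the value is the default 0. *)
Definition fsum (F : I -> W) : W :=
  if pselect (fin_supp F) is left h then \sum_(i <- undup (projT1 (cid h))) F i
  else 0.

Lemma fsumE (F : I -> W) (s : seq J) : uniq s ->
  (forall i, F i <> 0 -> (i : J) \in s) -> fsum F = \sum_(i <- s) F i.
Proof.
move=> us Fs; rewrite /fsum; case: pselect => [h|[]]; last by exists s.
case: cid => /= t Ft.
have red (r : seq J) : \sum_(i <- r) F i = \sum_(i <- [seq i <- r | F i != 0]) F i.
  rewrite big_filter [LHS](bigID (fun i => F i != 0)) /= [X in _ + X]big1 ?addr0 //.
  by move=> i /negbNE/eqP.
rewrite red [RHS]red; apply: (@perm_big _ _ _ J); apply: uniq_perm; rewrite ?filter_uniq ?undup_uniq //.
by move=> i; rewrite !mem_filter mem_undup; case: eqP => // /[dup] /Ft -> /Fs ->.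
Qed.

Lemma fsum_linear a (F G : I -> W) : fin_supp F -> fin_supp G ->
  fsum (fun i => a *: F i + G i) = a *: fsum F + fsum G.
Proof.
move=> [s Fs] [t Gt]; pose u := undup (s ++ t).
have uu : uniq u by rewrite undup_uniq.
have Fu i : F i <> 0 -> (i : J) \in u by move=> /Fs; rewrite mem_undup mem_cat => ->.
have Gu i : G i <> 0 -> (i : J) \in u.
  by move=> /Gt; rewrite mem_undup mem_cat orbC => ->.
rewrite (fsumE uu Fu) (fsumE uu Gu) (fsumE uu) ?scaler_sumr ?big_split //.
move=> i; have [F0|/Fu //] := pselect (F i = 0).
by rewrite F0 scaler0 add0r => /Gu.
Qed.

End FiniteSums.

Section Copower.
Variables (I : Type) (X : lmodType R).

Definition cpw : Type := {f : I -> X | fin_supp f}.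

Lemma cpw_eq (f g : cpw) : sval f =1 sval g -> f = g.
Proof. by case: f g => f pf [g pg] /= /funext fg; apply: eq_exist. Qed.

Lemma fin_supp0 : fin_supp (fun _ : I => 0 : X).
Proof. by exists [::]. Qed.

Lemma fin_suppL a (f g : I -> X) : fin_supp f -> fin_supp g ->
  fin_supp (fun i => a *: f i + g i).
Proof.
move=> [s fs] [t gt]; exists (s ++ t) => i; rewrite mem_cat.
have [->|/fs ->//] := pselect (f i = 0); have [->|/gt ->//] := pselect (g i = 0).
  by rewrite scaler0 addr0.
by rewrite orbT.
Qed.

Definition cpw_zero : cpw := exist _ _ fin_supp0.
(** All module operations are instances of this one, so finiteness of supports is checked once. *)
Definition cpw_lin a (f g : cpw) : cpw :=
  exist _ _ (fin_suppL a (svalP f) (svalP g)).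
Definition cpw_add (f g : cpw) := cpw_lin 1 f g.
Definition cpw_scale a f := cpw_lin a f cpw_zero.
Definition cpw_opp f := cpw_scale (-1) f.

HB.instance Definition _ := gen_eqMixin cpw.
HB.instance Definition _ := gen_choiceMixin cpw.

Lemma cpw_addA : associative cpw_add.
Proof. by move=> f g h; apply: cpw_eq => i /=; rewrite !scale1r addrA. Qed.
Lemma cpw_addC : commutative cpw_add.
Proof. by move=> f g; apply: cpw_eq => i /=; rewrite !scale1r addrC. Qed.
Lemma cpw_add0 : left_id cpw_zero cpw_add.
Proof. by move=> f; apply: cpw_eq => i /=; rewrite !scale1r add0r. Qed.
Lemma cpw_addN : left_inverse cpw_zero cpw_opp cpw_add.
Proof.
by move=> f; apply: cpw_eq => i /=; rewrite scale1r addr0 scaleN1r addNr.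
Qed.
HB.instance Definition _ :=
  GRing.isZmodule.Build cpw cpw_addA cpw_addC cpw_add0 cpw_addN.

Lemma cpw_scaleA a b v : cpw_scale a (cpw_scale b v) = cpw_scale (a * b) v.
Proof. by apply: cpw_eq => i /=; rewrite !addr0 scalerA. Qed.
Lemma cpw_scale1 : left_id 1 cpw_scale.
Proof. by move=> f; apply: cpw_eq => i /=; rewrite addr0 scale1r. Qed.
Lemma cpw_scaleDr : right_distributive cpw_scale +%R.
Proof. by move=> a f g; apply: cpw_eq => i /=; rewrite !addr0 !scale1r scalerDr. Qed.
Lemma cpw_scaleDl v : {morph cpw_scale^~ v : a b / a + b}.
Proof. by move=> a b; apply: cpw_eq => i /=; rewrite !addr0 scale1r scalerDl. Qed.
HB.instance Definition _ := GRing.Zmodule_isLmodule.Build R cpw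
  cpw_scaleA cpw_scale1 cpw_scaleDr cpw_scaleDl.

Lemma cpw_linE a (f g : cpw) i : sval (a *: f + g) i = a *: sval f i + sval g i.
Proof. by rewrite /= scale1r addr0. Qed.

Lemma fin_supp1 (i : I) x : fin_supp (fun k : I => if pselect (k = i) then x else 0 : X).
Proof.
exists [:: (i : {classic I})] => k; case: pselect => //= e _; rewrite e; exact: mem_head.
Qed.
Definition cpw_in i x : cpw := exist _ _ (fin_supp1 i x).

Lemma cpw_ind (P : cpw -> Prop) : P 0 ->
  (forall i x f, P f -> P (cpw_in i x + f)) -> forall f, P f.
Proof.
move=> P0 PS f; have [s fs] := svalP f; elim: s f fs => [|i s IH] f fs.
  suff -> : f = 0 by [].
  by apply: cpw_eq => i; apply: contrapT => /fs.
pose f' := cpw_in i (- sval f i) + f.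
have -> : f = cpw_in i (sval f i) + f'.
  apply: cpw_eq => k /=; rewrite !scale1r; case: pselect => [e|_] /=.
    by rewrite e addNKr.
  by rewrite !add0r.
apply/PS/IH => k /=; rewrite scale1r.
case: pselect => [e|ki] /=; first by rewrite e addNr.
by rewrite add0r => /fs; rewrite inE => /orP[/eqP //|].
Qed.

End Copower.

(** The universal property, with uniqueness of the induced map replaced by the induction principle
    [cp_ind], from which [cp_ext] recovers it. *)
Record copower (I : Type) (X : lmodule R) := MkCopower {
  cp_ob :> lmodule R;
  cp_in : I -> lhom X cp_ob;
  cp_out : forall Y : lmodule R, (I -> lhom X Y) -> lhom cp_ob Y;
  cp_outE : forall (Y : lmodule R) (g : I -> lhom X Y) i x,
    cp_out g (cp_in i x) = g i x;
  cp_ind : forall P : elements cp_ob -> Prop, P 0 ->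
    (forall i x p, P p -> P (cp_in i x + p)) -> forall p, P p
}.

Lemma copower_exists (I : Type) (X : lmodule R) : small I -> inhabited (copower I X).
Proof.
move=> sI; have sT : small (cpw I (elements X)).
  exact/small_sig/small_fun/small_members.
have [P [f [g [fK gK _]]]] := lmodule_exists [::] sT.
have ex i : exists h : lhom X P, h =1 (fun x => f (cpw_in i x)).
  apply: linear_exists => a u v; rewrite -linearP; congr (f _).
  apply: cpw_eq => k; rewrite cpw_linE /=.
  by case: (pselect (k = i)) => e /=; rewrite ?scaler0 ?addr0.
have [inj injE] := boolp.choice ex.
have exo (Y : lmodule R) (h : I -> lhom X Y) : exists k : lhom P Y,
    forall p, k p = fsum (fun i => h i (sval (g p) i)).
  apply: linear_exists => a u v.
  have fs p : fin_supp (fun i => h i (sval (g p) i)).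
    by have [s gs] := svalP (g p); exists s => i hi; apply: gs => /= e;
      rewrite e linear0 in hi.
  rewrite -fsum_linear //; congr fsum; apply: funext => i.
  by rewrite [g _]linearP cpw_linE linearP.
pose out Y h := projT1 (cid (exo Y h)).
have outE Y h p : out Y h p = fsum (fun i => h i (sval (g p) i)).
  by rewrite /out; case: cid.
split; exists P inj out.
- move=> Y h i x; rewrite outE (@fsumE _ _ _ [:: (i : {classic I})]) //; last first.
    move=> k; rewrite injE fK /=; case: pselect => [e _|_] /=; first by rewrite e mem_head.
    by rewrite linear0.
  by rewrite big_seq1 injE fK /=; case: pselect.
- move=> Q Q0 QS p; rewrite -(gK p); elim/cpw_ind: (g p) => [|i x u IH].
    by rewrite linear0.
  by rewrite linearD -injE; apply: QS.
Qed.

End Modules.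

(** * Second-order logic expressed in the category *)

(* A ruler [(N, M, io, z)] is a module [N] mapped by [io] to a module [M] with
   an endomorphism [z]. *)
Record ruler (O : Type) (M : O -> O -> Type) := Ruler {
  rN : O;
  rM : O;
  rio : M rN rM;
  rz : M rM rM
}.
Arguments Ruler {O M rN rM} rio rz.

(** A code for a function on the points of a ruler over [N]. The ruler [cZ] is not that of the
    values but is meant to be a sum of copies of it, one for each argument. *)
Record code (O : Type) (M : O -> O -> Type) (N : O) := Code {
  cZ : ruler M;
  cg : M N (rN cZ)
}.
Arguments Code {O M N cZ} cg.

Record rel (O : Type) (M : O -> O -> Type) := Rel {
  rP : ruler M;
  rcs : seq (code M (rN rP))
}.
Arguments Rel {O M rP} rcs.

(** The ruler is bundled with the point, so that the arguments of a relation can be points of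
    different rulers in one list. *)
Record spt (O : Type) (M : O -> O -> Type) (U : O) := Spt {
  sZ : ruler M;
  sx : M U (rN sZ);
  sp : M (rN sZ) U
}.
Arguments Spt {O M U sZ} sx sp.

(* The data by which ring elements are labelled: a ruler [fW] with ladder maps
   [fb], [fs], [fl], an augmentation [feps], a diagonal operator [fB], and a
   coded function [flam] to the points of the ruler [fK] of labels. *)
Record frame (O : Type) (M : O -> O -> Type) (U : O) := Frame {
  fW : ruler M;
  fP : O;
  fb : M (rN fW) fP;
  fs : M fP fP;
  fl : M fP (rN fW);
  feps : M (rN fW) U;
  fB : M (rN fW) (rN fW);
  fK : ruler M;
  flam : code M (rN fW)
}.
Arguments Frame {O M U fW fP} fb fs fl feps fB fK flam.

Section Formulas.
Variables (O : Type) (M : O -> O -> Type).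
Local Notation form := (form M).
Local Notation ruler := (ruler M).

Definition fCompEq X Y Y' Z (f : M Y Z) (g : M X Y) (f' : M Y' Z) (g' : M X Y') : form :=
  FComp f g (fun a => FComp f' g' (fun b => FEq a b)).

Definition fEqComp X Y Z (h : M X Z) (f : M Y Z) (g : M X Y) : form :=
  FComp f g (fun a => FEq h a).

(** Morphisms of rulers: [h] has to extend to the larger modules compatibly with their
    endomorphisms. On a standard ruler exactly the triangular maps do. *)
Definition fRhom (Z Z' : ruler) (h : M (rN Z) (rN Z')) : form :=
  FEx (rM Z) (rM Z') (fun k =>
    FAnd (fCompEq k (rio Z) (rio Z') h) (fCompEq k (rz Z) (rz Z') k)).

Definition fExRuler (k : ruler -> form) : form :=
  FExO (fun N => FExO (fun P => FEx N P (fun io => FEx P P (fun z =>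
    k (Ruler io z))))).

Definition fAllRuler (k : ruler -> form) : form :=
  FAllO (fun N => FAllO (fun P => FAll N P (fun io => FAll P P (fun z =>
    k (Ruler io z))))).

Fixpoint fExCodes (N : O) (m : nat) (k : seq (code M N) -> form) : form :=
  if m is m'.+1 then
    fExRuler (fun C => FEx N (rN C) (fun g =>
      fExCodes m' (fun cs => k (@Code _ _ N C g :: cs))))
  else k [::].

Fixpoint fAllCodes (N : O) (m : nat) (k : seq (code M N) -> form) : form :=
  if m is m'.+1 then
    fAllRuler (fun C => FAll N (rN C) (fun g =>
      fAllCodes m' (fun cs => k (@Code _ _ N C g :: cs))))
  else k [::].

Definition fExRel (m : nat) (k : rel M -> form) : form :=
  fExRuler (fun P => fExCodes m (fun cs => k (@Rel _ _ P cs))).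

Definition fAllRel (m : nat) (k : rel M -> form) : form :=
  fAllRuler (fun P => fAllCodes m (fun cs => k (@Rel _ _ P cs))).

Definition fGen (G : O) : form :=
  FAllO (fun X => FAllO (fun Y => FAll X Y (fun f => FAll X Y (fun g =>
    FImp (FAll G X (fun u => fCompEq f u g u)) (FEq f g))))).

Definition fRetract (U G : O) : form :=
  FEx U G (fun i => FEx G U (fun p => FComp p i (fun a => FId U (fun b => FEq a b)))).

Definition fUnit (U : O) : form :=
  FAnd (fGen U) (FAllO (fun G => FImp (fGen G) (fRetract U G))).

Variable U : O.
Local Notation spt := (spt M U).

Definition fTrue : form := FId U (fun i => FEq i i).

(** Being constant on the maps from the generator [U] amounts to being zero, and no zero object has
    to be named. *)
Definition fZero X Y (h : M X Y) : form :=
  FAll U X (fun f => FAll U X (fun g => fCompEq h f h g)).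

(** Addition recovered from the biproduct [B] of two copies of [U]: [d] is the pairing of the two
    summands and [s] the codiagonal. *)
Definition fAdd (r1 r2 r3 : M U U) : form :=
  FId U (fun e => FExO (fun B =>
    FEx U B (fun i1 => FEx U B (fun i2 => FEx B U (fun p1 => FEx B U (fun p2 =>
    FAnd (FAnd (fEqComp e p1 i1) (fEqComp e p2 i2))
    (FAnd (FAnd (FComp p1 i2 (fun h => fZero h)) (FComp p2 i1 (fun h => fZero h)))
    (FAnd (FAll U B (fun a => FAll U B (fun b =>
       FImp (fCompEq p1 a p1 b) (FImp (fCompEq p2 a p2 b) (FEq a b)))))
    (FEx U B (fun d => FEx B U (fun s =>
       FAnd (FAnd (fEqComp r2 p1 d) (fEqComp r3 p2 d))
       (FAnd (FAnd (fEqComp e s i1) (fEqComp e s i2)) (fEqComp r1 s d))))))))))))).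

(* The points of a ruler [Z] are the rank one idempotents [x p] of its
   endomorphism ring; [fLe] preorders them. *)
Definition fPt (Z : ruler) (x : M U (rN Z)) (p : M (rN Z) U) : form :=
  FAnd (FId U (fun e => fEqComp e p x))
    (FAll U U (fun c => FComp x c (fun xc => FComp xc p (fun t => fRhom t)))).

Definition fLe (Z : ruler) (x x' : M U (rN Z)) : form :=
  FEx (rN Z) (rN Z) (fun T => FAnd (fRhom T) (fEqComp x' T x)).

(** Passing to the equivalent point [w] makes only the class of [y] matter. A morphism of rulers can
    raise [x] before it meets the coded value, so the points reached are those at or below the value
    of the function. *)
Definition fReach (P : ruler) (c : code M (rN P)) (y : M U (rN P)) (Z : ruler)
    (x : M U (rN Z)) : form :=
  FEx U (rN P) (fun w => FAnd (FAnd (fLe y w) (fLe w y))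
    (FEx (rN Z) (rN (cZ c)) (fun h => FAnd (fRhom h) (fCompEq (cg c) w h x)))).

(* [x] is the greatest point of [Z] that [y] reaches through [c]. *)
Definition fFun (P : ruler) (c : code M (rN P)) (y : M U (rN P)) (Z : ruler)
    (x : M U (rN Z)) : form :=
  FAnd (fReach c y x)
    (FAll U (rN Z) (fun x' => FAll (rN Z) U (fun p' =>
      FImp (fPt x' p') (FImp (fReach c y x') (fLe x' x))))).

Definition fExPt (Z : ruler) (k : spt -> form) : form :=
  FEx U (rN Z) (fun x => FEx (rN Z) U (fun p => FAnd (fPt x p) (k (Spt x p)))).

Definition fAllPt (Z : ruler) (k : spt -> form) : form :=
  FAll U (rN Z) (fun x => FAll (rN Z) U (fun p => FImp (fPt x p) (k (Spt x p)))).

Fixpoint fFuns (P : ruler) (cs : seq (code M (rN P))) (y : M U (rN P))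
    (args : seq spt) : form :=
  match cs, args with
  | c :: cs, a :: args => FAnd (fFun c y (sx a)) (fFuns cs y args)
  | [::], [::] => fTrue
  | _, _ => FNot fTrue
  end.

Definition fApp (r : rel M) (args : seq spt) : form :=
  FEx U (rN (rP r)) (fun y => FEx (rN (rP r)) U (fun q =>
    FAnd (fPt y q) (fFuns (rcs r) y args))).

(* [k] is the label of [r]: the endomorphisms of the frame that look like right
   multiplication by [r] agree with [fB] at some point labelled [k]. *)
Definition fQ (F : frame M U) (r : M U U) (k : M U (rN (fK F))) : form :=
  FAll (rN (fW F)) (rN (fW F)) (fun T => FImp (fRhom T)
    (FImp (FEx (fP F) (fP F) (fun T' => FAnd (fCompEq T' (fb F) (fb F) T)
        (FAnd (fCompEq T' (fs F) (fs F) T') (fCompEq T (fl F) (fl F) T'))))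
    (FImp (fCompEq (feps F) T r (feps F))
    (FEx U (rN (fW F)) (fun y => FEx (rN (fW F)) U (fun p => FAnd (fPt y p)
      (FAnd (fFun (flam F) y k)
      (FComp p T (fun a => FComp p (fB F) (fun b => fCompEq a y b y)))))))))).

Definition fExFrame (k : frame M U -> form) : form :=
  fExRuler (fun W => FExO (fun P => FEx (rN W) P (fun b => FEx P P (fun s =>
  FEx P (rN W) (fun l => FEx (rN W) U (fun eps => FEx (rN W) (rN W) (fun B =>
  fExRuler (fun K => fExRuler (fun C => FEx (rN W) (rN C) (fun g =>
    k (Frame b s l eps B K (Code g)))))))))))).

Definition fLabel (F : frame M U) (r : M U U) (k : spt -> form) : form :=
  FEx U (rN (fK F)) (fun x => FEx (rN (fK F)) U (fun p =>
    FAnd (fPt x p) (FAnd (fQ r x) (k (Spt x p))))).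

(** An element may have several labels, but a point labels at most one element; this is all that the
    translation of relations needs. *)
Definition fGood (F : frame M U) : form :=
  FAnd (FAll U U (fun r => fLabel F r (fun _ => fTrue)))
    (FAll U U (fun r => FAll U U (fun r' =>
      FAll U (rN (fK F)) (fun x => FAll (rN (fK F)) U (fun p => FImp (fPt x p)
        (FImp (fQ r x) (FImp (fQ r' x) (FEq r r')))))))).

(* A cardinal is represented by a ruler together with a relation that
   corresponds to membership between its elements. *)
Local Notation card := (ruler * rel M)%type.

Definition fWF (c : card) : form :=
  fAllRel 1 (fun S => FImp (fExPt c.1 (fun p => fApp S [:: p]))
    (fExPt c.1 (fun p => FAnd (fApp S [:: p]) (fAllPt c.1 (fun q =>
      FImp (fApp c.2 [:: q; p]) (FNot (fApp S [:: q]))))))).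

Definition fIff (A B : form) : form := FAnd (FImp A B) (FImp B A).

Definition fExt (c : card) : form :=
  FAll U (rN c.1) (fun x => FAll (rN c.1) U (fun p => FImp (fPt x p)
  (FAll U (rN c.1) (fun y => FAll (rN c.1) U (fun q => FImp (fPt y q)
    (FImp (fAllPt c.1 (fun r =>
        fIff (fApp c.2 [:: r; Spt x p]) (fApp c.2 [:: r; Spt y q])))
      (FAnd (fLe x y) (fLe y x)))))))).

Definition fTrans (c : card) : form :=
  fAllPt c.1 (fun r => fAllPt c.1 (fun q => fAllPt c.1 (fun p =>
    FImp (fApp c.2 [:: r; q]) (FImp (fApp c.2 [:: q; p]) (fApp c.2 [:: r; p]))))).

(* [B] is a bijection from the elements of [p] to those of [c]. *)
Definition fBij (c : card) (p : spt) (B : rel M) : form :=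
  FAnd (FAnd
    (fAllPt c.1 (fun q => FImp (fApp c.2 [:: q; p])
       (fExPt c.1 (fun q' => fApp B [:: q; q']))))
    (fAllPt c.1 (fun q' => fExPt c.1 (fun q =>
       FAnd (fApp c.2 [:: q; p]) (fApp B [:: q; q'])))))
  (FAll U (rN c.1) (fun x => FAll (rN c.1) U (fun q => FImp (fPt x q)
  (FAll U (rN c.1) (fun y => FAll (rN c.1) U (fun r => FImp (fPt y r)
    (FAnd
      (fAllPt c.1 (fun t => FImp (fApp c.2 [:: t; p])
        (FImp (fApp B [:: t; Spt x q])
        (FImp (fApp B [:: t; Spt y r]) (FAnd (fLe x y) (fLe y x))))))
      (fAllPt c.1 (fun t => FImp (fApp c.2 [:: Spt x q; p])
        (FImp (fApp c.2 [:: Spt y r; p])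
        (FImp (fApp B [:: Spt x q; t])
        (FImp (fApp B [:: Spt y r; t]) (FAnd (fLe x y) (fLe y x)))))))))))))).

Definition fInit (c : card) : form :=
  fAllPt c.1 (fun p => fAllRel 2 (fun B => FNot (fBij c p B))).

Definition fCard (c : card) : form :=
  FAnd (FAnd (fWF c) (fExt c)) (FAnd (fTrans c) (fInit c)).

(* Elements of well-founded extensional structures are equal as sets if and
   only if they are bisimilar. *)
Definition fEqOrd (c d : card) (a b : spt) : form :=
  fExRel 2 (fun S => FAnd (fApp S [:: a; b])
    (fAllPt c.1 (fun p => fAllPt d.1 (fun q => FImp (fApp S [:: p; q])
      (FAnd
        (fAllPt c.1 (fun p' => FImp (fApp c.2 [:: p'; p])
          (fExPt d.1 (fun q' => FAnd (fApp d.2 [:: q'; q]) (fApp S [:: p'; q'])))))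
        (fAllPt d.1 (fun q' => FImp (fApp d.2 [:: q'; q])
          (fExPt c.1 (fun p' => FAnd (fApp c.2 [:: p'; p]) (fApp S [:: p'; q'])))))))))).

Definition fEqCard (c d : card) : form :=
  FAnd (fAllPt c.1 (fun p => fExPt d.1 (fun q => fEqOrd c d p q)))
    (fAllPt d.1 (fun q => fExPt c.1 (fun p => fEqOrd c d p q))).

Fixpoint fLabels (F : frame M U) (rs : seq (M U U)) (k : seq spt -> form) : form :=
  if rs is r :: rs' then
    fLabel F r (fun p => fLabels F rs' (fun ps => k (p :: ps)))
  else k [::].

Record env := Env {
  er : nat -> M U U;
  ec : nat -> card;
  eo : ord_var -> spt;
  ep : pred_var -> rel M
}.

Fixpoint tr (F : frame M U) (A : l2_formula) (e : env) : form :=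
  match A with
  | L2Add r1 r2 r3 => fAdd (er e r1) (er e r2) (er e r3)
  (* Endomorphisms of [U] are right multiplications, so composition reverses the order of the
     factors. *)
  | L2Mul r1 r2 r3 => fEqComp (er e r1) (er e r3) (er e r2)
  | L2EqRing r1 r2 => FEq (er e r1) (er e r2)
  | L2EqCard k1 k2 => fEqCard (ec e k1) (ec e k2)
  | L2EqOrd a1 a2 => fEqOrd (ec e a1.2) (ec e a2.2) (eo e a1) (eo e a2)
  | L2Pred i alphas rs =>
      fLabels F (map (er e) rs) (fun ps =>
        fApp (ep e (pred_of i alphas rs)) (map (eo e) alphas ++ ps))
  | L2Not A => FNot (tr F A e)
  | L2And A B => FAnd (tr F A e) (tr F B e)
  | L2Or A B => FOr (tr F A e) (tr F B e)
  | L2Imp A B => FImp (tr F A e) (tr F B e)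
  | L2AllRing r A => FAll U U (fun f =>
      tr F A (Env [eta er e with r |-> f] (ec e) (eo e) (ep e)))
  | L2ExRing r A => FEx U U (fun f =>
      tr F A (Env [eta er e with r |-> f] (ec e) (eo e) (ep e)))
  | L2AllCard k A => fAllRuler (fun Z => fAllRel 2 (fun S =>
      FImp (fCard (Z, S))
      (tr F A (Env (er e) [eta ec e with k |-> (Z, S)] (eo e) (ep e)))))
  | L2ExCard k A => fExRuler (fun Z => fExRel 2 (fun S =>
      FAnd (fCard (Z, S))
      (tr F A (Env (er e) [eta ec e with k |-> (Z, S)] (eo e) (ep e)))))
  | L2AllOrd a A => fAllPt (ec e a.2).1 (fun p =>
      tr F A (Env (er e) (ec e) [eta eo e with a |-> p] (ep e)))
  | L2ExOrd a A => fExPt (ec e a.2).1 (fun p =>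
      tr F A (Env (er e) (ec e) [eta eo e with a |-> p] (ep e)))
  | L2AllPred p A => fAllRel (size p.1.2 + p.2) (fun S =>
      tr F A (Env (er e) (ec e) (eo e) [eta ep e with p |-> S]))
  | L2ExPred p A => fExRel (size p.1.2 + p.2) (fun S =>
      tr F A (Env (er e) (ec e) (eo e) [eta ep e with p |-> S]))
  end.

(** Arbitrary values, built from the only morphism at hand; a sentence never reads them. *)
Definition env0 (i : M U U) : env :=
  Env (fun _ => i) (fun _ => (Ruler i i, @Rel _ _ (Ruler i i) [::]))
    (fun _ => @Spt _ _ U (Ruler i i) i i) (fun _ => @Rel _ _ (Ruler i i) [::]).

End Formulas.

(** Every free module of rank one and every good frame give the same truth value, so introducing
    them existentially loses nothing. *)
Definition tr_sentence (O : Type) (M : O -> O -> Type) (A : l2_formula) : form M :=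
  FExO (fun U => FId U (fun i => FAnd (fUnit M U) (@fExFrame _ M U (fun F =>
    FAnd (fGood F) (tr F A (env0 i)))))).

(** * Relating the syntactic and the semantic instances of the formulas *)

Section Parametricity.
Variable C : category.
Local Notation ctx := (list (entry C)).
Local Notation HomC := (@Hom C).

Definition rul_ok (G : ctx) (z : ruler name) (Z : ruler HomC) : Prop :=
  [/\ inO G (rN z) (rN Z), inO G (rM z) (rM Z), inM G (rio z) (rio Z) &
      inM G (rz z) (rz Z)].

Definition code_ok (G : ctx) n N (c : code name n) (D : code HomC N) : Prop :=
  rul_ok G (cZ c) (cZ D) /\ inM G (cg c) (cg D).

Inductive codes_ok (G : ctx) n N : seq (code name n) -> seq (code HomC N) -> Prop :=
  | codes_nil : codes_ok G [::] [::]
  | codes_cons c D cs Ds : code_ok G c D -> codes_ok G cs Ds ->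
      codes_ok G (c :: cs) (D :: Ds).

Definition rel_ok (G : ctx) (r : rel name) (S : rel HomC) : Prop :=
  rul_ok G (rP r) (rP S) /\ codes_ok G (rcs r) (rcs S).

Definition card_ok (G : ctx) (c : ruler name * rel name) (D : ruler HomC * rel HomC) :=
  rul_ok G c.1 D.1 /\ rel_ok G c.2 D.2.

Section Unit.
Variables (u : nat) (U : Ob C).

Definition spt_ok (G : ctx) (a : spt name u) (A : spt HomC U) : Prop :=
  [/\ rul_ok G (sZ a) (sZ A), inM G (sx a) (sx A) & inM G (sp a) (sp A)].

Inductive spts_ok (G : ctx) : seq (spt name u) -> seq (spt HomC U) -> Prop :=
  | spts_nil : spts_ok G [::] [::]
  | spts_cons a A l L : spt_ok G a A -> spts_ok G l L -> spts_ok G (a :: l) (A :: L).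

Definition frame_ok (G : ctx) (f : frame name u) (F : frame HomC U) : Prop :=
  [/\ rul_ok G (fW f) (fW F), inO G (fP f) (fP F), rul_ok G (fK f) (fK F),
      code_ok G (flam f) (flam F) &
  [/\ inM G (fb f) (fb F), inM G (fs f) (fs F), inM G (fl f) (fl F),
      inM G (feps f) (feps F) & inM G (fB f) (fB F)]].

Definition env_ok (G : ctx) (e : env name u) (E : env HomC U) : Prop :=
  [/\ forall r, inM G (er e r) (er E r), forall k, card_ok G (ec e k) (ec E k),
      forall a, spt_ok G (eo e a) (eo E a) & forall p, rel_ok G (ep e p) (ep E p)].

Lemma inO_mono (G H : ctx) x X : List.incl G H -> inO G x X -> inO H x X.
Proof. by move=> GH; apply: GH. Qed.

Lemma inM_mono (G H : ctx) X Y f (v : Hom X Y) : List.incl G H -> inM G f v -> inM H f v.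
Proof. by move=> GH; apply: GH. Qed.

Lemma rul_ok_mono (G H : ctx) z Z : List.incl G H -> rul_ok G z Z -> rul_ok H z Z.
Proof. by move=> GH [? ? ? ?]; split; apply: GH. Qed.

Lemma code_ok_mono (G H : ctx) n N (c : code name n) (D : code HomC N) :
  List.incl G H -> code_ok G c D -> code_ok H c D.
Proof. by move=> GH [/(rul_ok_mono GH) ? /GH ?]. Qed.

Lemma codes_ok_mono (G H : ctx) n N (c : seq (code name n)) (D : seq (code HomC N)) :
  List.incl G H -> codes_ok G c D -> codes_ok H c D.
Proof.
by move=> GH; elim=> [|? ? ? ? /(code_ok_mono GH) ? _ ?]; constructor.
Qed.

Lemma rel_ok_mono (G H : ctx) r S : List.incl G H -> rel_ok G r S -> rel_ok H r S.
Proof. by move=> GH [/(rul_ok_mono GH) ? /(codes_ok_mono GH) ?]. Qed.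

Lemma card_ok_mono (G H : ctx) c D : List.incl G H -> card_ok G c D -> card_ok H c D.
Proof. by move=> GH [/(rul_ok_mono GH) ? /(rel_ok_mono GH) ?]. Qed.

Lemma spt_ok_mono (G H : ctx) a A : List.incl G H -> spt_ok G a A -> spt_ok H a A.
Proof. by move=> GH [/(rul_ok_mono GH) ? /GH ? /GH ?]. Qed.

Lemma spts_ok_mono (G H : ctx) a A : List.incl G H -> spts_ok G a A -> spts_ok H a A.
Proof.
by move=> GH; elim=> [|? ? ? ? /(spt_ok_mono GH) ? _ ?]; constructor.
Qed.

Lemma frame_ok_mono (G H : ctx) f F : List.incl G H -> frame_ok G f F -> frame_ok H f F.
Proof.
move=> GH [? ? ? ? [? ? ? ? ?]].
split; [exact: rul_ok_mono GH _|exact: GH|exact: rul_ok_mono GH _|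
  exact: code_ok_mono GH _|by split; apply: GH].
Qed.

Lemma env_ok_mono (G H : ctx) e E : List.incl G H -> env_ok G e E -> env_ok H e E.
Proof.
move=> GH [h1 h2 h3 h4]; split=> x; [exact/GH/h1|exact: card_ok_mono GH (h2 x)
  |exact: spt_ok_mono GH (h3 x)|exact: rel_ok_mono GH (h4 x)].
Qed.

End Unit.

End Parametricity.

Arguments inO : simpl never.
Arguments inM : simpl never.

Ltac mono H :=
  first [apply: (inM_mono H) | apply: (inO_mono H) | apply: (rul_ok_mono H)
    | apply: (code_ok_mono H) | apply: (codes_ok_mono H) | apply: (rel_ok_mono H)
    | apply: (card_ok_mono H) | apply: (spt_ok_mono H) | apply: (spts_ok_mono H)
    | apply: (frame_ok_mono H) | apply: (env_ok_mono H)].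

(** Weakening: entries added by binders are peeled off the context until a hypothesis applies. *)
Ltac lift :=
  first
  [ eassumption
  | solve [left; reflexivity]
  | lazymatch goal with
    | |- context [?e :: ?G] => mono (List.incl_tl e (List.incl_refl G))
    end; lift
  | match goal with H : List.incl _ _ |- _ => mono H; lift end ].

Ltac wf_step :=
  first [apply: wf_Eq | apply: wf_Not | apply: wf_And | apply: wf_Or | apply: wf_Imp
    | apply: wf_AllO => ? ? | apply: wf_ExO => ? ? | apply: wf_All => [||? ?]
    | apply: wf_Ex => [||? ?] | apply: wf_Comp => [||? ?] | apply: wf_Id => [|? ?]].

Section Parametricity2.
Variable C : category.
Local Notation ctx := (list (entry C)).
Local Notation HomC := (@Hom C).

Lemma wf_CompEq (G : ctx) x y y' z X Y Y' Z f g f' g' (F : Hom Y Z) (K : Hom X Y)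
    (F' : Hom Y' Z) (K' : Hom X Y') :
  inM G f F -> inM G g K -> inM G f' F' -> inM G g' K' ->
  wf G (@fCompEq _ name x y y' z f g f' g') (fCompEq F K F' K').
Proof. by move=> *; rewrite /fCompEq; do !wf_step; lift. Qed.

Lemma wf_EqComp (G : ctx) x y z X Y Z h f g (H : Hom X Z) (F : Hom Y Z) (K : Hom X Y) :
  inM G h H -> inM G f F -> inM G g K ->
  wf G (@fEqComp _ name x y z h f g) (fEqComp H F K).
Proof. by move=> *; rewrite /fEqComp; do !wf_step; lift. Qed.

Lemma wf_Rhom (G : ctx) z z' Z Z' h (H : Hom (rN Z) (rN Z')) :
  rul_ok G z Z -> rul_ok G z' Z' -> inM G h H ->
  wf G (@fRhom _ name z z' h) (fRhom H).
Proof.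
by move=> [? ? ? ?] [? ? ? ?] ?; rewrite /fRhom; do !wf_step;
  try apply: wf_CompEq; lift.
Qed.

Lemma rul_ok_N (G : ctx) z Z : rul_ok G z Z -> inO G (rN z) (rN Z).
Proof. by case. Qed.

Lemma code_ok_Z (G : ctx) n N (c : code name n) (D : code HomC N) :
  code_ok G c D -> rul_ok G (cZ c) (cZ D).
Proof. by case. Qed.

Lemma code_ok_g (G : ctx) n N (c : code name n) (D : code HomC N) :
  code_ok G c D -> inM G (cg c) (cg D).
Proof. by case. Qed.

Lemma rel_ok_P (G : ctx) r S : rel_ok G r S -> rul_ok G (rP r) (rP S).
Proof. by case. Qed.

Lemma rel_ok_cs (G : ctx) r S : rel_ok G r S -> codes_ok G (rcs r) (rcs S).
Proof. by case. Qed.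

Lemma card_ok1 (G : ctx) c D : card_ok G c D -> rul_ok G c.1 D.1.
Proof. by case. Qed.

Lemma card_ok2 (G : ctx) c D : card_ok G c D -> rel_ok G c.2 D.2.
Proof. by case. Qed.

End Parametricity2.

Ltac incl := first
  [ exact: List.incl_refl | eassumption | apply: List.incl_tl; incl
  | match goal with
    | H : List.incl _ ?B |- List.incl _ ?B =>
        apply: (List.incl_tran _ H); incl
    end ].

Ltac ok_step :=
  first
  [ lift
  | lazymatch goal with
    | |- List.incl _ _ => incl
    | |- rul_ok _ (Ruler _ _) _ => split
    | |- rul_ok _ (cZ _) _ => apply: code_ok_Z
    | |- rul_ok _ (rP _) _ => apply: rel_ok_P
    | |- rul_ok _ _.1 _ => apply: card_ok1
    | |- code_ok _ (Code _) _ => split; cbn [cZ]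
    | |- codes_ok _ (rcs _) _ => apply: rel_ok_cs
    | |- codes_ok _ _ _ => constructor
    | |- rel_ok _ (Rel _) _ => split; cbn [rP rcs]
    | |- rel_ok _ _.2 _ => apply: card_ok2
    | |- card_ok _ _ _ => split
    | |- spt_ok _ (Spt _ _) _ => split; cbn [sZ]
    | |- spts_ok _ _ _ => constructor
    | |- frame_ok _ _ _ => split; [| | | |split]; cbn [flam]
    | |- inO _ (rN _) _ => apply: rul_ok_N
    | |- inM _ (cg _) _ => apply: code_ok_g
    end ].

Section Parametricity3.
Variable C : category.
Local Notation ctx := (list (entry C)).
Local Notation HomC := (@Hom C).

(** The continuation is treated in an arbitrary larger context, since a ruler binds several
    variables at once and a list of codes a varying number. *)
Lemma wf_ExRuler (G : ctx) k (K : ruler HomC -> form HomC) :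
  (forall G' z Z, List.incl G G' -> rul_ok G' z Z -> wf G' (k z) (K Z)) ->
  wf G (fExRuler k) (fExRuler K).
Proof. by move=> h; rewrite /fExRuler; do !wf_step; try lift; apply: h; do ?ok_step. Qed.

Lemma wf_AllRuler (G : ctx) k (K : ruler HomC -> form HomC) :
  (forall G' z Z, List.incl G G' -> rul_ok G' z Z -> wf G' (k z) (K Z)) ->
  wf G (fAllRuler k) (fAllRuler K).
Proof. by move=> h; rewrite /fAllRuler; do !wf_step; try lift; apply: h; do ?ok_step. Qed.

Lemma wf_ExCodes (G : ctx) n N m k (K : seq (code HomC N) -> form HomC) :
  inO G n N ->
  (forall G' cs Ds, List.incl G G' -> codes_ok G' cs Ds -> wf G' (k cs) (K Ds)) ->
  wf G (fExCodes (N := n) m k) (fExCodes m K).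
Proof.
elim: m G k K => [|m IH] G k K nN h /=; first by apply: h; do ?ok_step.
apply: wf_ExRuler => G' z Z GG' zZ; do !wf_step; do ?ok_step.
apply: IH => [|G2 cs Ds G2i csD]; first by ok_step.
apply: h; last by do ?ok_step.
by apply: List.incl_tran GG' _; apply: List.incl_tran G2i; ok_step.
Qed.

Lemma wf_AllCodes (G : ctx) n N m k (K : seq (code HomC N) -> form HomC) :
  inO G n N ->
  (forall G' cs Ds, List.incl G G' -> codes_ok G' cs Ds -> wf G' (k cs) (K Ds)) ->
  wf G (fAllCodes (N := n) m k) (fAllCodes m K).
Proof.
elim: m G k K => [|m IH] G k K nN h /=; first by apply: h; do ?ok_step.
apply: wf_AllRuler => G' z Z GG' zZ; do !wf_step; do ?ok_step.
apply: IH => [|G2 cs Ds G2i csD]; first by ok_step.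
apply: h; last by do ?ok_step.
by apply: List.incl_tran GG' _; apply: List.incl_tran G2i; ok_step.
Qed.

Lemma wf_ExRel (G : ctx) m k (K : rel HomC -> form HomC) :
  (forall G' r S, List.incl G G' -> rel_ok G' r S -> wf G' (k r) (K S)) ->
  wf G (fExRel m k) (fExRel m K).
Proof.
move=> h; apply: wf_ExRuler => G1 z Z GG1 zZ.
apply: wf_ExCodes => [|G2 cs Ds G12 csD]; first by do ?ok_step.
by apply: h; [exact: List.incl_tran G12|do ?ok_step].
Qed.

Lemma wf_AllRel (G : ctx) m k (K : rel HomC -> form HomC) :
  (forall G' r S, List.incl G G' -> rel_ok G' r S -> wf G' (k r) (K S)) ->
  wf G (fAllRel m k) (fAllRel m K).
Proof.
move=> h; apply: wf_AllRuler => G1 z Z GG1 zZ.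
apply: wf_AllCodes => [|G2 cs Ds G12 csD]; first by do ?ok_step.
by apply: h; [exact: List.incl_tran G12|do ?ok_step].
Qed.

End Parametricity3.

Ltac wf_go :=
  do ?first
  [ match goal with |- forall _, _ => move=> ? end | ok_step | apply: wf_CompEq | apply: wf_EqComp
  | apply: wf_Rhom | apply: wf_ExRuler | apply: wf_AllRuler | apply: wf_ExRel
  | apply: wf_AllRel | wf_step ].

Section Parametricity4.
Variable C : category.
Local Notation ctx := (list (entry C)).
Local Notation HomC := (@Hom C).

Lemma wf_Gen (G : ctx) x X : inO G x X -> wf G (fGen name x) (fGen HomC X).
Proof. move=> ?; rewrite /fGen; wf_go. Qed.

Lemma wf_Unit (G : ctx) x X : inO G x X -> wf G (fUnit name x) (fUnit HomC X).
Proof.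
by move=> ?; rewrite /fUnit /fRetract; do ?first [apply: wf_Gen | wf_step | ok_step].
Qed.

Variables (u : nat) (U : Ob C).

Lemma wf_True (G : ctx) : inO G u U -> wf G (fTrue name u) (fTrue HomC U).
Proof. by rewrite /fTrue; wf_go. Qed.

Lemma wf_Zero (G : ctx) x y X Y h (H : Hom X Y) : inO G u U -> inO G x X ->
  inM G h H -> wf G (@fZero _ name u x y h) (fZero U H).
Proof. by rewrite /fZero; wf_go. Qed.

Lemma wf_Add (G : ctx) f g h (F K H : Hom U U) : inO G u U ->
  inM G f F -> inM G g K -> inM G h H ->
  wf G (@fAdd _ name u f g h) (fAdd F K H).
Proof. by rewrite /fAdd; do ?first [apply: wf_Zero | progress wf_go]. Qed.

Lemma wf_Pt (G : ctx) z Z x (X : Hom U (rN Z)) p (P : Hom (rN Z) U) : inO G u U ->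
  rul_ok G z Z -> inM G x X -> inM G p P ->
  wf G (@fPt _ name u z x p) (fPt X P).
Proof. by rewrite /fPt; wf_go. Qed.

Lemma wf_Le (G : ctx) z Z x (X : Hom U (rN Z)) y (Y : Hom U (rN Z)) :
  rul_ok G z Z -> inM G x X -> inM G y Y ->
  wf G (@fLe _ name u z x y) (fLe X Y).
Proof. by rewrite /fLe; wf_go. Qed.

Lemma wf_Reach (G : ctx) r P c (D : code HomC (rN P)) y (Y : Hom U (rN P)) z Z x
    (X : Hom U (rN Z)) : inO G u U -> rul_ok G r P -> code_ok G c D ->
  rul_ok G z Z -> inM G x X -> inM G y Y ->
  wf G (@fReach _ name u r c y z x) (fReach D Y X).
Proof. by rewrite /fReach; do ?first [apply: wf_Le | progress wf_go]. Qed.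

Lemma wf_Fun (G : ctx) r P c (D : code HomC (rN P)) y (Y : Hom U (rN P)) z Z x
    (X : Hom U (rN Z)) : inO G u U -> rul_ok G r P -> code_ok G c D ->
  rul_ok G z Z -> inM G x X -> inM G y Y ->
  wf G (@fFun _ name u r c y z x) (fFun D Y X).
Proof.
by rewrite /fFun; do ?first [apply: wf_Reach | apply: wf_Le | apply: wf_Pt | progress wf_go].
Qed.

Lemma wf_ExPt (G : ctx) z Z k (K : spt HomC U -> form HomC) : inO G u U ->
  rul_ok G z Z ->
  (forall G' a A, List.incl G G' -> spt_ok G' a A -> wf G' (k a) (K A)) ->
  wf G (@fExPt _ name u z k) (fExPt Z K).
Proof.
move=> ? ? h; rewrite /fExPt.
by do ?first [apply: wf_Pt | apply: h | wf_step | ok_step].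
Qed.

Lemma wf_AllPt (G : ctx) z Z k (K : spt HomC U -> form HomC) : inO G u U ->
  rul_ok G z Z ->
  (forall G' a A, List.incl G G' -> spt_ok G' a A -> wf G' (k a) (K A)) ->
  wf G (@fAllPt _ name u z k) (fAllPt Z K).
Proof.
move=> ? ? h; rewrite /fAllPt.
by do ?first [apply: wf_Pt | apply: h | wf_step | ok_step].
Qed.

End Parametricity4.

Ltac wf_pt := lazymatch goal with
  | |- forall _, _ => move=> ?
  | |- wf _ (fTrue _ _) _ => apply: wf_True
  | |- wf _ (fZero _ _) _ => apply: wf_Zero
  | |- wf _ (fAdd _ _ _) _ => apply: wf_Add
  | |- wf _ (fLe _ _) _ => apply: wf_Le
  | |- wf _ (fPt _ _) _ => apply: wf_Pt
  | |- wf _ (fReach _ _ _) _ => apply: wf_Reach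
  | |- wf _ (fFun _ _ _) _ => apply: wf_Fun
  | |- wf _ (fExPt _ _) _ => apply: wf_ExPt
  | |- wf _ (fAllPt _ _) _ => apply: wf_AllPt
  | |- wf _ (fCompEq _ _ _ _) _ => apply: wf_CompEq
  | |- wf _ (fEqComp _ _ _) _ => apply: wf_EqComp
  | |- wf _ (fRhom _) _ => apply: wf_Rhom
  | |- wf _ (fExRuler _) _ => apply: wf_ExRuler
  | |- wf _ (fAllRuler _) _ => apply: wf_AllRuler
  | |- wf _ (fExRel _ _) _ => apply: wf_ExRel
  | |- wf _ (fAllRel _ _) _ => apply: wf_AllRel
  | |- wf _ _ _ => wf_step
  | |- _ => ok_step
  end.

Section Parametricity5.
Variable C : category.
Local Notation ctx := (list (entry C)).
Local Notation HomC := (@Hom C).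
Variables (u : nat) (U : Ob C).

Lemma spt_ok_Z (G : ctx) a A : @spt_ok C u U G a A -> rul_ok G (sZ a) (sZ A).
Proof. by case. Qed.

Lemma spt_ok_x (G : ctx) a A : @spt_ok C u U G a A -> inM G (sx a) (sx A).
Proof. by case. Qed.

Lemma wf_Funs (G : ctx) r P y (Y : Hom U (rN P)) cs (Ds : seq (code HomC (rN P)))
    args (Args : seq (spt HomC U)) : inO G u U -> rul_ok G r P -> inM G y Y ->
  codes_ok G cs Ds -> spts_ok G args Args ->
  wf G (@fFuns _ name u r cs y args) (fFuns Ds Y Args).
Proof.
move=> uU rP yY csD; elim: csD args Args => [|c D {}cs {}Ds cD _ IH] args Args [|a A l L aA lL] /=.
- by do !wf_pt.
- by do !wf_pt.
- by do !wf_pt.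
- apply: wf_And; last exact: IH.
  by apply: wf_Fun => //; [exact: spt_ok_Z aA|exact: spt_ok_x aA].
Qed.

Lemma wf_App (G : ctx) r R args (Args : seq (spt HomC U)) : inO G u U ->
  rel_ok G r R -> spts_ok G args Args -> wf G (@fApp _ name u r args) (fApp R Args).
Proof. by move=> ? ? ?; rewrite /fApp; do ?first [match goal with |- wf _ (fFuns _ _ _) _ => apply: wf_Funs end | wf_pt]. Qed.

Lemma frame_ok_K (G : ctx) f F : @frame_ok C u U G f F -> rul_ok G (fK f) (fK F).
Proof. by case. Qed.

Lemma wf_Q (G : ctx) f F r (R : Hom U U) k (K : Hom U (rN (fK F))) : inO G u U ->
  frame_ok G f F -> inM G r R -> inM G k K ->
  wf G (@fQ _ name u f r k) (fQ R K).
Proof.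
move=> ? [? ? ? ? [? ? ? ? ?]] ? ?; rewrite /fQ.
by do ?wf_pt.
Qed.

Lemma wf_ExFrame (G : ctx) k (K : frame HomC U -> form HomC) : inO G u U ->
  (forall G' f F, List.incl G G' -> frame_ok G' f F -> wf G' (k f) (K F)) ->
  wf G (@fExFrame _ name u k) (fExFrame K).
Proof.
move=> uU h; rewrite /fExFrame.
by do ?first [apply: h | wf_pt].
Qed.

Lemma wf_Label (G : ctx) f F r (R : Hom U U) k (K : spt HomC U -> form HomC) :
  inO G u U -> frame_ok G f F -> inM G r R ->
  (forall G' a A, List.incl G G' -> spt_ok G' a A -> wf G' (k a) (K A)) ->
  wf G (@fLabel _ name u f r k) (fLabel F R K).
Proof.
move=> uU fF rR h; have fK := frame_ok_K fF; rewrite /fLabel.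
by do ?first [apply: h | match goal with |- wf _ (fQ _ _) _ => apply: wf_Q end | wf_pt].
Qed.

Lemma wf_Good (G : ctx) f F : inO G u U -> @frame_ok C u U G f F ->
  wf G (fGood f) (fGood F).
Proof.
move=> uU fF; have fK := frame_ok_K fF; rewrite /fGood.
by do ?first [match goal with |- wf _ (fLabel _ _ _) _ => apply: wf_Label end | match goal with |- wf _ (fQ _ _) _ => apply: wf_Q end | wf_pt].
Qed.

Lemma wf_Card (G : ctx) c D : inO G u U -> @card_ok C G c D ->
  wf G (fCard u c) (fCard U D).
Proof.
move=> uU cD; rewrite /fCard; repeat apply: wf_And.
- by rewrite /fWF; do ?first [match goal with |- wf _ (fApp _ _) _ => apply: wf_App end | wf_pt].
- by rewrite /fExt /fIff; do ?first [match goal with |- wf _ (fApp _ _) _ => apply: wf_App end | wf_pt].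
- by rewrite /fTrans; do ?first [match goal with |- wf _ (fApp _ _) _ => apply: wf_App end | wf_pt].
- by rewrite /fInit /fBij; do ?first [match goal with |- wf _ (fApp _ _) _ => apply: wf_App end | wf_pt].
Qed.

Lemma wf_EqOrd (G : ctx) c C1 d D a A b B : inO G u U -> card_ok G c C1 ->
  card_ok G d D -> @spt_ok C u U G a A -> spt_ok G b B ->
  wf G (fEqOrd c d a b) (fEqOrd C1 D A B).
Proof.
by move=> uU cD dD aA bB; rewrite /fEqOrd; do ?first [match goal with |- wf _ (fApp _ _) _ => apply: wf_App end | wf_pt].
Qed.

Lemma wf_EqCard (G : ctx) c C1 d D : inO G u U -> @card_ok C G c C1 ->
  card_ok G d D -> wf G (fEqCard u c d) (fEqCard U C1 D).
Proof.
by move=> uU cD dD; rewrite /fEqCard; do ?first [match goal with |- wf _ (fEqOrd _ _ _ _) _ => apply: wf_EqOrd end | wf_pt].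
Qed.

Inductive homs_ok (G : ctx) : seq nat -> seq (Hom U U) -> Prop :=
  | homs_nil : homs_ok G [::] [::]
  | homs_cons r R rs Rs : inM G r R -> homs_ok G rs Rs -> homs_ok G (r :: rs) (R :: Rs).

Lemma homs_ok_mono (G H : ctx) rs Rs : List.incl G H -> homs_ok G rs Rs -> homs_ok H rs Rs.
Proof. by move=> GH; elim=> [|? ? ? ? /(inM_mono GH) ? _ ?]; constructor. Qed.

Lemma wf_Labels (G : ctx) f F rs (Rs : seq (Hom U U)) k (K : seq (spt HomC U) -> form HomC) :
  inO G u U -> frame_ok G f F -> homs_ok G rs Rs ->
  (forall G' a A, List.incl G G' -> spts_ok G' a A -> wf G' (k a) (K A)) ->
  wf G (@fLabels _ name u f rs k) (fLabels F Rs K).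
Proof.
elim: rs Rs G k K => [|r rs IH] Rs G k K uU fF rR h; inversion rR; subst => /=.
  by apply: h; [incl|constructor].
apply: wf_Label => // G' a A GG' aA; apply: IH.
- by lift.
- by lift.
- exact: homs_ok_mono GG' _.
- by move=> G2 l L G12 lL; apply: h; [incl|constructor; lift].
Qed.

Lemma wf_tr A (G : ctx) f (F : frame HomC U) e (E : env HomC U) : inO G u U -> frame_ok G f F -> env_ok G e E ->
  wf G (@tr _ name u f A e) (tr F A E).
Proof.
elim: A G e E => /= [r1 r2 r3|r1 r2 r3|r1 r2|k1 k2|a1 a2|i al rs|A IA|A IA B IB|A IA B IB
  |A IA B IB|r A IA|r A IA|k A IA|k A IA|a A IA|a A IA|p A IA|p A IA] G e E uU fF eE;
  have [eR eC eO eP] := eE.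
- exact: wf_Add.
- exact: wf_EqComp.
- exact: wf_Eq.
- exact: wf_EqCard.
- exact: wf_EqOrd.
- apply: wf_Labels => // [|G' ps Ps GG' pP].
    by elim: (rs) => [|r s IH] /=; constructor.
  apply: wf_App; [lift|exact: rel_ok_mono GG' _|].
  elim: (al) => //= a s IH; constructor=> //; exact: spt_ok_mono GG' _.
- by apply: wf_Not; apply: IA.
- by apply: wf_And; [apply: IA|apply: IB].
- by apply: wf_Or; [apply: IA|apply: IB].
- by apply: wf_Imp; [apply: IA|apply: IB].
- apply: wf_All => // g v; apply: IA; [lift|lift|].
  have := env_ok_mono (List.incl_tl (inr (g, Mor v)) (List.incl_refl G)) eE.
  case=> h1 h2 h3 h4; split=> //= s; case: eqP => // _; lift.
- apply: wf_Ex => // g v; apply: IA; [lift|lift|].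
  have := env_ok_mono (List.incl_tl (inr (g, Mor v)) (List.incl_refl G)) eE.
  case=> h1 h2 h3 h4; split=> //= s; case: eqP => // _; lift.
- apply: wf_AllRuler => G1 z Z GG1 zZ; apply: wf_AllRel => G2 s S G12 sS.
  apply: wf_Imp; first by apply: wf_Card; do ?ok_step.
  apply: IA; [lift|lift|].
  have [h1 h2 h3 h4] := env_ok_mono (List.incl_tran GG1 G12) eE.
  by split=> //= j; case: eqP => // _; split=> /=; lift.
- apply: wf_ExRuler => G1 z Z GG1 zZ; apply: wf_ExRel => G2 s S G12 sS.
  apply: wf_And; first by apply: wf_Card; do ?ok_step.
  apply: IA; [lift|lift|].
  have [h1 h2 h3 h4] := env_ok_mono (List.incl_tran GG1 G12) eE.
  by split=> //= j; case: eqP => // _; split=> /=; lift.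
- apply: wf_AllPt => // [|G1 b B GG1 bB]; first by case: (eC a.2).
  apply: IA; [lift|lift|].
  by have [h1 h2 h3 h4] := env_ok_mono GG1 eE; split=> //= j; case: eqP.
- apply: wf_ExPt => // [|G1 b B GG1 bB]; first by case: (eC a.2).
  apply: IA; [lift|lift|].
  by have [h1 h2 h3 h4] := env_ok_mono GG1 eE; split=> //= j; case: eqP.
- apply: wf_AllRel => G1 s S GG1 sS; apply: IA; [lift|lift|].
  by have [h1 h2 h3 h4] := env_ok_mono GG1 eE; split=> //= j; case: eqP.
- apply: wf_ExRel => G1 s S GG1 sS; apply: IA; [lift|lift|].
  by have [h1 h2 h3 h4] := env_ok_mono GG1 eE; split=> //= j; case: eqP.
Qed.

End Parametricity5.

Lemma wf_tr_sentence (C : category) A :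
  wf [::] (tr_sentence name A) (tr_sentence (@Hom C) A).
Proof.
rewrite /tr_sentence; apply: wf_ExO => u U; apply: wf_Id => [|i I]; first by lift.
apply: wf_And; first by apply: wf_Unit; lift.
apply: wf_ExFrame => [|G f F GG fF]; first by lift.
apply: wf_And; first by apply: wf_Good; lift.
apply: wf_tr; [lift|lift|].
have iI : inM G i I by lift.
have ok : rul_ok G (@Ruler _ name u u i i) (Ruler I I).
  have uU : inO G u U by lift.
  by split.
have nil n N : @codes_ok C G n N [::] [::] by constructor.
split=> k /=; [exact: iI|exact: (conj ok (conj ok (nil _ _)))
  |exact: (And3 ok iI iI)|exact: (conj ok (nil _ _))].
Qed.

(** * Local rings, copowers and rulers *)

Section LocalRing.
Variables (R : pzRingType) (localR : local_ring R).

Lemma not_invertible0 : ~ invertible (0 : R).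
Proof. by case: localR. Qed.

Lemma invertible_sum (I : Type) (s : seq I) (F : I -> R) :
  invertible (\sum_(i <- s) F i) -> exists i, invertible (F i).
Proof.
move=> inv; apply: contrapT => no; apply: (_ : ~ invertible (\sum_(i <- s) F i)) inv.
have [J0 JD _] := localR.
elim/big_ind: _ => [|x y|i _ Fi]; [exact: not_invertible0|exact: JD|].
by apply: no; exists i.
Qed.

(** As the non-units form a left ideal, [b] is a unit; then [a] is the product of [a * b] and the
    inverse of [b]. *)
Lemma invertibleM (a b : R) : invertible (a * b) -> invertible a /\ invertible b.
Proof.
move=> inv; have [_ _ JM] := localR.
have [s [sb bs]] : invertible b by apply: contrapT => /(JM a).
split; last by exists s.
have [t [t1 t2]] := inv; exists (b * t); split; last by rewrite mulrA.
by rewrite -mulrA (_ : t * a = s) // -[LHS]mulr1 -bs mulrA -(mulrA t) t1 mul1r.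
Qed.

End LocalRing.

Section Copowers.
Variable R : pzRingType.
Local Notation lmodule := (lmodule R).

Definition zhom (X Y : lmodule) : lhom X Y := projT1 (cid (zero_hom X Y)).

Lemma zhomE (X Y : lmodule) x : zhom X Y x = 0.
Proof. by rewrite /zhom; case: cid. Qed.

Definition cpo (I : Type) (sI : small I) (X : lmodule) : copower I X :=
  projT1 (cid (let: inhabits P := copower_exists X sI in
    ex_intro (fun _ : copower I X => True) P Logic.I)).

Lemma lhom0 (X Y : lmodule) (f : lhom X Y) : f 0 = 0.
Proof. exact: linear0. Qed.

Lemma lhomD (X Y : lmodule) (f : lhom X Y) x y : f (x + y) = f x + f y.
Proof. exact: linearD. Qed.

Lemma lhomZ (X Y : lmodule) (f : lhom X Y) a x : f (a *: x) = a *: f x.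
Proof. exact: linearZ. Qed.

Lemma lhom_sum (X Y : lmodule) (f : lhom X Y) (I : Type) (s : seq I) (F : I -> elements X) :
  f (\sum_(i <- s) F i) = \sum_(i <- s) f (F i).
Proof. exact: linear_sum. Qed.

Section Copower1.
Variables (I : Type) (X : lmodule) (P : copower I X).

Definition cp_co (i : I) : lhom P X :=
  cp_out P (fun j => if pselect (j = i) then lhom_id X else zhom X X).

Lemma cp_co_in i x : cp_co i (cp_in P i x) = x.
Proof. by rewrite /cp_co cp_outE; case: pselect. Qed.

Lemma cp_co_neq i j x : j <> i -> cp_co i (cp_in P j x) = 0.
Proof. by move=> ji; rewrite /cp_co cp_outE; case: pselect => //= _; rewrite zhomE. Qed.

Lemma cp_ext (Y : lmodule) (f g : lhom P Y) :
  (forall i x, f (cp_in P i x) = g (cp_in P i x)) -> forall p, f p = g p.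
Proof.
move=> fg; elim/cp_ind => [|i x p IH]; first by rewrite !linear0.
by rewrite !linearD fg IH.
Qed.

Lemma cp_decomp (p : elements P) : exists s : seq {classic I},
  p = \sum_(i <- s) cp_in P i (cp_co i p) /\ forall i, cp_co i p <> 0 -> (i : {classic I}) \in s.
Proof.
have supp q : fin_supp (fun i => cp_in P i (cp_co i q)).
  elim/cp_ind: q => [|i x q [s ps]]; first by exists [::] => i; rewrite !linear0.
  exists ((i : {classic I}) :: s) => j; rewrite inE linearD.
  have [->|ji] := pselect (j = i); first by rewrite eqxx.
  by rewrite cp_co_neq ?add0r => [/ps ->|/esym //]; rewrite orbT.
have [s ps] := supp p.
exists (undup s); split; last first.
  move=> i pi; rewrite mem_undup; apply: ps => e; apply: pi.
  by rewrite -(cp_co_in i (cp_co i p)) e linear0.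
rewrite -(fsumE (undup_uniq s)); last by move=> i /ps; rewrite mem_undup.
elim/cp_ind: p {s ps} => [|i x p IH].
  by rewrite (@fsumE _ _ _ _ [::]) ?big_nil // => i; rewrite !linear0.
have -> : (fun j => cp_in P j (cp_co j (cp_in P i x + p))) =
    (fun j => 1 *: cp_in P j (cp_co j (cp_in P i x)) + cp_in P j (cp_co j p)).
  by apply: funext => j; rewrite scale1r !linearD.
rewrite fsum_linear // -IH scale1r; congr (_ + _).
rewrite (@fsumE _ _ _ _ [:: (i : {classic I})]) ?big_seq1 ?cp_co_in // => j.
have [->|ji] := pselect (j = i); first by rewrite mem_head.
by rewrite cp_co_neq ?linear0 // => /esym.
Qed.

Lemma cp_vanish (Y : lmodule) (f : lhom P Y) p :
  (forall i, f (cp_in P i (cp_co i p)) = 0) -> f p = 0.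
Proof.
move=> f0; have [s [-> _]] := cp_decomp p.
by rewrite linear_sum big1.
Qed.

End Copower1.

Arguments cp_co {I X P} i.

End Copowers.
Arguments cp_co {R I X P} i.

(** * Rulers and points in the category of modules *)

Section Semantics.
Variables (R : pzRingType) (localR : local_ring R).
Local Notation lmodule := (lmodule R).
Local Notation ruler := (ruler (@Hom (Mod R))).
Local Notation code := (code (@Hom (Mod R))).

Definition free_on (U : lmodule) (u0 : elements U) (val : elements U -> R) : Prop :=
  (forall u, u = val u *: u0) /\ forall r, val (r *: u0) = r.

Lemma CompEqP (X Y Y' Z : lmodule) (f : lhom Y Z) (g : lhom X Y) (f' : lhom Y' Z)
    (g' : lhom X Y') :
  denote (C := Mod R) (fCompEq f g f' g') <-> forall x, f (g x) = f' (g' x).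
Proof.
split=> /= [e x|e]; last exact: linear_ext.
exact: (congr1 (fun h : lhom X Z => h x) e).
Qed.

Lemma EqCompP (X Y Z : lmodule) (h : lhom X Z) (f : lhom Y Z) (g : lhom X Y) :
  denote (C := Mod R) (fEqComp h f g) <-> forall x, h x = f (g x).
Proof.
split=> /= [e x|e]; last exact: linear_ext.
exact: (congr1 (fun h : lhom X Z => h x) e).
Qed.

Definition rhom (Z Z' : ruler) (h : lhom (rN Z) (rN Z')) : Prop :=
  exists k : lhom (rM Z) (rM Z'),
    (forall x, k (rio Z x) = rio Z' (h x)) /\ (forall x, k (rz Z x) = rz Z' (k x)).

Lemma RhomP (Z Z' : ruler) (h : lhom (rN Z) (rN Z')) :
  denote (C := Mod R) (fRhom h) <-> rhom h.
Proof.
by split=> -[k [/CompEqP k1 /CompEqP k2]]; exists k; split=> //; apply/CompEqP.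
Qed.

Lemma rhom_id (Z : ruler) : rhom (lhom_id (rN Z) : lhom (rN Z) (rN Z)).
Proof. by exists (lhom_id _). Qed.

Lemma rhom_comp (Z1 Z2 Z3 : ruler) (f : lhom (rN Z2) (rN Z3)) (g : lhom (rN Z1) (rN Z2)) :
  rhom f -> rhom g -> rhom (lhom_comp f g).
Proof.
move=> [f' [f1 f2]] [g' [g1 g2]]; exists (lhom_comp f' g').
by split=> x /=; [rewrite g1 f1|rewrite g2 f2].
Qed.

Section Points.
Variables (U : lmodule).

Definition isPt (Z : ruler) (x : lhom U (rN Z)) (p : lhom (rN Z) U) : Prop :=
  (forall u, p (x u) = u) /\ forall c : lhom U U, rhom (lhom_comp (lhom_comp x c) p).

Definition le (Z : ruler) (x y : lhom U (rN Z)) : Prop :=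
  exists T : lhom (rN Z) (rN Z), rhom T /\ forall u, y u = T (x u).

Lemma PtP (Z : ruler) (x : lhom U (rN Z)) (p : lhom (rN Z) U) :
  denote (C := Mod R) (fPt x p) <-> isPt x p.
Proof.
split=> -[px h]; split.
- by move=> u; rewrite -[RHS](congr1 (fun h : lhom U U => h u) (esym px)).
- by move=> c; apply/RhomP/h.
- by apply: linear_ext => u /=; rewrite px.
- by move=> c; apply/RhomP/h.
Qed.

Lemma LeP (Z : ruler) (x y : lhom U (rN Z)) :
  denote (C := Mod R) (fLe x y) <-> le x y.
Proof.
by split=> -[T [hT yT]]; exists T; split; first [exact/RhomP | exact/EqCompP].
Qed.

Lemma le_refl (Z : ruler) (x : lhom U (rN Z)) : le x x.
Proof. by exists (lhom_id _); split=> //; exact: rhom_id. Qed.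

Lemma le_trans (Z : ruler) (x y z : lhom U (rN Z)) : le x y -> le y z -> le x z.
Proof.
move=> [T [hT yT]] [S [hS zS]]; exists (lhom_comp S T).
by split=> [|u]; [exact: rhom_comp|rewrite /= zS yT].
Qed.

Definition eqv (Z : ruler) (x y : lhom U (rN Z)) : Prop := le x y /\ le y x.

Lemma eqv_refl (Z : ruler) (x : lhom U (rN Z)) : eqv x x.
Proof. by split; apply: le_refl. Qed.

Lemma eqv_sym (Z : ruler) (x y : lhom U (rN Z)) : eqv x y -> eqv y x.
Proof. by case. Qed.

Lemma eqv_trans (Z : ruler) (x y z : lhom U (rN Z)) : eqv x y -> eqv y z -> eqv x z.
Proof. by move=> [a b] [c d]; split; [apply: le_trans c|apply: le_trans b]. Qed.

Definition reach (P : ruler) (c : code (rN P)) (y : lhom U (rN P)) (Z : ruler)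
    (x : lhom U (rN Z)) : Prop :=
  exists2 w, eqv y w & exists2 h : lhom (rN Z) (rN (cZ c)), rhom h &
    forall u, cg c (w u) = h (x u).

Definition is_fun (P : ruler) (c : code (rN P)) (y : lhom U (rN P)) (Z : ruler)
    (x : lhom U (rN Z)) : Prop :=
  reach c y x /\ forall x' p', isPt x' p' -> reach c y x' -> le x' x.

Lemma ReachP (P : ruler) (c : code (rN P)) (y : lhom U (rN P)) (Z : ruler)
    (x : lhom U (rN Z)) : denote (C := Mod R) (fReach c y x) <-> reach c y x.
Proof.
split=> [[w [[/LeP yw /LeP wy] [h [/RhomP hh /CompEqP e]]]]|].
  by exists w => //; exists h.
by move=> [w [yw wy] [h hh e]]; exists w; split; [split; apply/LeP|
  exists h; split; [apply/RhomP|apply/CompEqP]].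
Qed.

Lemma FunP (P : ruler) (c : code (rN P)) (y : lhom U (rN P)) (Z : ruler)
    (x : lhom U (rN Z)) : denote (C := Mod R) (fFun c y x) <-> is_fun c y x.
Proof.
split=> -[/ReachP r h]; split=> // x' p'.
  by move=> /PtP hp /ReachP hr; apply/LeP/(h x' p').
by move=> /PtP hp /ReachP hr; apply/LeP; apply: h hp hr.
Qed.

Lemma is_fun_eqv (P : ruler) (c : code (rN P)) (y : lhom U (rN P)) (Z : ruler)
    (x x' : lhom U (rN Z)) : eqv x x' -> is_fun c y x -> is_fun c y x'.
Proof.
move=> [[T [hT xT]] [S [hS xS]]] [[w yw [h hh e]] mx]; split.
  exists w => //; exists (lhom_comp h S); first exact: rhom_comp.
  by move=> u; rewrite e /= xS.
move=> z p pz rz; apply: le_trans (mx _ _ pz rz) _; by exists T.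
Qed.

End Points.

Section StandardRuler.
Variables (U : lmodule) (u0 : elements U) (val : elements U -> R).
Hypothesis freeU : free_on u0 val.

Lemma valE u : val u *: u0 = u. Proof. by rewrite -(freeU.1 u). Qed.
Lemma valK r : val (r *: u0) = r. Proof. exact: freeU.2. Qed.

Lemma val_linear a u v : val (a *: u + v) = a * val u + val v.
Proof. by rewrite -[u]valE -[v]valE scalerA -scalerDl !valK. Qed.

Lemma val0 : val 0 = 0. Proof. by rewrite -(scale0r u0) valK. Qed.

Lemma val_sum (I : Type) (s : seq I) (F : I -> elements U) :
  val (\sum_(i <- s) F i) = \sum_(i <- s) val (F i).
Proof.
elim/big_rec2: _ => [|i x y _ <-]; first exact: val0.
by rewrite -[F i]scale1r val_linear mul1r scale1r.
Qed.

Lemma valZ a u : val (a *: u) = a * val u.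
Proof. by rewrite -[a *: u]addr0 val_linear val0 addr0. Qed.

Lemma hom_of_ex (X : lmodule) (v : elements X) :
  exists h : lhom U X, forall u, h u = val u *: v.
Proof. by apply: linear_exists => a x y; rewrite val_linear scalerDl scalerA. Qed.

Definition hom_of (X : lmodule) (v : elements X) : lhom U X := projT1 (cid (hom_of_ex v)).

Lemma hom_ofE (X : lmodule) (v : elements X) u : hom_of v u = val u *: v.
Proof. by rewrite /hom_of; case: cid. Qed.

Lemma hom_of1 (X : lmodule) (v : elements X) : hom_of v u0 = v.
Proof. by rewrite hom_ofE -{1}[u0]scale1r valK scale1r. Qed.

Lemma homE (X : lmodule) (f : lhom U X) u : f u = val u *: f u0.
Proof. by rewrite -{1}[u]valE linearZ. Qed.

Lemma hom_ext (X : lmodule) (f g : lhom U X) : f u0 = g u0 -> forall u, f u = g u.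
Proof. by move=> fg u; rewrite homE [RHS]homE fg. Qed.

Variables (W : Type) (lt : W -> W -> Prop) (wo : strict_wo lt) (sW : small W).

Let sWW : small (W * seq W) := small_prod sW (small_seq sW).

Definition stdN : copower W U := cpo sW U.
Definition stdM : copower (W * seq W) U := cpo sWW U.

Definition rank (i : W * seq W) : W := head i.1 i.2.

(* [stdM] is spanned by pairs of a root and a sequence of smaller and smaller
   elements below it; [z] goes to the parent node.  Thus the height of a node
   is its rank. *)
Definition std_z : lhom stdM stdM :=
  cp_out stdM (fun i => match i with
    | (a, g :: q) => if pselect (lt g (rank (a, q))) then cp_in stdM (a, q) else zhom _ _
    | _ => zhom _ _ end).

Definition std_io : lhom stdN stdM := cp_out stdN (fun a => cp_in stdM (a, [::])).

Definition std : ruler := @Ruler _ (@Hom (Mod R)) stdN stdM std_io std_z.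

Definition triangular (T : lhom stdN stdN) : Prop :=
  forall a b u, lt b a -> cp_co b (T (cp_in stdN a u)) = 0.

Let wf_lt : well_founded lt. Proof. by case: wo. Qed.
Let lt_irr a : ~ lt a a. Proof. exact: wf_irr. Qed.
Let lt_tr a b c : lt a b -> lt b c -> lt a c. Proof. by case: wo => _ tr _; exact: tr. Qed.
Let lt_tri a b : [\/ lt a b, a = b | lt b a]. Proof. by case: wo. Qed.

(** The parent of a node has a larger rank, so [std_z] raises ranks strictly. *)
Lemma std_z_rank (m : elements stdM) c :
  (forall i, lt (rank i) c -> cp_co i m = 0) ->
  forall i, ~ lt c (rank i) -> cp_co i (std_z m) = 0.
Proof.
move=> mc i ci; apply: (cp_vanish (f := lhom_comp (cp_co i) std_z)) => -[a [|g q]] /=.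
  by rewrite /std_z cp_outE zhomE linear0.
rewrite /std_z cp_outE; case: pselect => [gq|ngq] /=; last by rewrite zhomE linear0.
have [e|ne] := pselect ((a, q) = i); last exact: cp_co_neq.
rewrite -e cp_co_in; apply: mc => /=.
have [//|gc|cg] := lt_tri g c; case: ci; rewrite -e; first by rewrite -gc.
exact: lt_tr gq.
Qed.

(** The node [j] has a child of any rank below its own, in particular of [rank i]. By induction the
    image of that child has only ranks at least [rank i]; applying [std_z] raises them strictly, and
    [k] commutes with it. *)
Lemma std_heights (k : lhom stdM stdM) : (forall x, k (std_z x) = std_z (k x)) ->
  forall j i u, lt (rank i) (rank j) -> cp_co i (k (cp_in stdM j u)) = 0.
Proof.
move=> kz j; move: {2}(rank j) (erefl (rank j)) => b.
elim/(well_founded_ind wf_lt): b j => b IH [a q] jb i u ij.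
have e : cp_in stdM (a, q) u = std_z (cp_in stdM (a, rank i :: q) u).
  by rewrite /std_z cp_outE; case: pselect.
rewrite e kz; apply: std_z_rank (rank i) _ _ (@lt_irr _) => l li.
by apply: (IH (rank i)) => //; rewrite -jb.
Qed.

(** The rank of a root is the root itself, so the bound on ranks restricts to triangularity. *)
Lemma rhom_triangular (T : lhom stdN stdN) : rhom (Z := std) (Z' := std) T -> triangular T.
Proof.
move=> [k [/= kT kz]] a b u ba.
have := @std_heights k kz (a, [::]) (b, [::]) u ba.
have <- : std_io (cp_in stdN a u) = cp_in stdM (a, [::]) u by rewrite /std_io cp_outE.
rewrite kT; apply: etrans.
suff h n : cp_co (b, [::]) (std_io n) = cp_co b n by rewrite h.
apply: (cp_ext (f := lhom_comp (cp_co (b, [::])) std_io)) => c x /=.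
rewrite /std_io cp_outE; have [->|cb] := pselect (c = b); first by rewrite !cp_co_in.
by rewrite !cp_co_neq // => -[].
Qed.

(** The true nodes of the tree. The other pairs also index basis elements of [stdM], which keeps the
    index type simple; extensions of triangular maps are set to zero on them. *)
Fixpoint valid (a : W) (q : seq W) : Prop :=
  if q is g :: q' then lt g (rank (a, q')) /\ valid a q' else True.

Definition std_at (q : seq W) : lhom stdN stdM := cp_out stdN (fun x => cp_in stdM (x, q)).

Lemma std_atE q x u : std_at q (cp_in stdN x u) = cp_in stdM (x, q) u.
Proof. by rewrite /std_at cp_outE. Qed.

(** The extension moves the root by [T] and keeps the sequence. Triangularity moves a root only to
    roots at or above it, below which the same sequence still descends; this gives commutation with
    [std_z]. *)
Lemma triangular_rhom (T : lhom stdN stdN) : triangular T -> rhom (Z := std) (Z' := std) T.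
Proof.
move=> tT.
pose k : lhom stdM stdM := cp_out stdM (fun i =>
  if pselect (valid i.1 i.2) then lhom_comp (std_at i.2) (lhom_comp T (cp_in stdN i.1))
  else zhom _ _).
have kE a q u : k (cp_in stdM (a, q) u) =
    if pselect (valid a q) then std_at q (T (cp_in stdN a u)) else 0.
  by rewrite /k cp_outE /=; case: pselect => nv /=; rewrite ?zhomE.
exists k; split=> /=.
  apply: (cp_ext (f := lhom_comp k std_io) (g := lhom_comp std_io T)) => a u /=.
  by rewrite {1}/std_io cp_outE kE; case: pselect => [v|[]].
apply: (cp_ext (f := lhom_comp k std_z) (g := lhom_comp std_z k)) => -[a q] u /=.
rewrite {1}/std_z cp_outE kE; case: q => [|g q].
  rewrite zhomE linear0; case: pselect => v0 /=; last by rewrite linear0.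
  have h n : std_z (std_at [::] n) = zhom stdN stdM n.
    apply: (cp_ext (f := lhom_comp std_z (std_at [::])) (g := zhom stdN stdM)) => x v /=.
    by rewrite /std_at cp_outE /std_z cp_outE !zhomE.
  by rewrite h zhomE.
case: (pselect (lt g (rank (a, q)))) => gq /=; last first.
  rewrite zhomE linear0; case: pselect => [[]//|nv] /=; by rewrite linear0.
rewrite kE; case: (pselect (valid a q)) => vq; last first.
  by case: pselect => [[]//|nv] /=; rewrite linear0.
case: pselect => [v1|[]//] /=.
apply/eqP; rewrite -subr_eq0; apply/eqP; set n := T _.
have [d dE] : exists d : lhom stdN stdM, forall m, d m = std_at q m - std_z (std_at (g :: q) m).
  apply: linear_exists => c x y /=; rewrite !linearD !linearZ /=.
  by rewrite addrACA scalerDr.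
rewrite -dE; apply: cp_vanish => x; rewrite dE.
rewrite !std_atE /std_z cp_outE.
case: pselect => [gx|ngx] /=; first by rewrite subrr.
suff -> : cp_co x n = 0 by rewrite linear0 zhomE subrr.
apply: tT; have [//|xa|ax] := lt_tri x a; case: ngx.
  by rewrite xa.
by case: (q) gq => [|? ?] //= ga; apply: lt_tr ga ax.
Qed.

End StandardRuler.
End Semantics.

(** * Points and coded functions on standard rulers *)

Section StandardPoints.
Variables (R : pzRingType) (localR : local_ring R).
Variables (U : lmodule R) (u0 : elements U) (val : elements U -> R).
Hypothesis freeU : free_on u0 val.
Variables (W : Type) (lt : W -> W -> Prop) (wo : strict_wo lt) (sW : small W).

Local Notation ruler := (ruler (@Hom (Mod R))).
Local Notation N := (stdN U sW).
Local Notation std := (std U lt sW).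

Let lt_irr a : ~ lt a a. Proof. by case: wo => wf _ _; exact: wf_irr. Qed.
Let lt_tri a b : [\/ lt a b, a = b | lt b a]. Proof. by case: wo. Qed.

Definition std_pt (a : W) : lhom U (rN std) := cp_in N a.
Definition std_cv (a : W) (n : elements N) : R := val (cp_co a n).

Lemma std_coE a n : cp_co a n = std_cv a n *: u0.
Proof. by rewrite /std_cv (valE freeU). Qed.

Lemma std_pt_isPt a : isPt (std_pt a) (cp_co a : lhom (rN std) U).
Proof.
split=> [u|c]; first exact: cp_co_in.
apply: (triangular_rhom (lt := lt)) => // b d u db /=.
have [e|ba] := pselect (b = a).
  by subst b; rewrite cp_co_neq // => e; rewrite e in db; exact: lt_irr db.
  by rewrite [cp_co a _]cp_co_neq // (lhom0 c) !lhom0.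
Qed.

(* In a point the lowest component is a unit. *)
Definition is_lead (x : lhom U (rN std)) (a : W) : Prop :=
  (forall b, lt b a -> cp_co b (x u0) = 0) /\ invertible (std_cv a (x u0)).

Lemma std_pt_lead a : is_lead (std_pt a) a.
Proof.
split=> [b ba|].
  by rewrite cp_co_neq // => e; rewrite e in ba; exact: lt_irr ba.
rewrite /std_cv cp_co_in -[u0]scale1r (valK freeU).
by exists 1; rewrite mulr1.
Qed.

(** Expanding [p x = 1] in the basis writes 1 as a sum of products of a component of [x] and a value
    of [p]; as the ring is local, one product is a unit, and so are its factors. Triangularity of
    [x p] at this index [a] kills the lower components of [x] up to the unit value of [p]. *)
Lemma isPt_lead (x : lhom U (rN std)) p : isPt x p -> exists a, is_lead x a.
Proof.
move=> [px cx]; have [s [xs _]] := cp_decomp (x u0 : elements N).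
pose d a := val (p (std_pt a u0)).
have : invertible (\sum_(a <- s) std_cv a (x u0) * d a).
  suff -> : \sum_(a <- s) std_cv a (x u0) * d a = 1.
    by exists 1; rewrite mulr1.
  have -> : 1 = val u0 by rewrite -[u0]scale1r (valK freeU).
  rewrite -{2}(px u0) {2}xs lhom_sum (val_sum freeU); apply: eq_bigr => a _.
  by rewrite std_coE !lhomZ (valZ freeU).
move=> /(invertible_sum localR)[a /(invertibleM localR)[inva [t [dt _]]]].
exists a; split=> // b ba.
have := rhom_triangular wo (cx (lhom_id U)) u0 ba => /=.
rewrite (homE freeU x) lhomZ.
by move=> /(congr1 (fun v => t *: v)); rewrite scaler0 scalerA dt scale1r.
Qed.

(** One triangular map sends the basis element at [a] to [x] and the others to zero; the one back
    divides the component at [a] by the leading unit. *)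
Lemma lead_eqv (x : lhom U (rN std)) a : is_lead x a -> eqv (std_pt a) x.
Proof.
move=> [x0 [s [sx xs]]]; split.
  exists (cp_out N (fun b => if pselect (b = a) then x else zhom _ _)); split; last first.
    by move=> u; rewrite /std_pt cp_outE; case: pselect.
  apply: (triangular_rhom (lt := lt)) => // b c u cb; rewrite cp_outE.
  case: pselect => [e|_] /=; last by rewrite zhomE lhom0.
  by subst b; rewrite (homE freeU x) lhomZ x0 ?scaler0.
pose h := hom_of freeU (s *: u0).
exists (lhom_comp (lhom_comp (std_pt a) h) (cp_co a)); split.
  apply: (triangular_rhom (lt := lt)) => // b c u cb /=.
  have [e|ba] := pselect (b = a); last first.
    by rewrite [cp_co a _]cp_co_neq // (lhom0 h) (lhom0 (std_pt a)) lhom0.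
  by subst b; rewrite [cp_co c _]cp_co_neq // => e; rewrite e in cb; exact: lt_irr cb.
apply: (hom_ext freeU (g := lhom_comp (lhom_comp (lhom_comp (std_pt a) h) (cp_co a)) x)).
by rewrite /= hom_ofE scalerA xs scale1r.
Qed.

(** Components above [b] contribute nothing at [b] or below, so at the lowest position only the
    diagonal entry of [T] acts. *)
Lemma tri_co (T : lhom N N) b n : triangular lt T -> (forall c, lt c b -> cp_co c n = 0) ->
  (forall c, lt c b -> cp_co c (T n) = 0) /\
  std_cv b (T n) = std_cv b n * std_cv b (T (std_pt b u0)).
Proof.
move=> tT n0.
have comp c d : lt c d -> cp_co c (T (cp_in N d (cp_co d n))) = 0 by move=> /tT.
split=> [c cb|].
  apply: (cp_vanish (f := lhom_comp (cp_co c) T)) => d /=.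
  have [db|db|bd] := lt_tri d b; first by rewrite n0 // !lhom0.
    by apply: comp; rewrite db.
  by apply: comp; have [_ tr _] := wo; exact: tr cb bd.
have [d dE] : exists d : lhom N N, forall m, d m = m - std_pt b (cp_co b m).
  apply: linear_exists => c x y /=; rewrite !linearD !linearZ /=.
  by rewrite addrACA scalerDr.
have : cp_co b (T (d n)) = 0.
  apply: (cp_vanish (f := lhom_comp (cp_co b) (lhom_comp T d))) => c /=; rewrite dE.
  have [cb|->|bc] := lt_tri c b.
  - by rewrite n0 // (lhom0 (cp_in N c)) (lhom0 (cp_co b)) (lhom0 (std_pt b)) subr0 !lhom0.
  - by rewrite cp_co_in subrr (lhom0 T) lhom0.
  - rewrite [cp_co b (cp_in _ _ _)]cp_co_neq ?(lhom0 (std_pt b)) ?subr0; first exact: comp.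
    by move=> e; rewrite e in bc; exact: lt_irr bc.
rewrite dE => /eqP; rewrite (_ : T _ = T n - T (std_pt b (cp_co b n))); last exact: linearB.
rewrite (_ : cp_co b (_ - _) = cp_co b (T n) - cp_co b (T (std_pt b (cp_co b n)))); last exact: linearB.
rewrite subr_eq0 => /eqP; rewrite {1}/std_cv => ->.
by rewrite (std_coE b n) !lhomZ (valZ freeU).
Qed.

(** The image [y] has no component below [a], and writing [x] as an image of [y] makes the leading
    unit of [x] a multiple of the component of [y] at [a]. *)
Lemma eqv_lead (x y : lhom U (rN std)) a : eqv x y -> is_lead x a -> is_lead y a.
Proof.
move=> [[T [/(rhom_triangular wo) hT yT]] [S [/(rhom_triangular wo) hS xS]]] [x0 inv].
have y0 := (tri_co hT x0).1; rewrite -yT in y0.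
split=> //; move: inv; rewrite xS.
by rewrite (tri_co hS y0).2 => /(invertibleM localR)[].
Qed.

Lemma lead_uniq (x : lhom U (rN std)) a b : is_lead x a -> is_lead x b -> a = b.
Proof.
move=> [x0 ia] [y0 ib]; have [ab|//|ba] := lt_tri a b.
  by move: ia; rewrite /std_cv y0 // (val0 freeU) => /(not_invertible0 localR).
by move: ib; rewrite /std_cv x0 // (val0 freeU) => /(not_invertible0 localR).
Qed.

Lemma lead_eqv2 (x y : lhom U (rN std)) a : is_lead x a -> is_lead y a -> eqv x y.
Proof. by move=> /lead_eqv/eqv_sym ax /lead_eqv; apply: eqv_trans. Qed.

Section FunctionCode.
Variables (Z : ruler) (x : W -> lhom U (rN Z)) (p : W -> lhom (rN Z) U).
Hypothesis xp : forall s, isPt (x s) (p s).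

Let CN : copower W (rN Z) := cpo sW (rN Z).
Let CM : copower W (rM Z) := cpo sW (rM Z).
Let Cio : lhom CN CM := cp_out CN (fun s => lhom_comp (cp_in CM s) (rio Z)).
Let Cz : lhom CM CM := cp_out CM (fun s => lhom_comp (cp_in CM s) (rz Z)).

Definition sum_ruler : ruler := @Ruler _ (@Hom (Mod R)) CN CM Cio Cz.

Definition fun_code : code (@Hom (Mod R)) (rN std) :=
  @Code _ (@Hom (Mod R)) (rN std) sum_ruler
    (cp_out N (fun s => lhom_comp (cp_in CN s) (x s)) : lhom N CN).

Lemma sum_in_rhom s : rhom (Z := Z) (Z' := sum_ruler) (cp_in CN s).
Proof.
exists (cp_in CM s); split=> v /=.
  by rewrite /Cio cp_outE.
by rewrite /Cz cp_outE.
Qed.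

Lemma sum_out_rhom s : rhom (Z := sum_ruler) (Z' := Z) (cp_co s : lhom CN _).
Proof.
exists (cp_co s : lhom CM _); split=> /=.
  apply: (cp_ext (f := lhom_comp (cp_co s) Cio) (g := lhom_comp (rio Z) (cp_co s))) => t v /=.
  rewrite /Cio cp_outE /=; have [->|ts] := pselect (t = s); first by rewrite !cp_co_in.
  by rewrite !cp_co_neq // lhom0.
apply: (cp_ext (f := lhom_comp (cp_co s) Cz) (g := lhom_comp (rz Z) (cp_co s))) => t v /=.
rewrite /Cz cp_outE /=; have [->|ts] := pselect (t = s); first by rewrite !cp_co_in.
by rewrite !cp_co_neq // lhom0.
Qed.

(** The component of [h v] in the copy at [s] is [x s] times the leading unit of [w]. Dividing by
    this unit through the point [x s] is a morphism of rulers because [isPt] asks for [x c p] with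
    every [c], and it exhibits [x s] as lying above [v]. *)
Lemma fun_code_reach (y : lhom U (rN std)) s (v : lhom U (rN Z)) : is_lead y s ->
  reach fun_code y v <-> le v (x s).
Proof.
move=> ys; split=> [[w /eqv_lead/(_ ys) [w0 [t [tw wt]]] [h hh e]]|[T [hT xT]]]; last first.
  exists (std_pt s); first exact/eqv_sym/lead_eqv.
  exists (lhom_comp (cp_in CN s) T); first exact: (rhom_comp (sum_in_rhom s) hT).
  by move=> u; rewrite /std_pt /= cp_outE /= xT.
have e0 : cp_co s (h (v u0) : elements CN) = std_cv s (w u0) *: x s u0.
  rewrite -e /= -lhomZ -std_coE.
  suff : forall n : elements N, cp_co s (cp_out N (fun s => lhom_comp (cp_in CN s) (x s)) n : elements CN)
      = x s (cp_co s n) by [].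
  apply: (cp_ext (f := lhom_comp (cp_co s : lhom CN _) (cp_out N (fun s => lhom_comp (cp_in CN s) (x s))))
    (g := lhom_comp (x s) (cp_co s))) => a u /=; rewrite cp_outE /=.
  have [->|ts] := pselect (a = s); first by rewrite !cp_co_in.
  by rewrite !cp_co_neq // lhom0.
have [px cx] := xp s.
exists (lhom_comp (lhom_comp (lhom_comp (x s) (hom_of freeU (t *: u0))) (p s))
  (lhom_comp (cp_co s : lhom CN _) h)); split.
  by apply: rhom_comp; [exact: cx|exact: (rhom_comp (sum_out_rhom s) hh)].
apply: (hom_ext freeU (g := lhom_comp _ v)) => /=.
rewrite e0 (lhomZ (p s)) px (hom_ofE freeU) (valZ freeU).
by rewrite -{3}[u0]scale1r (valK freeU) mulr1 scalerA wt scale1r.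
Qed.

Lemma fun_code_is_fun (y : lhom U (rN std)) s (v : lhom U (rN Z)) : is_lead y s ->
  is_fun fun_code y v <-> eqv v (x s).
Proof.
move=> ys; split=> [[/(fun_code_reach _ ys) vx h]|[vx xv]].
  by split=> //; apply: h (xp s) _; apply/(fun_code_reach _ ys)/le_refl.
split=> [|v' p' _ /(fun_code_reach _ ys) h]; first exact/(fun_code_reach _ ys).
exact: le_trans h xv.
Qed.

End FunctionCode.
End StandardPoints.

(** * The free module of rank one and addition *)

Section Quotient.
Variables (R : pzRingType) (U : lmodType R) (J : set U).
Hypothesis (J0 : J 0) (JL : forall a x y, J x -> J y -> J (a *: x + y)).

Let JN x : J x -> J (- x).
Proof. by move=> /JL/(_ J0); rewrite -[- x]addr0 -scaleN1r; exact. Qed.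
Let JD x y : J x -> J y -> J (x + y).
Proof. by move=> Jx Jy; rewrite -[x]scale1r; exact: JL. Qed.

(** The quotient is carried by chosen representatives; as a subtype of [U] it inherits smallness. *)
Let can (x : U) : U := xget 0 [set y | J (x - y)].

Let canJ x : J (x - can x).
Proof. by apply: (@xgetPex _ 0 [set y | J (x - y)]); exists x; rewrite /= subrr. Qed.

Let can_eq x y : J (x - y) -> can x = can y.
Proof.
move=> xy; congr xget; apply/seteqP; split=> z /= h.
  by rewrite -(subrKA x) -(opprB x y); apply: JD h; exact: JN.
by rewrite -(subrKA y); apply: JD.
Qed.

Let can_id x : can (can x) = can x.
Proof. by apply: can_eq; rewrite -opprB; apply/JN/canJ. Qed.

(* The hypotheses are parameters of the type for the sake of its module structure. *)
Definition quot_type : Type :=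
  let _ := J0 in let _ := JL in {x : U | can x = x}.
Definition quot_pr (x : U) : quot_type := exist _ (can x) (can_id x).

Lemma quot_prE x y : quot_pr x = quot_pr y <-> J (x - y).
Proof.
split=> [[e]|/can_eq e]; last exact: eq_exist.
rewrite -(subrKA (can x)); apply: JD; first exact: canJ.
by rewrite e -opprB; apply/JN/canJ.
Qed.

Lemma quot_prK (q : quot_type) : quot_pr (sval q) = q.
Proof. by case: q => x xc; apply: eq_exist. Qed.

HB.instance Definition _ := gen_eqMixin quot_type.
HB.instance Definition _ := gen_choiceMixin quot_type.

Let lin a (p q : quot_type) := quot_pr (a *: sval p + sval q).

Let lin_pr a x y : lin a (quot_pr x) (quot_pr y) = quot_pr (a *: x + y).
Proof.
apply/quot_prE; rewrite /= opprD addrACA -scalerBr.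
by apply: JL; rewrite -opprB; apply/JN/canJ.
Qed.

Let add p q := lin 1 p q.
Let scale a p := lin a p (quot_pr 0).
Let opp p := scale (-1) p.

Let prP (p : quot_type) : exists x, p = quot_pr x.
Proof. by exists (sval p); rewrite quot_prK. Qed.

Let addA : associative add.
Proof.
move=> p q r; have [x ->] := prP p; have [y ->] := prP q; have [z ->] := prP r.
by rewrite /add !lin_pr !scale1r addrA.
Qed.
Let addC : commutative add.
Proof.
move=> p q; have [x ->] := prP p; have [y ->] := prP q.
by rewrite /add !lin_pr !scale1r addrC.
Qed.
Let add0 : left_id (quot_pr 0) add.
Proof. by move=> p; have [x ->] := prP p; rewrite /add lin_pr scale1r add0r. Qed.
Let addN : left_inverse (quot_pr 0) opp add.
Proof.
move=> p; have [x ->] := prP p.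
by rewrite /add /opp /scale !lin_pr scale1r addr0 scaleN1r addNr.
Qed.
HB.instance Definition _ := GRing.isZmodule.Build quot_type addA addC add0 addN.

Let scaleA a b p : scale a (scale b p) = scale (a * b) p.
Proof. by have [x ->] := prP p; rewrite /scale !lin_pr !addr0 scalerA. Qed.
Let scale1 : left_id 1 scale.
Proof. by move=> p; have [x ->] := prP p; rewrite /scale lin_pr addr0 scale1r. Qed.
Let scaleDr : right_distributive scale +%R.
Proof.
move=> a p q; have [x ->] := prP p; have [y ->] := prP q.
change (scale a (add (quot_pr x) (quot_pr y)) = add (scale a (quot_pr x)) (scale a (quot_pr y))).
by rewrite /scale /add !lin_pr !scale1r !addr0 scalerDr.
Qed.
Let scaleDl p : {morph scale^~ p : a b / a + b}.
Proof.
move=> a b; have [x ->] := prP p.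
change (scale (a + b) (quot_pr x) = add (scale a (quot_pr x)) (scale b (quot_pr x))).
by rewrite /scale /add !lin_pr !scale1r !addr0 scalerDl.
Qed.
HB.instance Definition _ := GRing.Zmodule_isLmodule.Build R quot_type
  scaleA scale1 scaleDr scaleDl.

Lemma quot_pr_linear a x y :
  quot_pr (a *: x + y) = a *: quot_pr x + quot_pr y :> quot_type.
Proof.
change (quot_pr (a *: x + y) = add (scale a (quot_pr x)) (quot_pr y)).
by rewrite /add /scale !lin_pr scale1r addr0.
Qed.

End Quotient.

Section Unit.
Variables (R : pzRingType) (localR : local_ring R) (smallR : small R).
Local Notation lmodule := (lmodule R).

Lemma quotient_exists (U : lmodule) (J : set (elements U)) : J 0 ->
    (forall a x y, J x -> J y -> J (a *: x + y)) ->
  exists (Q : lmodule) (q : lhom U Q), forall x, q x = 0 <-> J x.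
Proof.
move=> J0 JL.
have sT : small (quot_type J0 JL) by apply/small_sig/small_members.
have [Q [f [g [fK gK _]]]] := lmodule_exists [::] sT.
have [q qE] : exists q : lhom U Q, forall x, q x = f (quot_pr J0 JL x).
  by apply: linear_exists => a x y; rewrite quot_pr_linear linearP.
exists Q, q => x; rewrite qE -[in X in _ <-> X](subr0 x) -(quot_prE J0 JL).
split=> [|->]; last exact: linear0.
by move=> /(congr1 g); rewrite linear0 fK.
Qed.

Lemma regular_exists : exists (U : lmodule) u0 val, @free_on R U u0 val.
Proof.
have [U [f [g [fK gK _]]]] := @lmodule_exists R R^o [::] smallR.
exists U, (f 1), g; split=> [u|r]; last by rewrite linearZ /= fK; exact: mulr1.
by rewrite -linearZ (_ : _ *: _ = g u) ?gK //; exact: mulr1.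
Qed.

Definition generator (G : lmodule) : Prop := forall (X Y : lmodule) (f g : lhom X Y),
  (forall (u : lhom G X) x, f (u x) = g (u x)) -> forall x, f x = g x.

Lemma GenP (G : lmodule) : denote (C := Mod R) (fGen (@Hom (Mod R)) G) <-> generator G.
Proof.
split=> h X Y f g.
  move=> fg; have -> : f = g by apply: (h X Y f g) => u; apply/CompEqP/fg.
  by [].
by move=> fg; apply/linear_ext/h => u; apply/CompEqP/fg.
Qed.

Section Free.
Variables (U : lmodule) (u0 : elements U) (val : elements U -> R).
Hypothesis freeU : free_on u0 val.

Lemma free_generator : generator U.
Proof.
by move=> X Y f g fg x; have := fg (hom_of freeU x) u0; rewrite hom_of1.
Qed.

(** Otherwise all maps from [G] to [U] land in the non-units, a submodule since the ring is local.
    Then [G] does not separate the quotient map by this submodule from zero. *)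
Lemma generator_onto (G : lmodule) : generator G ->
  exists (f : lhom G U) x, invertible (val (f x)).
Proof.
move=> genG; apply: contrapT => no.
have [J0 JD JM] := localR.
have [||Q [q qE]] := @quotient_exists U [set u | ~ invertible (val u)].
- by rewrite /= (val0 freeU).
- by move=> a x y /= hx hy; rewrite (val_linear freeU); apply: JD => //; exact: JM.
have /qE : q u0 = 0.
  rewrite -[RHS](zhomE Q u0); apply: (genG) => f x; rewrite zhomE; apply/qE => inv.
  by apply: no; exists f, x.
apply; rewrite -[u0]scale1r (valK freeU); exists 1; rewrite !mulr1; by [].
Qed.

Lemma free_retract (G : lmodule) : generator G ->
  exists (i : lhom U G) (p : lhom G U), forall u, p (i u) = u.
Proof.
move=> /generator_onto[f [x [s [sf fs]]]].
exists (hom_of freeU x), (lhom_comp (hom_of freeU (s *: u0)) f).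
apply: (hom_ext freeU (f := lhom_comp _ _) (g := lhom_id _)) => /=.
by rewrite hom_of1 hom_ofE scalerA fs scale1r.
Qed.

(** The idempotent [i p] is right multiplication by an idempotent [e]. In a local ring [e] or
    [1 - e] is a unit, so [e] is 1 or 0. *)
Lemma free_idempotent (V' : lmodule) (i : lhom V' U) (p : lhom U V') :
  (forall v, p (i v) = v) -> (forall u, i (p u) = u) \/ (forall v : elements V', v = 0).
Proof.
move=> pi; pose e := val (i (p u0)).
have iE u : i (p u) = (val u * e) *: u0.
  by rewrite -{1}(valE freeU u) !lhomZ -scalerA (valE freeU).
have ee : e * e = e.
  by have := iE (i (p u0)); rewrite pi => /(congr1 val); rewrite (valK freeU) => <-.
have [J0 JD JM] := localR.
have [[s [se es]]|ne] := pselect (invertible e).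
  left=> u; have e1 : e = 1 by rewrite -[e]mul1r -se -mulrA ee.
  by rewrite iE e1 mulr1 (valE freeU).
have [[s [se es]]|ne'] := pselect (invertible (1 - e)).
  right=> v; have e0 : e = 0.
    by rewrite -[e]mul1r -se -mulrA mulrBl mul1r ee subrr mulr0.
  by rewrite -(pi v) -(pi (p (i v))) iE e0 mulr0 scale0r lhom0.
by have := JD _ _ ne ne'; rewrite /= addrC subrK => -[]; exists 1; rewrite mulr1.
Qed.

End Free.

(** Applied to the regular module, the formula makes [U] a retract of it. The regular module has no
    proper nonzero retract, and zero is not a generator. *)
Lemma UnitP (U : lmodule) : denote (C := Mod R) (fUnit (@Hom (Mod R)) U) <->
  exists u0 val, @free_on R U u0 val.
Proof.
split=> [[/GenP genU h]|[u0 [val freeU]]].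
  have [V' [v0 [val freeV]]] := regular_exists.
  have [i [p ip]] : denote (C := Mod R) (fRetract (@Hom (Mod R)) U V').
    by apply: h; apply/GenP; exact: free_generator freeV.
  have pi v : p (i v) = v by exact: (congr1 (fun k : lhom U U => k v) ip).
  have [ip'|U0] := free_idempotent freeV pi.
    exists (p v0), (fun u => val (i u)); split=> [u|r].
      by rewrite -lhomZ (valE freeV) pi.
    by rewrite lhomZ ip' (valK freeV).
  have : v0 = 0.
    rewrite -(zhomE V' v0) -[LHS]/(lhom_id V' v0); apply: genU => u x.
    by rewrite zhomE (U0 x) !lhom0.
  move=> /(congr1 val); rewrite (val0 freeV) -[v0]scale1r (valK freeV) => e.
  by have := not_invertible0 localR; rewrite -e => -[]; exists 1; rewrite mulr1.
split; first by apply/GenP; exact: free_generator freeU.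
move=> G /GenP /(free_retract freeU)[i [p ip]]; exists i, p.
exact: linear_ext.
Qed.

Lemma AddP (U : lmodule) u0 val (freeU : @free_on R U u0 val) (r1 r2 r3 : lhom U U) :
  denote (C := Mod R) (fAdd r1 r2 r3) <-> forall u, r1 u = r2 u + r3 u.
Proof.
have ZeroP (X Y : lmodule) (h : lhom X Y) :
    denote (C := Mod R) (fZero U h) <-> forall x, h x = 0.
  split=> [hh x|h0 f g]; last by apply/CompEqP => x; rewrite !h0.
  have /CompEqP/(_ u0) := hh (hom_of freeU x) (zhom U X).
  by rewrite zhomE lhom0 hom_of1.
split.
  move=> [B [i1 [i2 [p1 [p2 [[/EqCompP p11 /EqCompP p22] [[/ZeroP p12 /ZeroP p21]
    [mono [d [s [[/EqCompP p1d /EqCompP p2d] [[/EqCompP s1 /EqCompP s2] /EqCompP r1E]]]]]]]]]]]] u.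
  have [d' d'E] : exists d' : lhom U B, forall x, d' x = i1 (r2 x) + i2 (r3 x).
    by apply: linear_exists => a x y; rewrite !linearP /= scalerDr addrACA.
  have e : d = d'.
    apply: mono; apply/CompEqP => x; rewrite d'E lhomD.
      by rewrite -p1d -p11 [p1 (i2 _)]p12 addr0.
    by rewrite -p2d -p22 [p2 (i1 _)]p21 add0r.
  by rewrite r1E e d'E lhomD -s1 -s2.
move=> r1E; pose B := cpo small_bool U; exists (B : lmodule).
exists (cp_in B true), (cp_in B false), (cp_co true : lhom B U), (cp_co false : lhom B U).
split; [|split; [|split]].
- by split; apply/EqCompP => x; rewrite cp_co_in.
- by split; apply/ZeroP => x /=; rewrite cp_co_neq.
- move=> a b /CompEqP ab1 /CompEqP ab2; apply: linear_ext => u.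
  apply/eqP; rewrite -subr_eq0; apply/eqP.
  have e i : cp_co i (a u : elements B) = cp_co i (b u) by case: i; [exact: ab1|exact: ab2].
  apply: (cp_vanish (P := B) (f := lhom_id B)) => i.
  rewrite (_ : cp_co i (a u - b u) = cp_co i (a u : elements B) - cp_co i (b u)).
    by rewrite e subrr !lhom0.
  exact: linearB.
have [d dE] : exists d : lhom U B, forall u, d u = cp_in B true (r2 u) + cp_in B false (r3 u).
  by apply: linear_exists => a x y; rewrite !linearP /= scalerDr addrACA.
exists d, (cp_out B (fun _ => lhom_id U)); split; [|split; [split|]]; first split;
  apply/EqCompP => u.
- by rewrite dE lhomD cp_co_in cp_co_neq // addr0.
- by rewrite dE lhomD cp_co_in cp_co_neq // add0r.
- by rewrite cp_outE.
- by rewrite cp_outE.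
- by rewrite dE lhomD !cp_outE r1E.
Qed.

End Unit.

(** * Coding of relations and of ring elements *)

Section Relations.
Variables (R : pzRingType) (localR : local_ring R).
Variables (U : lmodule R) (u0 : elements U) (val : elements U -> R).
Hypothesis freeU : free_on u0 val.

Local Notation HomR := (@Hom (Mod R)).
Local Notation ruler := (ruler HomR).
Local Notation rel := (rel HomR).
Local Notation spt := (spt HomR U).
Local Notation code := (code HomR).

Definition isPtIn (Z : ruler) (a : spt) : Prop := sZ a = Z /\ isPt (sx a) (sp a).

(** The rulers of the two points are a priori different; an inductive definition avoids transport
    along their equality. *)
Inductive speqv : spt -> spt -> Prop :=
  SpEqv Z (x y : lhom U (rN Z)) (p q : lhom (rN Z) U) : eqv x y ->
    speqv (@Spt _ _ _ Z x p) (@Spt _ _ _ Z y q).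

Lemma speqv_refl a : speqv a a.
Proof. by case: a => Z x p; constructor; exact: eqv_refl. Qed.

Lemma speqv_sym a b : speqv a b -> speqv b a.
Proof. by case=> Z x y p q h; constructor; exact: eqv_sym. Qed.

Lemma Spt_inj (Z : ruler) (x y : lhom U (rN Z)) p q :
  @Spt _ HomR U Z x p = @Spt _ HomR U Z y q -> x = y.
Proof.
move=> /(congr1 (fun a => existT (fun Z : ruler => lhom U (rN Z)) (sZ a) (sx a))).
exact: inj_pair2.
Qed.

Lemma speqvE (Z : ruler) (x y : lhom U (rN Z)) p q :
  speqv (@Spt _ HomR U Z x p) (@Spt _ HomR U Z y q) -> eqv x y.
Proof.
move e1 : (Spt x p) => a; move e2 : (Spt y q) => b ab.
case: ab e1 e2 => Z' x' y' p' q' xy e1 e2.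
have eZ : Z = Z' := congr1 (fun a : spt => sZ a) e1.
by subst Z'; rewrite (Spt_inj e1) (Spt_inj e2).
Qed.

Fixpoint funs (P : ruler) (cs : seq (code (rN P))) (y : lhom U (rN P))
    (args : seq spt) : Prop :=
  match cs, args with
  | c :: cs, a :: args => is_fun c y (sx a) /\ funs cs y args
  | [::], [::] => True
  | _, _ => False
  end.

Definition app (r : rel) (args : seq spt) : Prop :=
  exists y q, @isPt R U (rP r) y q /\ funs (rcs r) y args.

Lemma FunsP (P : ruler) (cs : seq (code (rN P))) (y : lhom U (rN P)) args :
  denote (C := Mod R) (fFuns cs y args) <-> funs cs y args.
Proof.
elim: cs args => [|c cs IH] [|a args] /=.
- by split.
- by split=> // h; case: h.
- by split=> // h; case: h.
- by split=> -[h1 h2]; split; first [exact/FunP | exact/IH].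
Qed.

Lemma AppP r args : denote (C := Mod R) (fApp r args) <-> app r args.
Proof.
by split=> -[y [q [yq h]]]; exists y, q; split; first [exact/PtP | exact/FunsP].
Qed.

Lemma ExPtP (Z : ruler) k : denote (C := Mod R) (@fExPt _ HomR U Z k) <->
  exists2 a, isPtIn Z a & denote (k a).
Proof.
split=> [[x [p [/PtP xp h]]]|[a]]; first by exists (@Spt _ HomR U Z x p).
by case: a => Z' x p [/= <- xp] h; exists x, p; split=> //; exact/PtP.
Qed.

Lemma AllPtP (Z : ruler) k : denote (C := Mod R) (@fAllPt _ HomR U Z k) <->
  forall a, isPtIn Z a -> denote (k a).
Proof.
split=> [h [Z' x p] [/= e xp]|h x p /PtP xp]; last exact: h.
by subst Z'; apply: h; exact/PtP.
Qed.

Fixpoint ptargs (Zs : seq ruler) (args : seq spt) : Prop :=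
  match Zs, args with
  | Z :: Zs, a :: args => isPtIn Z a /\ ptargs Zs args
  | [::], [::] => True
  | _, _ => False
  end.

Fixpoint eqvs (args args' : seq spt) : Prop :=
  match args, args' with
  | a :: args, b :: args' => speqv a b /\ eqvs args args'
  | [::], [::] => True
  | _, _ => False
  end.

Lemma eqvs_refl args : eqvs args args.
Proof. by elim: args => //= a args IH; split=> //; exact: speqv_refl. Qed.

Lemma eqvs_sym args args' : eqvs args args' -> eqvs args' args.
Proof.
elim: args args' => [|a args IH] [|b args'] //= [ab h].
by split; [exact: speqv_sym|exact: IH].
Qed.

Lemma small_lhom (X Y : lmodule R) : small (lhom X Y).
Proof.
apply: (@small_inj _ (elements X -> elements Y) (fun f : lhom X Y => (f : _ -> _))).
  by move=> f g fg; apply: linear_ext => x; rewrite fg.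
by apply: small_fun; exact: small_members.
Qed.

(** A relation will be indexed by its own tuples, so these must form a small type to carry a
    ruler. *)
Lemma small_ptargs Zs : small {args | ptargs Zs args}.
Proof.
elim: Zs => [|Z Zs IH].
  apply: (@small_inj _ nat (fun _ => 0%N) _ small_nat).
  by move=> [[|? ?] //= p] [[|? ?] //= q] _; exact: eq_exist.
have ex (w : {args | ptargs (Z :: Zs) args}) :
    exists t : lhom U (rN Z) * lhom (rN Z) U * {args | ptargs Zs args},
      sval w = @Spt _ HomR U Z t.1.1 t.1.2 :: sval t.2.
  case: w => [[|[Z' x p] args] //= [[/= e xp] h]]; subst Z'.
  by exists (x, p, exist _ args h).
have [f fE] := boolp.choice ex.
apply: (@small_inj _ _ f).
  by move=> v w e; apply: eq_sig_hprop; [move=> ? ? ?; exact: Prop_irrelevance|rewrite !fE e].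
by apply: small_prod IH; apply: small_prod; exact: small_lhom.
Qed.

Lemma codes_exist (W : Type) (lt : W -> W -> Prop) (wo : strict_wo lt) (sW : small W)
    Zs (F : W -> seq spt) : (forall w, ptargs Zs (F w)) ->
  exists cs : seq (code (rN (std U lt sW))), size cs = size Zs /\
    forall y s args, is_lead u0 val y s -> ptargs Zs args ->
      (funs cs y args <-> eqvs args (F s)).
Proof.
elim: Zs F => [|Z Zs IH] F FZ.
  exists [::]; split=> // y s [|//] _ _.
  by have := FZ s; case: (F s) => //= a l [].
have ex w : exists t : lhom U (rN Z) * lhom (rN Z) U * seq spt,
    [/\ F w = @Spt _ HomR U Z t.1.1 t.1.2 :: t.2, isPt t.1.1 t.1.2 & ptargs Zs t.2].
  have := FZ w; case: (F w) => [|[Z' x p] args] //= [[/= e xp] h]; subst Z'.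
  by exists (x, p, args).
have [f fP] := boolp.choice ex.
have [w|cs [scs csP]] := IH (fun w => (f w).2); first by case: (fP w).
have xp s : isPt (f s).1.1 (f s).1.2 by case: (fP s).
exists (fun_code lt sW (fun s => (f s).1.1) :: cs); split=> /= [|y s]; first by rewrite scs.
case=> [|[Z' x p] args] // ys [[/= e xp'] h]; subst Z'.
have [-> _ _] := fP s.
rewrite (csP y s args ys h) (fun_code_is_fun localR freeU wo xp _ ys) /=.
split=> -[h1 h2]; split=> //.
exact: speqvE h1.
Qed.

(** The tuples satisfying [P], in any well-order, form the ruler that indexes the relation, and the
    coordinates are the coded functions. Codes see points only up to equivalence, whence the
    invariance asked of [P]. *)
Lemma rel_exists Zs (P : seq spt -> Prop) :
    (forall args args', ptargs Zs args -> ptargs Zs args' ->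
       eqvs args args' -> P args -> P args') ->
  exists2 r : rel, size (rcs r) = size Zs &
    forall args, ptargs Zs args -> (app r args <-> P args).
Proof.
move=> Pinv; pose W := {args | ptargs Zs args /\ P args}.
have sW : small W.
  apply: (@small_inj _ _ (fun w : W => exist (ptargs Zs) (sval w) (svalP w).1) _ (small_ptargs Zs)).
  by move=> [a pa] [b pb] /= [ab]; exact: eq_exist.
have [lt wo] := wo_exists W.
have [w|cs [scs csP]] := @codes_exist W lt wo sW Zs (fun w => sval w); first by case: w => ? [].
exists (@Rel _ _ (std U lt sW) cs) => // args pargs; split=> [[y [q [/= yq fa]]]|Pargs].
  have [s ys] := isPt_lead localR freeU wo yq.
  move/(csP y s args ys pargs): fa => /eqvs_sym e.
  by case: s {ys} e => args' [pa Pa] /= e; exact: Pinv e Pa.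
pose s : W := exist _ args (conj pargs Pargs).
exists (std_pt U lt sW s), (cp_co s); split; first exact: (std_pt_isPt U wo sW s).
apply/(csP _ s) => //; first exact: (std_pt_lead freeU wo sW s).
exact: eqvs_refl.
Qed.

End Relations.

(** * Labels of ring elements *)

Section Frames.
Variables (R : pzRingType) (localR : local_ring R) (smallR : small R).
Variables (U : lmodule R) (u0 : elements U) (val : elements U -> R).
Hypothesis freeU : free_on u0 val.

Local Notation HomR := (@Hom (Mod R)).
Local Notation frame := (frame HomR U).

Definition isQ (F : frame) (r : lhom U U) (k : lhom U (rN (fK F))) : Prop :=
  forall T : lhom (rN (fW F)) (rN (fW F)), rhom T ->
  (exists T' : lhom (fP F) (fP F), [/\ forall x, T' (fb F x) = fb F (T x),
     forall x, T' (fs F x) = fs F (T' x) & forall x, T (fl F x) = fl F (T' x)]) ->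
  (forall x, feps F (T x) = r (feps F x)) ->
  exists (y : lhom U (rN (fW F))) (p : lhom (rN (fW F)) U),
    [/\ isPt y p, is_fun (flam F) y k & forall u, p (T (y u)) = p (fB F (y u))].

Lemma QP (F : frame) (r : lhom U U) (k : lhom U (rN (fK F))) :
  denote (C := Mod R) (fQ r k) <-> isQ r k.
Proof.
split=> h T hT.
  move=> [T' [T1 T2 T3]] e; have [|||y [p [/PtP yp [/FunP yk /CompEqP ty]]]] := h T _ _ _.
  - exact/RhomP.
  - by exists T'; split; [exact/CompEqP|split; exact/CompEqP].
  - exact/CompEqP.
  by exists y, p; split.
move=> [T' [/CompEqP T1 [/CompEqP T2 /CompEqP T3]]] /CompEqP e.
have [||y [p [yp yk ty]]] := h T _ _ e; first exact/RhomP; first by exists T'.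
exists y, p; split; first exact/PtP; split; first exact/FunP.
exact/CompEqP.
Qed.

Definition isGood (F : frame) : Prop :=
  (forall r, exists x p, @isPt R U (fK F) x p /\ isQ r x) /\
  forall r r' x p, @isPt R U (fK F) x p -> isQ r x -> isQ r' x -> r = r'.

Lemma GoodP (F : frame) : denote (C := Mod R) (fGood F) <-> isGood F.
Proof.
split=> -[h1 h2]; split.
- by move=> r; have [x [p [/PtP xp [/QP q _]]]] := h1 r; exists x, p.
- by move=> r r' x p xp q q'; apply: (h2 r r' x p); [exact/PtP|exact/QP|exact/QP].
- move=> r; have [x [p [xp q]]] := h1 r; exists x, p.
  by split; [exact/PtP|split; [exact/QP|]].
- by move=> r r' x p /PtP xp /QP q /QP q'; exact: h2 xp q q'.
Qed.

Lemma isQ_eqv (F : frame) r (x y : lhom U (rN (fK F))) : eqv x y -> isQ r x -> isQ r y.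
Proof.
move=> xy h T hT hT' e; have [z [p [zp zx tz]]] := h T hT hT' e.
by exists z, p; split=> //; exact: is_fun_eqv xy zx.
Qed.

Section Construction.
Variables (W : Type) (lt : W -> W -> Prop) (wo : strict_wo lt) (sW : small W).
Variables (ladder : nat -> W -> W) (label : W -> R).
Hypothesis ladder_le : forall n x, ladder n x = x \/ lt (ladder n x) x.
Hypothesis ladder_cof : forall x y, lt y x ->
  exists n0, forall n, (n0 <= n)%N -> lt y (ladder n x).
Hypothesis closed : forall (f : W -> W) q, exists d, [/\ label d = q,
  forall n, lt (ladder n d) d & forall c, lt c d -> lt (f c) d].
Variables (ltR : R -> R -> Prop) (woR : strict_wo ltR).

Let wf_lt : well_founded lt. Proof. by case: wo. Qed.
Let lt_irr a : ~ lt a a. Proof. exact: wf_irr. Qed.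
Let lt_tr a b c : lt a b -> lt b c -> lt a c. Proof. by case: wo => _ tr _; exact: tr. Qed.
Let lt_tri a b : [\/ lt a b, a = b | lt b a]. Proof. by case: wo. Qed.

Local Notation N := (stdN U sW).

Let sWn : small (W * nat) := small_prod sW small_nat.
Let P : copower (W * nat) U := cpo sWn U.

Let b : lhom N P := cp_out N (fun a => cp_in P (a, 0%N)).
Let s : lhom P P := cp_out P (fun i => cp_in P (i.1, i.2.+1)).
Let l : lhom P N := cp_out P (fun i => cp_in N (ladder i.2 i.1)).
Let eps : lhom N U := cp_out N (fun _ => lhom_id U).
Let B : lhom N N :=
  cp_out N (fun a => lhom_comp (cp_in N a) (hom_of freeU (label a *: u0))).

(** [P] contains a copy of [N] for each natural number, [b] enters the first copy, [s] shifts to the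
    next one, and [l] applies [ladder n] on copy [n]. A single map of [P] compatible with all three
    therefore forces commutation with every [L n]: infinitely many conditions in one formula. *)
Definition std_frame : frame :=
  @Frame _ HomR U (std U lt sW) P b s l eps B (std U ltR smallR)
    (fun_code lt sW (fun w => std_pt U ltR smallR (label w))).

Let mapc (f : lhom U U) : lhom N N := cp_out N (fun a => lhom_comp (cp_in N a) f).

Let mapc_tri f : triangular lt (mapc f).
Proof.
move=> a c u ca; rewrite /mapc cp_outE /= cp_co_neq // => e.
by rewrite e in ca; exact: lt_irr ca.
Qed.

Let row (n : nat) : lhom N P := cp_out N (fun a => cp_in P (a, n)).
Let L (n : nat) : lhom N N := cp_out N (fun a => cp_in N (ladder n a)).

Let co_L n x m : (forall z, z <> x -> cp_co z m <> 0 -> ladder n z <> ladder n x) ->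
  cp_co (ladder n x) (L n m) = cp_co x m.
Proof.
move=> h; have [d dE] : exists d : lhom N U, forall m, d m = cp_co (ladder n x) (L n m) - cp_co x m.
  apply: linear_exists => c v w /=; rewrite !linearD !linearZ /=.
  by rewrite addrACA scalerDr.
apply/eqP; rewrite -subr_eq0; apply/eqP; rewrite -dE; apply: cp_vanish => z.
rewrite dE /L cp_outE; have [->|zx] := pselect (z = x); first by rewrite !cp_co_in subrr.
rewrite [cp_co x _]cp_co_neq // subr0.
have [->|nz] := pselect (cp_co z m = 0); first by rewrite (lhom0 (cp_in N (ladder n z))) lhom0.
by rewrite cp_co_neq //; exact: h.
Qed.

Let is_fun_label (y : lhom U N) w (v : lhom U (rN (std U ltR smallR))) k :
  is_lead u0 val (y : lhom U (rN (std U lt sW))) w -> is_lead u0 val v k ->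
  is_fun (flam std_frame) (y : lhom U (rN (std U lt sW))) v <-> label w = k.
Proof.
move=> yw vk.
rewrite (fun_code_is_fun localR freeU wo (fun w => std_pt_isPt U woR smallR (label w)) v yw).
split=> [/eqv_sym/(eqv_lead localR freeU woR) h|e].
  apply: (lead_uniq localR freeU woR) vk.
  by apply: h; exact: std_pt_lead.
by subst k; apply: (lead_eqv2 freeU woR vk); exact: std_pt_lead.
Qed.

(** Testing [isQ] on the map that multiplies every basis element by [r] yields a point with lead [w]
    labelled [k]. Both sides of the equation given by [isQ] reduce to the component at [w], between
    the leading unit of [y] and the value of [p] there; cancelling these two units leaves
    [val (r u0) = label w]. *)
Let label_of_Q (r : lhom U U) (x : lhom U (rN (std U ltR smallR))) k :
  is_lead u0 val x k -> isQ (F := std_frame) r x -> val (r u0) = k.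
Proof.
move=> xk q; have [||v|y [p [yp yx ty]]] := q (mapc r : lhom N N).
- exact: (triangular_rhom wo (mapc_tri r)).
- exists (cp_out P (fun i => lhom_comp (cp_in P i) r)); split=> /=.
  + apply: (cp_ext (f := lhom_comp (cp_out P (fun i => lhom_comp (cp_in P i) r)) b)
      (g := lhom_comp b (mapc r))) => a u /=.
    by rewrite /b /mapc !cp_outE /= ?cp_outE.
  + apply: (cp_ext (f := lhom_comp (cp_out P (fun i => lhom_comp (cp_in P i) r)) s)
      (g := lhom_comp s (cp_out P (fun i => lhom_comp (cp_in P i) r)))) => a u /=.
    by rewrite /s !cp_outE /= ?cp_outE.
  + apply: (cp_ext (f := lhom_comp (mapc r) l)
      (g := lhom_comp l (cp_out P (fun i => lhom_comp (cp_in P i) r)))) => a u /=.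
    by rewrite /l /mapc !cp_outE /= ?cp_outE.
- apply: (cp_ext (f := lhom_comp eps (mapc r)) (g := lhom_comp r eps)) => a u /=.
  by rewrite /eps /mapc !cp_outE /= ?cp_outE.
have [w yw] := isPt_lead localR freeU wo yp.
have wk := (is_fun_label yw xk).1 yx; rewrite -wk.
have [y0 invy] := yw.
have [t [ty1 ty2]] := invy.
have [py cy] := yp.
pose ps := val (p (cp_in N w u0)).
(* Above [w] the functional [p] vanishes: [y p] is triangular, and its entry at [w] is a value of
   [p] times the leading unit of [y]. *)
have pE (m : elements N) : (forall c, lt c w -> cp_co c m = 0) ->
    p m = (std_cv val w m * ps) *: u0.
  move=> m0.
  have [d dE] : exists d : lhom N U, forall m, d m = p m - p (cp_in N w (cp_co w m)).
    by apply: linear_exists => c v z /=; rewrite !linearD !linearZ /= addrACA scalerDr.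
  have : d m = 0.
    apply: cp_vanish => z; rewrite dE; have [zw|->|wz] := lt_tri z w.
    - by rewrite m0 // (lhom0 (cp_in N z)) (lhom0 (cp_co w)) (lhom0 (cp_in N w)) subrr.
    - by rewrite cp_co_in subrr.
    - rewrite [cp_co w _]cp_co_neq; last by move=> e; rewrite e in wz; exact: lt_irr wz.
      rewrite (lhom0 (cp_in N w)) (lhom0 p) subr0.
      rewrite -[p _](valE freeU).
      suff -> : val (p (cp_in N z (cp_co z m))) = 0 by rewrite scale0r.
      have := rhom_triangular wo (cy (lhom_id U)) (cp_co z m) wz => /=.
      rewrite (homE freeU y) lhomZ (std_coE freeU w) scalerA => /(congr1 val).
      rewrite (valK freeU) (val0 freeU) => /(congr1 (fun a => a * t)).
      by rewrite mul0r -mulrA ty2 mulr1.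
  rewrite dE => /eqP; rewrite subr_eq0 => /eqP ->.
  by rewrite (std_coE freeU) !lhomZ -scalerA -/ps (valE freeU).
have yps : std_cv val w (y u0) * ps = 1.
  have := pE _ y0; rewrite py => /(congr1 val); rewrite (valK freeU) => <-.
  by rewrite -[u0]scale1r (valK freeU).
have [_ [q' [_ psq]]] : invertible (std_cv val w (y u0)) /\ invertible ps.
  by apply: (invertibleM localR); rewrite yps; exists 1; rewrite mulr1.
have coT z f m : cp_co z (mapc f m) = f (cp_co z m).
  apply: (cp_ext (f := lhom_comp (cp_co z) (mapc f)) (g := lhom_comp f (cp_co z))) => c v /=.
  rewrite /mapc cp_outE /=; have [->|cz] := pselect (c = z); first by rewrite !cp_co_in.
  by rewrite !cp_co_neq // lhom0.
have coB z m : cp_co z (B m) = hom_of freeU (label z *: u0) (cp_co z m).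
  apply: (cp_ext (f := lhom_comp (cp_co z) B)
    (g := lhom_comp (hom_of freeU (label z *: u0)) (cp_co z))) => c v /=.
  rewrite /B cp_outE /=; have [->|cz] := pselect (c = z); first by rewrite !cp_co_in.
  by rewrite !cp_co_neq // lhom0.
have := ty u0; rewrite /= !pE => [|c cw|c cw]; last first.
- by rewrite coT y0 // lhom0.
- by rewrite coB y0 // lhom0.
rewrite /std_cv coT coB (std_coE freeU) !lhomZ hom_of1 !(valZ freeU).
move=> /(congr1 val); rewrite !(valK freeU) => /(congr1 (fun a => t * (a * q'))).
have val1 : val u0 = 1 by rewrite -[u0]scale1r (valK freeU).
by rewrite -!mulrA psq !mulr1 !(mulrA t) ty1 !mul1r val1 mulr1.
Qed.

(** The map [T] commutes with every [L n]. At a point [d] labelled [k] and closed under a function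
    bounding the supports of images under [T], the ladders force [T] to send the basis element to a
    multiple of itself; the augmentation shows that the multiplier is [r], as is the entry of [B]
    there. *)
Let Q_of_label (r : lhom U U) (x : lhom U (rN (std U ltR smallR))) k :
  is_lead u0 val x k -> val (r u0) = k -> isQ (F := std_frame) r x.
Proof.
move=> xk rk T hT [T' [/= T1 T2 T3]] /= Te.
have tT := rhom_triangular wo hT.
have rowT n m : T' (row n m) = row n (T m).
  have row0 v : row 0 v = b v by [].
  have rowS j v : row j.+1 v = s (row j v).
    apply: (cp_ext (f := row j.+1) (g := lhom_comp s (row j))) => a u /=.
    by rewrite /row /s !cp_outE.
  elim: n m => [|n IH] m; first by rewrite !row0 T1.
  by rewrite !rowS T2 IH.
have TL n m : T (L n m) = L n (T m).
  have Lrow v : L n v = l (row n v).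
    apply: (cp_ext (f := L n) (g := lhom_comp l (row n))) => a u /=.
    by rewrite /L /row /l !cp_outE.
  by rewrite !Lrow T3 rowT.
(* The resulting [f c] bounds the support of the image of the basis element at [c], so closure of
   [d] under [f] keeps the images of smaller basis elements below [d]. *)
have bnd c : exists d, forall z, cp_co z (T (cp_in N c u0)) <> 0 -> z = d \/ lt z d.
  have [t [_ ts]] := cp_decomp (T (cp_in N c u0)).
  suff [d dP] : exists d, forall z, (z : {classic W}) \in t -> z = d \/ lt z d.
    by exists d => z /ts/dP.
  elim: t {ts} => [|a t [d dP]]; first by exists c.
  have [ad|ad|da] := lt_tri a d.
  - by exists d => z; rewrite inE => /orP[/eqP ->|/dP //]; right.
  - by exists d => z; rewrite inE => /orP[/eqP ->|/dP //]; left.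
  - exists a => z; rewrite inE => /orP[/eqP ->|/dP[->|zd]]; [by left|by right|].
    by right; exact: lt_tr zd da.
have [f fP] := boolp.choice bnd.
have [d [dk dlad dcl]] := closed f k.
pose v := T (cp_in N d u0).
(* Let [z1] be the top of the support of [v], above [d]. For some [n] its rung lies above [d] and
   above the rest of the support, so the component of [v] at [z1] survives in [L n v]. But [L n v]
   is the image of the basis element at [ladder n d], which is supported below [d]. *)
have vup z : lt d z -> cp_co z v = 0.
  move=> dz; apply: contrapT => vz.
  have [t [_ ts]] := cp_decomp v.
  have [z1 [vz1 dz1 zmax]] : exists z, [/\ cp_co z v <> 0, lt d z &
      forall y, cp_co y v <> 0 -> y = z \/ lt y z].
    have : forall t : seq {classic W}, exists z, [/\ cp_co z v <> 0, lt d z &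
        forall y : W, (y : {classic W}) \in t -> cp_co y v <> 0 -> y = z \/ lt y z].
      elim=> [|a t' [z' [vz' dz' h]]]; first by exists z.
      have [va|va] := pselect (cp_co (a : W) v = 0).
        exists z'; split=> // y; rewrite inE => /orP[/eqP ->|]; [by move=> /(_ va)|exact: h].
      have [az|az|za] := lt_tri a z'.
      - by exists z'; split=> // y; rewrite inE => /orP[/eqP -> _|/h //]; right.
      - by exists z'; split=> // y; rewrite inE => /orP[/eqP -> _|/h //]; left.
      - exists a; split=> //; first exact: lt_tr dz' za.
        move=> y; rewrite inE => /orP[/eqP -> _|yt vy]; first by left.
        by right; have [->//|yz] := h y yt vy; exact: lt_tr yz za.
    move=> /(_ t)[z1 [h1 h2 h3]]; exists z1; split=> // y vy; exact: h3 (ts _ vy) vy.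
  have [n nP] : exists n, lt d (ladder n z1) /\
      forall y, y <> z1 -> cp_co y v <> 0 -> lt y (ladder n z1).
    have [n0 n0P] := ladder_cof dz1.
    suff [n1 n1P] : exists n1, forall n, (n1 <= n)%N -> forall y : W,
        (y : {classic W}) \in t -> y <> z1 -> cp_co y v <> 0 -> lt y (ladder n z1).
      exists (maxn n0 n1); split; first by apply: n0P; exact: leq_maxl.
      by move=> y yz vy; apply: n1P => //; [exact: leq_maxr|exact: ts].
    elim: (t) => [|a t' [n1 n1P]]; first by exists 0%N.
    have [[az va]|no] := pselect (a <> z1 /\ cp_co (a : W) v <> 0).
      have az1 : lt a z1 by case: (zmax a va).
      have [n2 n2P] := ladder_cof az1; exists (maxn n1 n2) => n; rewrite geq_max => /andP[h1 h2] y.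
      by rewrite inE => /orP[/eqP -> _ _|yt]; [exact: n2P|exact: n1P].
    exists n1 => n h1 y; rewrite inE => /orP[/eqP -> az va|yt]; last exact: n1P.
    by case: no.
  have [dn nz] := nP.
  have : cp_co (ladder n z1) (T (cp_in N (ladder n d) u0)) <> 0.
    have -> : cp_in N (ladder n d) u0 = L n (cp_in N d u0) by rewrite /L cp_outE.
    rewrite TL -/v co_L // => y yz vy e.
    have := nz y yz vy; rewrite -e; case: (ladder_le n y) => [->|h1 h2]; first exact: lt_irr.
    exact: lt_irr (lt_tr h1 h2).
  move=> /fP h; have fd := dcl _ (dlad n).
  have : lt (ladder n z1) d by case: h => [->//|h]; exact: lt_tr h fd.
  by move=> /(lt_tr dn)/lt_irr.
have vd z : z <> d -> cp_co z v = 0.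
  by move=> zd; have [/(tT _ _ u0)//|//|/vup//] := lt_tri z d.
exists (std_pt U lt sW d), (cp_co d); split; first exact: std_pt_isPt.
  by apply/(is_fun_label (std_pt_lead freeU wo sW d) xk).
apply: (hom_ext freeU (f := lhom_comp (cp_co d) (lhom_comp T (cp_in N d)))
  (g := lhom_comp (cp_co d) (lhom_comp B (cp_in N d)))) => /=.
rewrite {1}/B cp_outE cp_co_in /= hom_of1 dk.
(* As [v] is concentrated at [d], the augmentation reads off its coefficient, and [T] lies over
   [r]. *)
have <- : eps v = cp_co d v.
  have [g gE] : exists g : lhom N U, forall m, g m = eps m - cp_co d m.
    by apply: linear_exists => c w z /=; rewrite !linearD !linearZ /= addrACA scalerDr.
  apply/eqP; rewrite -subr_eq0 -gE; apply/eqP/cp_vanish => z; rewrite gE.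
  have [->|zd] := pselect (z = d); first by rewrite /eps cp_outE cp_co_in /= subrr.
  by rewrite vd // (lhom0 (cp_in N z)) (lhom0 eps) lhom0 subrr.
by rewrite Te /eps cp_outE /= -rk (valE freeU).
Qed.

Lemma std_frame_good : isGood std_frame.
Proof.
split=> [r|r r' x p xp].
  exists (std_pt U ltR smallR (val (r u0))), (cp_co (val (r u0))).
  split; first exact: (std_pt_isPt U woR).
  by apply: Q_of_label erefl; exact: std_pt_lead.
have [k xk] := isPt_lead localR freeU woR xp.
move=> /(label_of_Q xk) rk /(label_of_Q xk) rk'; apply/linear_ext/(hom_ext freeU).
by rewrite -[LHS](valE freeU) rk -rk' (valE freeU).
Qed.

End Construction.

Lemma frame_exists : exists F, isGood F.
Proof.
have [W [lt [lad [label [_ [wo sW ll lc cl]]]]]] := ladder_exists (0 : R) smallR.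
have [ltR woR] := wo_exists R.
by exists (std_frame lt sW lad label ltR); exact: std_frame_good.
Qed.

End Frames.

(** * Cardinals *)

HB.instance Definition _ := isPointed.Build V (\pi_V leaf).

(* Exposes the implication denoted by the goal. *)
Ltac imp := let H := fresh in intro H; revert H; fold denote.

Section Cardinals.
Variables (R : pzRingType) (localR : local_ring R).
Variables (U : lmodule R) (u0 : elements U) (val : elements U -> R).
Hypothesis freeU : free_on u0 val.

Local Notation HomR := (@Hom (Mod R)).
Local Notation ruler := (ruler HomR).
Local Notation rel := (rel HomR).
Local Notation spt := (spt HomR U).
Local Notation code := (code HomR).
Local Notation card := (ruler * rel)%type.

Lemma ExRulerP k : denote (C := Mod R) (@fExRuler _ HomR k) <-> exists Z, denote (k Z).
Proof.
split=> [[N [P [io [z h]]]]|[[N P io z] h]]; first by exists (Ruler io z).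
by exists N, P, io, z.
Qed.

Lemma AllRulerP k : denote (C := Mod R) (@fAllRuler _ HomR k) <-> forall Z, denote (k Z).
Proof. by split=> [h [N P io z]|h N P io z]; apply: h. Qed.

Lemma ExCodesP (N : lmodule R) m k : denote (C := Mod R) (@fExCodes _ HomR N m k) <->
  exists2 cs, size cs = m & denote (k cs).
Proof.
elim: m k => [|m IH] k.
  by split=> [h|[[|//] _ h //]]; exists [::].
split=> [/(ExRulerP (fun Z => FEx N (rN Z) (fun g => fExCodes m (fun cs =>
    k (@Code _ HomR N Z g :: cs)))))[Z [g /IH[cs <- h]]]|[[|[Z g] cs]//= [scs] h]].
  by exists (Code g :: cs).
by exists (rN Z), (rM Z), (rio Z), (rz Z); case: Z g h => ? ? ? ? g h; exists g; apply/IH; exists cs.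
Qed.

Lemma AllCodesP (N : lmodule R) m k : denote (C := Mod R) (@fAllCodes _ HomR N m k) <->
  forall cs, size cs = m -> denote (k cs).
Proof.
elim: m k => [|m IH] k.
  by split=> [h [|//] _ //|]; apply.
split=> [/(AllRulerP (fun Z => FAll N (rN Z) (fun g => fAllCodes m (fun cs =>
    k (@Code _ HomR N Z g :: cs))))) h [|[Z g] cs]//= [scs]|h].
  by move/IH: (h Z g); apply.
by move=> ? ? ? ? g; apply/IH => cs scs; apply: h; rewrite /= scs.
Qed.

Lemma ExRelP m k : denote (C := Mod R) (@fExRel _ HomR m k) <->
  exists2 r, size (rcs r) = m & denote (k r).
Proof.
split=> [/ExRulerP[P /ExCodesP[cs scs h]]|[[P cs] scs h]]; first by exists (Rel cs).
by apply/ExRulerP; exists P; apply/ExCodesP; exists cs.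
Qed.

Lemma AllRelP m k : denote (C := Mod R) (@fAllRel _ HomR m k) <->
  forall r, size (rcs r) = m -> denote (k r).
Proof.
split=> [/AllRulerP h [P cs] scs|h].
  by move/AllCodesP: (h P); apply.
by apply/AllRulerP => P; apply/AllCodesP => cs scs; apply: h.
Qed.

Lemma funs_eqv (P : ruler) (cs : seq (code (rN P))) (y : lhom U (rN P)) args args' :
  eqvs args args' -> funs cs y args -> funs cs y args'.
Proof.
elim: cs args args' => [|c cs IH] [|a args] [|b args'] //= [ab h] [h1 h2].
split; last exact: IH h h2.
by case: ab h1 => Z x x' p p' xx'; exact: is_fun_eqv.
Qed.

Lemma app_eqv r args args' : @eqvs R U args args' -> app r args -> app r args'.
Proof. by move=> h [y [q [yq f]]]; exists y, q; split=> //; exact: funs_eqv h f. Qed.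

Definition card_rel (c : card) (kappa : V) (th : spt -> V) : Prop :=
  [/\ forall p, isPtIn c.1 p -> members kappa (th p),
      forall v, members kappa v -> exists2 p, isPtIn c.1 p & th p = v,
      forall p q, isPtIn c.1 p -> isPtIn c.1 q -> (th p = th q <-> speqv p q) &
      forall p q, isPtIn c.1 p -> isPtIn c.1 q ->
        (app c.2 [:: q; p] <-> members (th p) (th q))].

Lemma rel1_exists (Z : ruler) (P : spt -> Prop) :
  (forall p q, isPtIn Z p -> isPtIn Z q -> speqv p q -> P p -> P q) ->
  exists2 r : rel, size (rcs r) = 1%N & forall p, isPtIn Z p -> (app r [:: p] <-> P p).
Proof.
move=> Pinv; have [|r sr rP] := rel_exists localR freeU (Zs := [:: Z])
    (P := fun args => if args is [:: a] then P a else False).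
  by move=> [|a [|? ?]] [|b [|? ?]] //= [aZ ?] [bZ ?] [ab _] //; exact: (Pinv a b aZ bZ ab).
by exists r => // p pZ; rewrite rP.
Qed.

Lemma rel2_exists (Z Z' : ruler) (P : spt -> spt -> Prop) :
  (forall p q p' q', isPtIn Z p -> isPtIn Z q -> isPtIn Z' p' -> isPtIn Z' q' ->
     speqv p q -> speqv p' q' -> P p p' -> P q q') ->
  exists2 r : rel, size (rcs r) = 2%N &
    forall p q, isPtIn Z p -> isPtIn Z' q -> (app r [:: p; q] <-> P p q).
Proof.
move=> Pinv; have [|r sr rP] := rel_exists localR freeU (Zs := [:: Z; Z'])
    (P := fun args => if args is [:: a; b] then P a b else False).
  move=> [|a [|b [|? ?]]] [|a' [|b' [|? ?]]] /=; try tauto.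
  move=> [aZ [bZ _]] [a'Z [b'Z _]] [ab [a'b' _]]; exact: (Pinv a a' b b' aZ a'Z bZ b'Z ab a'b').
by exists r => // p q pZ qZ; rewrite rP.
Qed.

(** The well-order of the ruler is arbitrary and unrelated to membership, which is carried by the
    relation alone. *)
Lemma card_exists (kappa : V) : exists c th,
  card_rel c kappa th /\ size (rcs c.2) = 2%N.
Proof.
pose W := {v | members kappa v}.
have sW : small W.
  apply: (@small_inj _ (members kappa) (fun w : W => SigSub (mem_set (svalP w))) _
    (small_members kappa)).
  by move=> [v pv] [w pw] [vw]; exact: eq_exist.
have [lt wo] := wo_exists W; pose Z := std U lt sW.
have ex (p : spt) : exists v, isPtIn Z p -> exists w : W, sval w = v /\
    forall x q, p = @Spt _ HomR U Z x q -> is_lead u0 val x w.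
  have [[e xp]|] := pselect (isPtIn Z p); last by exists kappa.
  case: p e xp => Z' x q /= e xp; subst Z'.
  have [w xw] := isPt_lead localR freeU wo xp.
  by exists (sval w) => _; exists w; split=> // x' q' /Spt_inj <-.
have [th thP] := boolp.choice ex.
have th_std w : th (@Spt _ HomR U Z (std_pt U lt sW w) (cp_co w)) = sval w.
  have pt : isPtIn Z (@Spt _ HomR U Z (std_pt U lt sW w) (cp_co w)).
    by split=> //; exact: std_pt_isPt.
  have [w' [<- /(_ _ _ erefl) w'P]] := thP _ pt; congr sval.
  by apply: (lead_uniq localR freeU wo) w'P _; exact: std_pt_lead.
have thE p q : isPtIn Z p -> isPtIn Z q -> (th p = th q <-> speqv p q).
  move=> pZ qZ; have [w [<- wP]] := thP p pZ; have [v [<- vP]] := thP q qZ.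
  case: p pZ wP => Z1 x p [/= e1 _]; subst Z1 => wP.
  case: q qZ vP => Z2 y q [/= e2 _]; subst Z2 => vP.
  have wx := wP _ _ erefl; have vy := vP _ _ erefl.
  split=> [wv|/speqvE xy].
    have e : w = v by apply: eq_sig_hprop wv => ? ? ?; exact: Prop_irrelevance.
    by subst v; constructor; exact: (lead_eqv2 freeU wo wx vy).
  by congr sval; apply: (lead_uniq localR freeU wo) vy; exact: (eqv_lead localR freeU wo xy).
have [|r sr rP] := @rel2_exists Z Z (fun p q => members (th q) (th p)).
  by move=> p q p' q' pZ qZ p'Z q'Z /(thE p q pZ qZ) -> /(thE p' q' p'Z q'Z) ->.
exists (Z, r), th; split=> //; split=> /=.
- by move=> p /thP[w [<- _]]; exact: (svalP w).
- move=> v vk; pose w : W := exist _ v vk.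
  exists (@Spt _ HomR U Z (std_pt U lt sW w) (cp_co w)); last exact: th_std.
  by split=> //; exact: std_pt_isPt.
- exact: thE.
- by move=> p q pZ qZ; rewrite rP.
Qed.

Section CardRel.
Variables (c : card) (kappa : V) (th : spt -> V).
Hypothesis ck : card_rel c kappa th.

Let thk p : isPtIn c.1 p -> members kappa (th p). Proof. by case: ck => h _ _ _; exact: h. Qed.
Let thS v : members kappa v -> exists2 p, isPtIn c.1 p & th p = v.
Proof. by case: ck => _ h _ _; exact: h. Qed.
Let thE p q : isPtIn c.1 p -> isPtIn c.1 q -> (th p = th q <-> speqv p q).
Proof. by case: ck => _ _ h _; exact: h. Qed.
Let thM p q : isPtIn c.1 p -> isPtIn c.1 q ->
  (denote (C := Mod R) (fApp c.2 [:: q; p]) <-> members (th p) (th q)).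
Proof. by case: ck => _ _ _ h pZ qZ; rewrite -h //; exact: AppP. Qed.

Let leE (x y : lhom U (rN c.1)) p q : isPt x p -> isPt y q ->
  (le x y /\ le y x) <-> th (@Spt _ HomR U c.1 x p) = th (@Spt _ HomR U c.1 y q).
Proof.
move=> xp yq; rewrite thE //; split=> [h|/speqvE //]; by constructor.
Qed.

Lemma Cn_card : kappa \in Cn -> denote (C := Mod R) (fCard U c).
Proof.
move=> /set_mem[[trk trk'] ink]; split; split.
- apply/AllRelP => S sS; imp => /ExPtP[p pZ Sp].
  have [v [q [qZ [Sq qv]]] vmin] := wf_min mem_wf (ex_intro
    (fun v => exists q, isPtIn c.1 q /\ denote (C := Mod R) (fApp S [:: q]) /\ th q = v) (th p)
    (ex_intro _ p (conj pZ (conj Sp erefl)))).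
  apply/ExPtP; exists q => //; split=> //; apply/AllPtP => q' q'Z; imp => /(thM qZ q'Z) q'q Sq'.
  by apply: (vmin (th q')); rewrite -?qv //; exists q'.
- move=> x p; imp => /PtP xp y q; imp => /PtP yq; imp => /AllPtP h.
  have pZ : isPtIn c.1 (@Spt _ HomR U c.1 x p) by [].
  have qZ : isPtIn c.1 (@Spt _ HomR U c.1 y q) by [].
  have [] : le x y /\ le y x; last by split; apply/LeP.
  apply/(leE xp yq)/members_inj/seteqP; split=> v vp.
    have [r rZ rv] := thS (trk _ (mem_set (thk pZ)) _ vp).
    by have [h1 _] := h r rZ; rewrite -rv in vp *; apply/(thM qZ rZ)/h1/(thM pZ rZ).
  have [r rZ rv] := thS (trk _ (mem_set (thk qZ)) _ vp).
  by have [_ h1] := h r rZ; rewrite -rv in vp *; apply/(thM pZ rZ)/h1/(thM qZ rZ).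
- apply/AllPtP => r rZ; apply/AllPtP => q qZ; apply/AllPtP => p pZ.
  imp => /(thM qZ rZ) rq; imp => /(thM pZ qZ) qp; apply/(thM pZ rZ).
  exact: (trk' _ (mem_set (thk pZ)) _ (mem_set qp)).
- apply/AllPtP => p pZ; apply/AllRelP => B sB; imp => -[[tot sur] fi].
  have {}tot := (@AllPtP _ _ c.1 (fun q => FImp (fApp c.2 [:: q; p])
    (fExPt c.1 (fun q' => fApp B [:: q; q'])))).1 tot.
  have {}sur := (@AllPtP _ _ c.1 (fun q' => fExPt c.1 (fun q =>
    FAnd (fApp c.2 [:: q; p]) (fApp B [:: q; q'])))).1 sur.
  have {}fi x q y r : isPt x q -> isPt y r ->
      (forall t, isPtIn c.1 t -> denote (C := Mod R) (fApp c.2 [:: t; p]) ->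
        denote (C := Mod R) (fApp B [:: t; @Spt _ HomR U c.1 x q]) ->
        denote (C := Mod R) (fApp B [:: t; @Spt _ HomR U c.1 y r]) -> le x y /\ le y x) /\
      (forall t, isPtIn c.1 t ->
        denote (C := Mod R) (fApp c.2 [:: @Spt _ HomR U c.1 x q; p]) ->
        denote (C := Mod R) (fApp c.2 [:: @Spt _ HomR U c.1 y r; p]) ->
        denote (C := Mod R) (fApp B [:: @Spt _ HomR U c.1 x q; t]) ->
        denote (C := Mod R) (fApp B [:: @Spt _ HomR U c.1 y r; t]) -> le x y /\ le y x).
    move=> /PtP xq /PtP yr; have [h1 h2] := fi x q xq y r yr.
    split=> -[Z1 t pt] [/= e /PtP tP]; subst Z1 => a1 a2 a3.
      by have [/LeP ? /LeP ?] := h1 t pt tP a1 a2 a3.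
    by move=> a4; have [/LeP ? /LeP ?] := h2 t pt tP a1 a2 a3 a4.
  apply: (ink (th p) (mem_set (thk pZ))); apply/card_set_bijP.
  (* The relation [B] on points induces a function on their values, since it respects
     equivalence. *)
  have ex v : exists w, members (th p) v -> exists q q', [/\ isPtIn c.1 q, isPtIn c.1 q',
      th q = v, th q' = w & denote (C := Mod R) (fApp B [:: q; q'])].
    have [vp|] := pselect (members (th p) v); last by exists v.
    have [q qZ qv] := thS (trk _ (mem_set (thk pZ)) _ vp).
    have /ExPtP[q' q'Z qq'] : denote (C := Mod R) (fExPt c.1 (fun q' => fApp B [:: q; q'])).
      by apply: tot => //; apply/(thM pZ qZ); rewrite qv.
    by exists (th q') => _; exists q, q'.
  have [f fP] := boolp.choice ex.
  have fE v q q' : isPtIn c.1 q -> isPtIn c.1 q' -> th q = v -> members (th p) v ->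
      denote (C := Mod R) (fApp B [:: q; q']) -> f v = th q'.
    move=> qZ q'Z qv vp qq'; have [r [r' [rZ r'Z rv r'f rr']]] := fP v vp.
    case: r' r'Z rr' r'f => Z1 x1 p1 [/= e1 xp1]; subst Z1 => rr' <-.
    case: q' q'Z qq' => Z2 x2 p2 [/= e2 xp2]; subst Z2 => qq'.
    have [h _] := fi _ _ _ _ xp1 xp2.
    have [||h1 h2] := h q qZ _ _ qq'.
    + by apply/(thM pZ qZ); rewrite qv.
    + apply/AppP/(app_eqv _ ((AppP _ _).1 rr')); split; first by apply/(thE rZ qZ); rewrite rv qv.
      by split=> //; exact: speqv_refl.
    + by apply/(leE xp1 xp2).
  exists f; split.
  + by move=> v /fP[q [q' [_ q'Z _ <- _]]]; exact: thk.
  + move=> v w /set_mem vp /set_mem wp e.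
    have [q [q' [qZ q'Z qv q'f qq']]] := fP v vp.
    have [r [r' [rZ r'Z rw r'f rr']]] := fP w wp.
    case: q qZ qv qq' => Z1 x1 p1 [/= e1 xp1]; subst Z1 => qv qq'.
    case: r rZ rw rr' => Z2 x2 p2 [/= e2 xp2]; subst Z2 => rw rr'.
    have [_ h] := fi _ _ _ _ xp1 xp2.
    rewrite -qv -rw; apply/(leE xp1 xp2).
    have [|||h1 h2] := h q' q'Z _ _ qq' _; last by [].
    + by apply/thM => //; rewrite qv.
    + by apply/thM => //; rewrite rw.
    + apply/AppP/(app_eqv _ ((AppP _ _).1 rr')); split; first exact: speqv_refl.
      by split=> //; apply/(thE r'Z q'Z); rewrite r'f q'f e.
  + move=> w /thS[q' q'Z q'w]; have /ExPtP[q qZ [/(thM pZ qZ) qp qq']] := sur q' q'Z.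
    by exists (th q) => //; rewrite -q'w; exact: fE qq'.
Qed.

(** [fTrans] yields that every element of [kappa] is transitive. Transitivity of [kappa] itself is
    not a statement about its points, and comes from the collapse. *)
Lemma card_Cn : (forall v w, members kappa v -> members v w -> members kappa w) ->
  denote (C := Mod R) (fCard U c) -> kappa \in Cn.
Proof.
move=> trk [_ [tr ini]].
have {}tr (r q p : spt) : isPtIn c.1 r -> isPtIn c.1 q -> isPtIn c.1 p ->
    denote (C := Mod R) (fApp c.2 [:: r; q]) -> denote (C := Mod R) (fApp c.2 [:: q; p]) ->
    denote (C := Mod R) (fApp c.2 [:: r; p]).
  case: r => Z1 x1 p1 [/= e1 /PtP h1]; case: q => Z2 x2 p2 [/= e2 /PtP h2].
  case: p => Z3 x3 p3 [/= e3 /PtP h3]; subst Z1 Z2 Z3.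
  exact: (tr x1 p1 h1 x2 p2 h2 x3 p3 h3).
have {}ini (p : spt) : isPtIn c.1 p -> forall B, size (rcs B) = 2%N ->
    ~ denote (C := Mod R) (fBij c p B).
  case: p => Z1 x1 p1 [/= e1 /PtP h1]; subst Z1.
  exact: (AllRelP 2 (fun B => FNot (fBij c (@Spt _ HomR U c.1 x1 p1) B))).1 (ini x1 p1 h1).
apply/mem_set; split; first split.
- by move=> v /set_mem vk w vw; exact: trk vk vw.
- move=> v /set_mem vk w /set_mem wv u uw.
  have wk := trk _ _ vk wv; have uk := trk _ _ wk uw.
  have [p pZ pv] := thS vk; have [q qZ qw] := thS wk; have [r rZ ru] := thS uk.
  have h := tr r q p rZ qZ pZ; rewrite -pv -ru; apply/(thM pZ rZ)/h.
    by apply/(thM qZ rZ); rewrite qw ru.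
  by apply/(thM pZ qZ); rewrite qw pv.
- move=> v /set_mem vk /card_set_bijP[f [fv fI fS]].
  have [p pZ pv] := thS vk.
  have [|B sB BP] := @rel2_exists c.1 c.1 (fun a b => f (th a) = th b).
    by move=> a a' b b' aZ a'Z bZ b'Z /(thE aZ a'Z) -> /(thE bZ b'Z) ->.
  have BP' a b : isPtIn c.1 a -> isPtIn c.1 b ->
      denote (C := Mod R) (fApp B [:: a; b]) <-> f (th a) = th b.
    by move=> aZ bZ; rewrite -BP //; exact: AppP.
  apply: (ini p pZ B sB); split; first split.
  + apply/AllPtP => q qZ; imp => /(thM pZ qZ); rewrite pv => /fv /thS[q' q'Z q'f].
    by apply/ExPtP; exists q' => //; apply/BP'.
  + apply/AllPtP => q' q'Z; have [w wv wq'] := fS _ (thk q'Z).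
    have [q qZ qw] := thS (trk _ _ vk wv).
    apply/ExPtP; exists q => //; split; first by apply/(thM pZ qZ); rewrite pv qw.
    by apply/BP' => //; rewrite qw.
  + move=> x q; imp => /PtP xq y r; imp => /PtP yr; split; apply/AllPtP => t tZ.
      imp => _; imp => /BP' h1; imp => /BP' h2; have [|h3 h4] := (leE xq yr).2; last by split; apply/LeP.
      by rewrite -h1 // -h2.
    have qZ : isPtIn c.1 (@Spt _ HomR U c.1 x q) by [].
    have rZ : isPtIn c.1 (@Spt _ HomR U c.1 y r) by [].
    imp => /(thM pZ qZ) hq; imp => /(thM pZ rZ) hr; imp => /BP' h1; imp => /BP' h2.
    have [|h3 h4] := (leE xq yr).2; last by split; apply/LeP.
    by apply: fI; rewrite -?pv ?mem_set // h1 // h2.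
Qed.

End CardRel.

End Cardinals.

(** * Mostowski collapse and equality of ordinals *)

Section Collapse.
Variables (R : pzRingType) (localR : local_ring R).
Variables (U : lmodule R) (u0 : elements U) (val : elements U -> R).
Hypothesis freeU : free_on u0 val.

Local Notation HomR := (@Hom (Mod R)).
Local Notation ruler := (ruler HomR).
Local Notation rel := (rel HomR).
Local Notation spt := (spt HomR U).
Local Notation card := (ruler * rel)%type.

Lemma speqv_trans (a b c : spt) : speqv a b -> speqv b c -> speqv a c.
Proof.
move=> [Z x y p q xy]; move e : (Spt y q) => d dc.
case: dc e => Z' x' z p' r h e.
have eZ : Z = Z' := congr1 (fun a : spt => sZ a) e.
by subst Z'; constructor; apply: eqv_trans xy _; rewrite (Spt_inj e).
Qed.

Definition transitive_V (v : V) : Prop :=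
  forall x y, members v x -> members x y -> members v y.

Lemma Cn_transitive v : v \in Cn -> transitive_V v.
Proof. by move=> /set_mem[[tr _] _] x y /mem_set vx; exact: tr. Qed.

(** The formula asserts well-foundedness for coded relations only, but every predicate invariant
    under equivalence is coded. So membership between points is truly well-founded, recursion
    defines [th], and extensionality makes it injective up to equivalence. *)
Lemma collapse (c : card) : denote (C := Mod R) (fWF U c) ->
    denote (C := Mod R) (fExt U c) ->
  exists kappa th, @card_rel R U c kappa th /\ transitive_V kappa.
Proof.
move=> WF EX.
pose lt (q p : spt) := [/\ isPtIn c.1 q, isPtIn c.1 p & app c.2 [:: q; p]].
have {}WF (S : rel) : size (rcs S) = 1%N -> (exists2 p : spt, isPtIn c.1 p & app S [:: p]) ->
    exists2 p : spt, isPtIn c.1 p & app S [:: p] /\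
      forall q, isPtIn c.1 q -> app c.2 [:: q; p] -> ~ app S [:: q].
  move=> sS [p pZ Sp].
  have h : denote (C := Mod R) (fExPt c.1 (fun p : spt => fApp S [:: p])) ->
      denote (C := Mod R) (fExPt c.1 (fun p : spt => FAnd (fApp S [:: p])
        (fAllPt c.1 (fun q => FImp (fApp c.2 [:: q; p]) (FNot (fApp S [:: q])))))).
    exact: (AllRelP 1 (fun S => FImp (fExPt c.1 (fun p => fApp S [:: p]))
      (fExPt c.1 (fun p : spt => FAnd (fApp S [:: p]) (fAllPt c.1 (fun q =>
        FImp (fApp c.2 [:: q; p]) (FNot (fApp S [:: q])))))))).1 WF S sS.
  have /h/ExPtP[q qZ [/AppP Sq h1]] : denote (C := Mod R) (fExPt c.1 (fun p : spt => fApp S [:: p])).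
    by apply/ExPtP; exists p => //; apply/AppP.
  exists q => //; split=> // r rZ /AppP rq /AppP Sr.
  by case: r rZ rq Sr => Z1 x1 p1 [/= e1 /PtP hr]; subst Z1; apply: h1.
have {}EX (p q : spt) : isPtIn c.1 p -> isPtIn c.1 q ->
    (forall r, isPtIn c.1 r -> (app c.2 [:: r; p] <-> app c.2 [:: r; q])) -> speqv p q.
  case: p => Z1 x1 p1 [/= e1 /PtP h1]; case: q => Z2 x2 p2 [/= e2 /PtP h2]; subst Z1 Z2 => h.
  have h' := EX x1 p1 h1 x2 p2 h2; constructor.
  have [|/LeP ? /LeP ?] := h'; last by split.
  move=> x p /PtP xp.
  by have [? ?] := h (@Spt _ HomR U c.1 x p) (conj erefl xp); split=> /AppP ?; apply/AppP; auto.
have wf : well_founded lt.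
  apply: min_wf => P [x Px].
  have [[p pZ Pp]|no] := pselect (exists2 p, isPtIn c.1 p & P p); last first.
    exists x => // y [_ xZ _] _; apply: no; by exists x.
  (* An arbitrary predicate is first closed under equivalence, which a coded relation cannot avoid;
     a least point of the closure is then moved back into [P]. *)
  have [|S sS SP] := rel1_exists localR freeU (Z := c.1)
      (P := fun p => exists p', [/\ isPtIn c.1 p', speqv p' p & P p']).
    move=> a b _ _ ab [p' [p'Z p'a Pp']]; exists p'; split=> //.
    exact: speqv_trans ab.
  have [|q qZ [/(SP q qZ)[p' [p'Z p'q Pp']] qmin]] := WF S sS.
    by exists p => //; apply/SP => //; exists p; split=> //; exact: speqv_refl.
  exists p' => // r [rZ _ rp'] Pr; apply: (qmin r rZ).
    by apply: app_eqv rp'; split; [exact: speqv_refl|split].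
  by apply/SP => //; exists r; split=> //; exact: speqv_refl.
have sPt : small {p : spt | isPtIn c.1 p}.
  apply: (@small_inj _ {args : seq spt | ptargs [:: c.1] args}
    (fun p => exist (ptargs [:: c.1]) [:: sval p] (conj (svalP p) Logic.I)) _
    (small_ptargs U [:: c.1])).
  by move=> [p pZ] [q qZ] [pq]; exact: eq_exist.
have slt p : small {q | lt q p}.
  have h (w : {q | lt q p}) : isPtIn c.1 (sval w) by case: w => q [].
  apply: (@small_inj _ _ (fun w => exist _ (sval w) (h w)) _ sPt).
  by move=> [q qZ] [r rZ] [qr]; exact: eq_exist.
pose F (p : spt) (h : forall q, lt q p -> V) : V :=
  projT1 (cid (small_set_of (fun w : {q | lt q p} => h (sval w) (proj2_sig w)) (slt p))).
pose th := Fix wf (fun _ => V) F.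
have thF p : th p = F p (fun q _ => th q).
  rewrite /th Fix_eq // => {}p h k hk; congr (F p _).
  by apply: functional_extensionality_dep => q; apply: funext => qp; apply: hk.
have thE p v : members (th p) v <-> exists2 q, lt q p & th q = v.
  rewrite thF /F; case: cid => x /= ->; split=> [[[q qp] _ <-]|[q qp <-]]; first by exists q.
  by exists (exist _ q qp).
have lt_eqv (p p' q q' : spt) : isPtIn c.1 p' -> isPtIn c.1 q' ->
    speqv p p' -> speqv q q' -> lt q p -> lt q' p'.
  move=> p'Z q'Z pp' qq' [qZ pZ h]; split=> //.
  by apply: app_eqv h; split=> //; split.
have th_inj p : forall q, isPtIn c.1 p -> isPtIn c.1 q -> th p = th q -> speqv p q.
  elim/(well_founded_ind wf): p => p IH q pZ qZ pq; apply: EX => // r rZ; split=> rh.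
    have rp : lt r p by split.
    have /thE[r' r'q r'r] : members (th q) (th r) by rewrite -pq; apply/thE; exists r.
    have [r'Z _ _] := r'q; have rr' := IH r rp r' rZ r'Z (esym r'r).
    by have [] := lt_eqv q q r' r qZ rZ (speqv_refl q) (speqv_sym rr') r'q.
  have rq : lt r q by split.
  have /thE[r' r'p r'r] : members (th p) (th r) by rewrite pq; apply/thE; exists r.
  have [r'Z _ _] := r'p; have r'r' := IH r' r'p r r'Z rZ r'r.
  by have [] := lt_eqv p p r' r pZ rZ (speqv_refl p) r'r' r'p.
have [kappa kE] := small_set_of (fun w : {p : spt | isPtIn c.1 p} => th (sval w)) sPt.
exists kappa, th; split; last first.
  move=> v w; rewrite kE => -[[p pZ] _ <-] /thE[q [qZ _ _] <-].
  by exists (exist _ q qZ).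
split.
- by move=> p pZ; rewrite kE; exists (exist _ p pZ).
- by move=> v; rewrite kE => -[[p pZ] _ <-]; exists p.
- move=> p q pZ qZ; split; first exact: th_inj.
  move=> pq; apply/members_inj/seteqP; split=> v /thE[r rh rv]; apply/thE; exists r => //.
    by have [rZ _ _] := rh; exact: (lt_eqv p q r r qZ rZ pq (speqv_refl r)).
  by have [rZ _ _] := rh; exact: (lt_eqv q p r r pZ rZ (speqv_sym pq) (speqv_refl r)).
- move=> p q pZ qZ; split=> [h|/thE[r rp rq]]; first by apply/thE; exists q.
  have [rZ _ _] := rp.
  by have [] := lt_eqv p p r q pZ qZ (speqv_refl p) (th_inj r q rZ qZ rq) rp.
Qed.

Lemma card_collapse (c : card) : denote (C := Mod R) (fCard U c) ->
  exists2 kappa, kappa \in Cn & exists th, @card_rel R U c kappa th.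
Proof.
move=> hc; have [[WF EX] _] := hc; have [kappa [th [ck tk]]] := collapse WF EX.
by exists kappa; [exact: (card_Cn localR freeU ck tk hc)|exists th].
Qed.

Section EqOrd.
Variables (c d : card) (kappa lambda : V) (th th' : spt -> V).
Hypotheses (ck : card_rel c kappa th) (dk : card_rel d lambda th').
Hypotheses (tk : transitive_V kappa) (tl : transitive_V lambda).

Lemma EqOrdP a b : isPtIn c.1 a -> isPtIn d.1 b ->
  denote (C := Mod R) (fEqOrd c d a b) <-> th a = th' b.
Proof.
have [c1 c2 c3 c4] := ck; have [d1 d2 d3 d4] := dk.
move=> aZ bZ; split=> [/ExRelP[S _ [/AppP Sab bis]]|ab]; last first.
  have [|S sS SP] := rel2_exists localR freeU (Z := c.1) (Z' := d.1)
      (P := fun p q => th p = th' q).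
    by move=> p q p' q' pZ qZ p'Z q'Z /(c3 p q pZ qZ) -> /(d3 p' q' p'Z q'Z) ->.
  apply/ExRelP; exists S => //; split; first by apply/AppP/SP.
  apply/AllPtP => p pZ; apply/AllPtP => q qZ; imp => /AppP/(SP p q pZ qZ) pq.
  split.
    apply/AllPtP => p' p'Z; imp => /AppP/(c4 p p' pZ p'Z) p'p; apply/ExPtP.
    have [q' q'Z q'p'] : exists2 q', isPtIn d.1 q' & th' q' = th p'.
      by apply/d2/(tl (d1 q qZ)); rewrite -pq.
    exists q' => //; split; apply/AppP; last by apply/SP.
    by apply/(d4 q q' qZ q'Z); rewrite q'p' -pq.
  apply/AllPtP => q' q'Z; imp => /AppP/(d4 q q' qZ q'Z) q'q; apply/ExPtP.
  have [p' p'Z p'q'] : exists2 p', isPtIn c.1 p' & th p' = th' q'.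
    by apply/c2/(tk (c1 p pZ)); rewrite pq.
  exists p' => //; split; apply/AppP; last by apply/SP.
  by apply/(c4 p p' pZ p'Z); rewrite p'q' pq.
have {}bis (p q : spt) : isPtIn c.1 p -> isPtIn d.1 q -> app S [:: p; q] ->
    (forall p', isPtIn c.1 p' -> app c.2 [:: p'; p] ->
       exists2 q', isPtIn d.1 q' & app d.2 [:: q'; q] /\ app S [:: p'; q']) /\
    (forall q', isPtIn d.1 q' -> app d.2 [:: q'; q] ->
       exists2 p', isPtIn c.1 p' & app c.2 [:: p'; p] /\ app S [:: p'; q']).
  case: p => Z1 x1 p1 [/= e1 /PtP h1]; case: q => Z2 x2 p2 [/= e2 /PtP h2]; subst Z1 Z2.
  move=> /AppP h; have [b1 b2] := bis x1 p1 h1 x2 p2 h2 h; split.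
    move=> [Z3 x3 p3] [/= e3 /PtP h3] /AppP h'; subst Z3.
    have [x [p [/PtP xp [/AppP hh /AppP hS]]]] := b1 x3 p3 h3 h'.
    by exists (@Spt _ HomR U d.1 x p).
  move=> [Z3 x3 p3] [/= e3 /PtP h3] /AppP h'; subst Z3.
  have [x [p [/PtP xp [/AppP hh /AppP hS]]]] := b2 x3 p3 h3 h'.
  by exists (@Spt _ HomR U c.1 x p).
(* Induction on membership. By transitivity of [kappa] and [lambda] the elements of [th a] and
   [th' b] are again values of points, to which the bisimulation applies. *)
move: {2}(th a) (erefl (th a)) => v; elim/(well_founded_ind mem_wf): v a b aZ bZ Sab => v IH a b aZ bZ Sab av.
have [b1 b2] := bis a b aZ bZ Sab.
apply/members_inj/seteqP; split=> w ww.
  have [p pZ pw] := c2 _ (tk (c1 a aZ) ww).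
  have [|q qZ [qb pq]] := b1 p pZ; first by apply/c4; rewrite ?pw.
  by rewrite -pw (IH (th p) _ p q) // -?av ?pw //; apply/d4.
have [q qZ qw] := d2 _ (tl (d1 b bZ) ww).
have [|p pZ [pa pq]] := b2 q qZ; first by apply/d4; rewrite ?qw.
have pa' : members (th a) (th p) by apply/c4.
by rewrite -qw -(IH (th p) _ p q) // -av.
Qed.

Lemma EqCardP : denote (C := Mod R) (fEqCard U c d) <-> kappa = lambda.
Proof.
have [c1 c2 c3 c4] := ck; have [d1 d2 d3 d4] := dk.
split=> [[h1 h2]|e].
  apply/members_inj/seteqP; split=> v vk.
    have [[Z x p] [/= eZ xp] <-] := c2 v vk; subst Z.
    have [y [q [/PtP yq h]]] := h1 x p ((PtP x p).2 xp).
    have xZ : isPtIn c.1 (@Spt _ HomR U c.1 x p) by [].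
    have yZ : isPtIn d.1 (@Spt _ HomR U d.1 y q) by [].
    by rewrite ((EqOrdP xZ yZ).1 h); exact: d1.
  have [[Z x p] [/= eZ xp] <-] := d2 v vk; subst Z.
  have [y [q [/PtP yq h]]] := h2 x p ((PtP x p).2 xp).
  have xZ : isPtIn d.1 (@Spt _ HomR U d.1 x p) by [].
  have yZ : isPtIn c.1 (@Spt _ HomR U c.1 y q) by [].
  by rewrite -((EqOrdP yZ xZ).1 h); exact: c1.
split.
  apply/AllPtP => p pZ; have [|q qZ qp] := d2 (th p); first by rewrite -e; exact: c1.
  by apply/ExPtP; exists q => //; apply/EqOrdP.
apply/AllPtP => q qZ; have [|p pZ qp] := c2 (th' q); first by rewrite e; exact: d1.
by apply/ExPtP; exists p => //; apply/EqOrdP.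
Qed.

End EqOrd.
End Collapse.

(** * The translation of second-order formulas is correct *)

Section Correctness.
Variables (R : pzRingType) (localR : local_ring R).
Variables (U : lmodule R) (u0 : elements U) (val : elements U -> R).
Hypothesis freeU : free_on u0 val.

Local Notation HomR := (@Hom (Mod R)).
Local Notation spt := (spt HomR U).
Local Notation env := (env HomR U).
Variables (F : frame HomR U) (goodF : isGood F).

(** The endomorphism [f] is right multiplication by this element. *)
Definition rr (f : lhom U U) : R := val (f u0).

Lemma rr_inj (f g : lhom U U) : rr f = rr g -> f = g.
Proof.
move=> fg; apply/linear_ext/(hom_ext freeU).
by rewrite -[LHS](valE freeU) -[RHS](valE freeU) -/(rr f) fg.
Qed.

Lemma rr_hom_of r : rr (hom_of freeU (r *: u0)) = r.
Proof. by rewrite /rr hom_of1 (valK freeU). Qed.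

Definition isLab (f : lhom U U) (a : spt) : Prop :=
  exists x p, [/\ a = @Spt _ HomR U (fK F) x p, isPt x p & isQ f x].

Fixpoint labs (fs : seq (lhom U U)) (ks : seq spt) : Prop :=
  match fs, ks with
  | f :: fs, k :: ks => isLab f k /\ labs fs ks
  | [::], [::] => True
  | _, _ => False
  end.

Lemma LabelsP fs k : denote (C := Mod R) (@fLabels _ HomR U F fs k) <->
  exists2 ks, labs fs ks & denote (k ks).
Proof.
elim: fs k => [|f fs IH] k.
  by split=> [h|[[|//] _ h //]]; exists [::].
split=> [[x [p [/PtP xp [/QP q /IH[ks h1 h2]]]]]|[[|a ks] //= [[x [p [-> xp q]]] h1] h2]].
  by exists (@Spt _ HomR U (fK F) x p :: ks) => //; split=> //; exists x, p.
exists x, p; split; first exact/PtP; split; first exact/QP.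
by apply/IH; exists ks.
Qed.

Lemma labs_exist fs : exists ks, labs fs ks.
Proof.
elim: fs => [|f fs [ks h]]; first by exists [::].
have [x [p [xp q]]] := goodF.1 f.
by exists (@Spt _ HomR U (fK F) x p :: ks); split=> //; exists x, p.
Qed.

Lemma labs_inj fs gs ks : labs fs ks -> labs gs ks -> fs = gs.
Proof.
elim: fs gs ks => [|f fs IH] [|g gs] [|k ks] //= [fk h] [gk h'].
congr cons; last exact: IH h h'.
have [x [p [e xp q]]] := fk; have [y [r [e' _ q']]] := gk.
rewrite e in e'; have e2 := Spt_inj e'; subst y.
exact: (goodF.2 _ _ _ _ xp q q').
Qed.

Lemma labs_ptargs fs ks : labs fs ks -> ptargs (nseq (size fs) (fK F)) ks.
Proof.
elim: fs ks => [|f fs IH] [|k ks] //= [[x [p [-> xp _]]] /IH h].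
by split.
Qed.

Lemma labs_eqvs fs ks ks' : labs fs ks -> eqvs ks ks' ->
  ptargs (nseq (size fs) (fK F)) ks' -> labs fs ks'.
Proof.
elim: fs ks ks' => [|f fs IH] [|k ks] [|k' ks'] //= [fk h] [kk' h'] [k'K h''].
split; last exact: IH h h' h''.
have [x [p [e xp q]]] := fk; subst k.
case: k' k'K kk' => Z y r [/= eZ yr] kk'; subst Z.
by exists y, r; split=> //; exact: isQ_eqv (speqvE kk') q.
Qed.

Lemma ptargs_cat Zs Zs' (l l' : seq spt) : ptargs Zs l -> ptargs Zs' l' ->
  ptargs (Zs ++ Zs') (l ++ l').
Proof. by elim: Zs l => [|Z Zs IH] [|a l] //= [h /IH h']; split; auto. Qed.

Lemma ptargs_split Zs Zs' (l : seq spt) : ptargs (Zs ++ Zs') l ->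
  exists l1 l2, [/\ l = l1 ++ l2, ptargs Zs l1 & ptargs Zs' l2].
Proof.
elim: Zs l => [|Z Zs IH] l /=; first by exists [::], l.
by case: l => //= a l [h /IH[l1 [l2 [-> h1 h2]]]]; exists (a :: l1), l2.
Qed.

Lemma eqvs_cat (l1 l2 k1 k2 : seq spt) : eqvs l1 k1 -> eqvs l2 k2 ->
  eqvs (l1 ++ l2) (k1 ++ k2).
Proof. by elim: l1 k1 => [|a l1 IH] [|b k1] //= [h /IH h'] /h'. Qed.

Lemma eqvs_cat_inv (l1 l2 k1 k2 : seq spt) : size l1 = size k1 ->
  eqvs (l1 ++ l2) (k1 ++ k2) -> eqvs l1 k1 /\ eqvs l2 k2.
Proof. by elim: l1 k1 => [|a l1 IH] [|b k1] //= [/IH h] [ab /h[]]. Qed.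

Lemma ptargs_size Zs (l : seq spt) : ptargs Zs l -> size l = size Zs.
Proof. by elim: Zs l => [|Z Zs IH] [|a l] //= [_ /IH ->]. Qed.

Section Values.
Variables (ec : nat -> ruler HomR * rel HomR) (vc : nat -> V) (th : nat -> spt -> V).

Fixpoint vals (ks : seq nat) (args : seq spt) : seq V :=
  match ks, args with
  | k :: ks, a :: args => th k a :: vals ks args
  | _, _ => [::]
  end.

Lemma vals_eqvs ks (l l' : seq spt) : (forall k, k \in ks -> card_rel (ec k) (vc k) (th k)) ->
  ptargs [seq (ec k).1 | k <- ks] l -> ptargs [seq (ec k).1 | k <- ks] l' ->
  (vals ks l = vals ks l' <-> eqvs l l').
Proof.
elim: ks l l' => [|k ks IH] [|a l] [|b l'] //= h [aZ lZ] [bZ l'Z].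
have [_ _ thE _] := h k (mem_head _ _).
have hk j : j \in ks -> card_rel (ec j) (vc j) (th j) by move=> jk; apply: h; rewrite inE jk orbT.
have IH' := IH l l' hk lZ l'Z.
split=> [[/(thE a b aZ bZ) ab /IH' ll']|[/(thE a b aZ bZ) -> /IH' ->]] //.
Qed.

Lemma vals_members ks (l : seq spt) : (forall k, k \in ks -> card_rel (ec k) (vc k) (th k)) ->
  ptargs [seq (ec k).1 | k <- ks] l ->
  all2 (fun alpha kappa => alpha \in members kappa) (vals ks l) (map vc ks).
Proof.
elim: ks l => [|k ks IH] [|a l] //= h [aZ lZ].
have [thk _ _ _] := h k (mem_head _ _).
rewrite (mem_set (thk a aZ)) /=; apply: IH => // j jk; apply: h.
by rewrite inE jk orbT.
Qed.

End Values.

(** The two relations are compared on well-sorted arguments only. Asking for some list of labels is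
    enough, since labels determine the ring elements although not conversely. *)
Definition pred_inv (ec : nat -> ruler HomR * rel HomR) (th : nat -> spt -> V)
    (p : pred_var) (r : rel HomR) (P : l2_relation R) : Prop :=
  forall args fs, ptargs [seq (ec k).1 | k <- p.1.2] args -> size fs = p.2 ->
    ((exists2 ks, labs fs ks & app r (args ++ ks)) <->
      P (vals th p.1.2 args) (map rr fs)).

Definition inv (rings cards : seq nat) (ords : seq ord_var) (preds : seq pred_var) (e : env)
    (vr : nat -> R) (vc : nat -> V) (vo : ord_var -> V) (vp : pred_var -> l2_relation R)
    (th : nat -> spt -> V) : Prop :=
  [/\ forall r, r \in rings -> rr (er e r) = vr r,
      forall k, k \in cards -> vc k \in Cn /\ card_rel (ec e k) (vc k) (th k),
      forall a, a \in ords -> [/\ a.2 \in cards, isPtIn (ec e a.2).1 (eo e a) &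
        th a.2 (eo e a) = vo a] &
      forall p, p \in preds -> all [in cards] p.1.2 /\
        pred_inv (ec e) th p (ep e p) (vp p)].

Section Preds.
Variables (cards : seq nat) (ec : nat -> ruler HomR * rel HomR) (vc : nat -> V)
  (th : nat -> spt -> V).
Hypothesis cardsP : forall k, k \in cards -> vc k \in Cn /\ card_rel (ec k) (vc k) (th k).
Variable p : pred_var.
Hypothesis pc : all [in cards] p.1.2.

Let hk k : k \in p.1.2 -> card_rel (ec k) (vc k) (th k).
Proof. by move=> /(allP pc)/cardsP[]. Qed.

Lemma rel_of_pred (P : l2_relation R) : exists2 r : rel HomR,
  size (rcs r) = (size p.1.2 + p.2)%N & pred_inv ec th p r P.
Proof.
pose Zs := [seq (ec k).1 | k <- p.1.2].
have [|r sr rP] := rel_exists localR freeU (Zs := Zs ++ nseq p.2 (fK F))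
    (P := fun l => exists args ks fs, [/\ l = args ++ ks, ptargs Zs args, size fs = p.2,
       labs fs ks & P (vals th p.1.2 args) (map rr fs)]).
  move=> l l' lZ l'Z ll' [args [ks [fs [e aZ sfs fk h]]]]; subst l.
  have [args' [ks' [e a'Z k'K]]] := ptargs_split l'Z; subst l'.
  have [] := eqvs_cat_inv _ ll'; first by rewrite (ptargs_size aZ) (ptargs_size a'Z).
  move=> aa' kk'; exists args', ks', fs; split=> //.
    by apply: labs_eqvs fk kk' _; rewrite sfs.
  by rewrite -((vals_eqvs hk aZ a'Z).2 aa').
exists r; first by rewrite sr size_cat size_map size_nseq.
move=> args fs aZ sfs; split=> [[ks fk]|h].
  have kK : ptargs (nseq p.2 (fK F)) ks by rewrite -sfs; exact: labs_ptargs.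
  move=> /(rP _ (ptargs_cat aZ kK))[args' [ks' [fs' [e a'Z sfs' fk' h]]]].
  have [e1 e2] : args = args' /\ ks = ks'.
    have s : size args = size args' by rewrite (ptargs_size aZ) (ptargs_size a'Z).
    split; first by rewrite -[args](take_size_cat ks erefl) e s take_size_cat.
    by rewrite -[ks](drop_size_cat ks (erefl (size args))) e s drop_size_cat.
  by subst args' ks'; rewrite (labs_inj fk fk').
have [ks fk] := labs_exist fs; exists ks => //.
have kK : ptargs (nseq p.2 (fK F)) ks by rewrite -sfs; exact: labs_ptargs.
by apply/(rP _ (ptargs_cat aZ kK)); exists args, ks, fs.
Qed.

(** The relation is read off from the values of points; equal values mean equivalent points, between
    which [app] does not distinguish. *)
Lemma pred_of_rel (r : rel HomR) : exists2 P : l2_relation R,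
  relation_on (map vc p.1.2) p.2 P & pred_inv ec th p r P.
Proof.
pose Zs := [seq (ec k).1 | k <- p.1.2].
exists (fun alphas rs => exists args ks fs, [/\ ptargs Zs args, size fs = p.2, labs fs ks,
   app r (args ++ ks) & alphas = vals th p.1.2 args /\ rs = map rr fs]).
  move=> alphas rs [args [ks [fs [aZ sfs _ _ [-> ->]]]]].
  by split; [exact: vals_members hk aZ|rewrite size_map].
move=> args fs aZ sfs; split=> [[ks fk h]|]; first by exists args, ks, fs.
move=> [args' [ks [fs' [a'Z sfs' fk h [e1 e2]]]]].
have ef : fs = fs'.
  elim: fs fs' {sfs sfs' fk} e2 => [|f fs IH] [|f' fs'] //= [/rr_inj -> /IH ->] //.
subst fs'; exists ks => //; apply: app_eqv h; apply: eqvs_cat; last exact: eqvs_refl.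
by apply/(vals_eqvs hk a'Z aZ).
Qed.

End Preds.

Section Updates.
Variables (rings cards : seq nat) (ords : seq ord_var) (preds : seq pred_var) (e : env).
Variables (vr : nat -> R) (vc : nat -> V) (vo : ord_var -> V) (vp : pred_var -> l2_relation R).
Variable th : nat -> spt -> V.
Hypothesis I : inv rings cards ords preds e vr vc vo vp th.

Lemma inv_ring r f : inv (r :: rings) cards ords preds
  (Env [eta er e with r |-> f] (ec e) (eo e) (ep e)) [eta vr with r |-> rr f] vc vo vp th.
Proof.
have [Ir Ic Io Ip] := I; split=> // j /=.
by rewrite inE; case: eqP => [//|_ /Ir].
Qed.

(** That [k] is not yet in scope keeps the ordinal and predicate variables in scope attached to the
    same cardinals as before. *)
Lemma inv_card k c kappa t : k \notin cards -> kappa \in Cn -> card_rel c kappa t ->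
  inv rings (k :: cards) ords preds
    (Env (er e) [eta ec e with k |-> c] (eo e) (ep e))
    vr [eta vc with k |-> kappa] vo vp [eta th with k |-> t].
Proof.
move=> nk kC ck; have [Ir Ic Io Ip] := I.
have nkj j : j \in cards -> (j == k) = false by move=> jc; apply: contraNF nk => /eqP <-.
split=> //=.
- move=> j; rewrite in_cons; case: (j == k) => [_|/= /Ic //]; by split.
- by move=> a /Io[h1 h2 h3]; rewrite inE h1 orbT nkj.
- move=> p /Ip[h1 h2]; split.
    by apply/allP => j /(allP h1) jc; rewrite /= inE jc orbT.
  move=> args fs.
  have -> : [seq ([eta ec e with k |-> c] j).1 | j <- p.1.2] = [seq (ec e j).1 | j <- p.1.2].
    by apply/eq_in_map => j /(allP h1) jc /=; rewrite nkj.
  have -> : vals [eta th with k |-> t] p.1.2 args = vals th p.1.2 args; last exact: h2.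
  move: h1; elim: (p.1.2) args => [|j ks IH] [|a l] //= /andP[jc /IH ->].
  by rewrite nkj.
Qed.

Lemma inv_ord a p : a.2 \in cards -> isPtIn (ec e a.2).1 p ->
  inv rings cards (a :: ords) preds (Env (er e) (ec e) [eta eo e with a |-> p] (ep e))
    vr vc [eta vo with a |-> th a.2 p] vp th.
Proof.
move=> ac pZ; have [Ir Ic Io Ip] := I; split=> // b /=.
by rewrite inE; case: eqP => [->|_ /Io].
Qed.

Lemma inv_pred p r P : all [in cards] p.1.2 -> pred_inv (ec e) th p r P ->
  inv rings cards ords (p :: preds) (Env (er e) (ec e) (eo e) [eta ep e with p |-> r])
    vr vc vo [eta vp with p |-> P] th.
Proof.
move=> pc pr; have [Ir Ic Io Ip] := I; split=> // q /=.
by rewrite inE; case: eqP => [->|_ /Ip].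
Qed.

End Updates.

Lemma tr_correct A rings cards ords preds (e : env) vr vc vo vp th :
  l2_scoped rings cards ords preds A ->
  inv rings cards ords preds e vr vc vo vp th ->
  (denote (C := Mod R) (tr F A e) <-> l2_sat vr vc vo vp A).
Proof.
elim: A rings cards ords preds e vr vc vo vp th =>
  [r1 r2 r3|r1 r2 r3|r1 r2|k1 k2|a1 a2|i al rs|A IA|A IA B IB|A IA B IB
  |A IA B IB|r A IA|r A IA|k A IA|k A IA|a A IA|a A IA|p A IA|p A IA]
  rings cards ords preds e vr vc vo vp th sc I; have [Ir Ic Io Ip] := I.
- have /and3P[h1 h2 h3] := sc; rewrite [tr _ _ _]/= [l2_sat _ _ _ _ _]/= -!Ir // (AddP freeU).
  split=> [h|h u]; first by rewrite /rr h -[X in val (X + _)]scale1r (val_linear freeU) mul1r.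
  rewrite (homE freeU) [er e r2 u](homE freeU) [er e r3 u](homE freeU) -scalerDr; congr (_ *: _).
  by rewrite -[LHS](valE freeU) -/(rr _) h scalerDl /rr !(valE freeU).
- have /and3P[h1 h2 h3] := sc; rewrite [tr _ _ _]/= [l2_sat _ _ _ _ _]/= -!Ir // EqCompP.
  have e32 : val (er e r3 (er e r2 u0)) = rr (er e r2) * rr (er e r3).
    by rewrite (homE freeU) (valZ freeU).
  split=> [h|h]; first by rewrite /rr h.
  apply: (hom_ext freeU (g := lhom_comp (er e r3) (er e r2))) => /=.
  by rewrite -[LHS](valE freeU) -[RHS](valE freeU) e32 -h.
- have /andP[h1 h2] := sc; rewrite /= -!Ir //.
  by split=> [->//|]; exact: rr_inj.
- have /andP[/Ic[C1 ck1] /Ic[C2 ck2]] := sc.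
  exact: (EqCardP localR freeU ck1 ck2 (Cn_transitive C1) (Cn_transitive C2)).
- have /andP[/Io[h1 h2 e1] /Io[h3 h4 e2]] := sc; rewrite [l2_sat _ _ _ _ _]/= -e1 -e2.
  have [C1 ck1] := Ic _ h1; have [C2 ck2] := Ic _ h3.
  exact: (EqOrdP localR freeU ck1 ck2 (Cn_transitive C1) (Cn_transitive C2) h2 h4).
- have /and3P[hp hal hrs] := sc; have [_ ipr] := Ip _ hp.
  have aZ : ptargs [seq (ec e k).1 | k <- [seq a.2 | a <- al]] (map (eo e) al).
    elim: al hal {hp ipr sc} => //= a al IH /andP[/Io[_ h _] /IH h']; by split.
  have -> : l2_sat vr vc vo vp (L2Pred i al rs) =
      vp (pred_of i al rs) (vals th [seq a.2 | a <- al] (map (eo e) al)) (map rr (map (er e) rs)).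
    rewrite /=; congr (vp _ _ _).
      elim: al hal {hp ipr aZ sc} => //= a al IH /andP[/Io[_ _ ->] /IH ->] //.
    elim: rs hrs {hp ipr sc} => //= r rs IH /andP[/Ir -> /IH ->] //.
  rewrite -(ipr (map (eo e) al) (map (er e) rs)) ?size_map // LabelsP.
  by split=> -[ks fk /AppP h]; exists ks => //; apply/AppP.
- by have h := IA _ _ _ _ _ _ _ _ _ _ sc I; split=> n /h.
- have /andP[sA sB] := sc; have hA := IA _ _ _ _ _ _ _ _ _ _ sA I.
  by have hB := IB _ _ _ _ _ _ _ _ _ _ sB I; split=> -[/hA h1 /hB h2]; split.
- have /andP[sA sB] := sc; have hA := IA _ _ _ _ _ _ _ _ _ _ sA I.
  by have hB := IB _ _ _ _ _ _ _ _ _ _ sB I; split=> [[/hA|/hB]|[/hA|/hB]]; [left|right|left|right].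
- have /andP[sA sB] := sc; have hA := IA _ _ _ _ _ _ _ _ _ _ sA I.
  by have hB := IB _ _ _ _ _ _ _ _ _ _ sB I; split=> h /hA/h/hB.
- split=> [h x|h f]; last exact: ((IA _ _ _ _ _ _ _ _ _ _ sc (inv_ring I r f)).2 (h (rr f))).
  have := (IA _ _ _ _ _ _ _ _ _ _ sc (inv_ring I r _)).1 (h (hom_of freeU (x *: u0))).
  by rewrite rr_hom_of.
- split=> [[f h]|[x h]].
    by exists (rr f); exact: ((IA _ _ _ _ _ _ _ _ _ _ sc (inv_ring I r f)).1 h).
  exists (hom_of freeU (x *: u0)); rewrite -[x]rr_hom_of in h.
  exact: ((IA _ _ _ _ _ _ _ _ _ _ sc (inv_ring I r _)).2 h).
- have /andP[nk sA] := sc; split=> [h kappa kC|h].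
    have [c [t [ck sc']]] := card_exists localR freeU kappa.
    apply: (IA _ _ _ _ _ _ _ _ _ _ sA (inv_card I nk kC ck)).1.
    have h' := (AllRelP _ _).1 ((AllRulerP _).1 h c.1).
    by case: c ck sc' h' => Z S ck sS h'; apply: (h' S sS); exact: Cn_card ck kC.
  apply/AllRulerP => Z; apply/AllRelP => S sS; imp => hc.
  have [kappa kC [t ck]] := card_collapse localR freeU hc.
  exact: ((IA _ _ _ _ _ _ _ _ _ _ sA (inv_card I nk kC ck)).2 (h _ kC)).
- have /andP[nk sA] := sc; split=> [/ExRulerP[Z /ExRelP[S sS [hc h]]]|[kappa kC h]].
    have [kappa kC [t ck]] := card_collapse localR freeU hc.
    by exists kappa => //; exact: ((IA _ _ _ _ _ _ _ _ _ _ sA (inv_card I nk kC ck)).1 h).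
  have [[Z S] [t [ck sc']]] := card_exists localR freeU kappa.
  apply/ExRulerP; exists Z; apply/ExRelP; exists S => //.
  split; first exact: Cn_card ck kC.
  exact: ((IA _ _ _ _ _ _ _ _ _ _ sA (inv_card I nk kC ck)).2 h).
- have /andP[ac sA] := sc; have [_ [thk thS _ _]] := Ic _ ac.
  split=> [/AllPtP h v /set_mem vk|h].
    have [p pZ <-] := thS v vk.
    exact: ((IA _ _ _ _ _ _ _ _ _ _ sA (inv_ord I ac pZ)).1 (h p pZ)).
  apply/AllPtP => p pZ; apply: (IA _ _ _ _ _ _ _ _ _ _ sA (inv_ord I ac pZ)).2.
  by apply/h/mem_set/thk.
- have /andP[ac sA] := sc; have [_ [thk thS _ _]] := Ic _ ac.
  split=> [/ExPtP[p pZ h]|[v /set_mem vk h]].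
    exists (th a.2 p); first exact/mem_set/thk.
    exact: ((IA _ _ _ _ _ _ _ _ _ _ sA (inv_ord I ac pZ)).1 h).
  have [p pZ pv] := thS v vk; apply/ExPtP; exists p => //; rewrite -pv in h.
  exact: ((IA _ _ _ _ _ _ _ _ _ _ sA (inv_ord I ac pZ)).2 h).
- have /andP[pc sA] := sc; split=> [/AllRelP h P hP|h].
    have [r sr rP] := rel_of_pred Ic pc P.
    exact: ((IA _ _ _ _ _ _ _ _ _ _ sA (inv_pred I pc rP)).1 (h r sr)).
  apply/AllRelP => r sr; have [P hP rP] := pred_of_rel Ic pc r.
  exact: ((IA _ _ _ _ _ _ _ _ _ _ sA (inv_pred I pc rP)).2 (h P hP)).
- have /andP[pc sA] := sc; split=> [/ExRelP[r sr h]|[P hP h]].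
    have [P hP rP] := pred_of_rel Ic pc r; exists P => //.
    exact: ((IA _ _ _ _ _ _ _ _ _ _ sA (inv_pred I pc rP)).1 h).
  have [r sr rP] := rel_of_pred Ic pc P; apply/ExRelP; exists r => //.
  exact: ((IA _ _ _ _ _ _ _ _ _ _ sA (inv_pred I pc rP)).2 h).
Qed.

End Correctness.

Lemma ExFrameP (R : pzRingType) (U : lmodule R) (k : frame (@Hom (Mod R)) U -> form (@Hom (Mod R))) :
  denote (C := Mod R) (fExFrame k) <-> exists F, denote (k F).
Proof.
split=> [|[[[N M io z] P b s l eps B [N' M' io' z'] [[N2 M2 io2 z2] g]] h]].
  move=> [N [M [io [z [P [b [s [l [eps [B [N' [M' [io' [z' [N2 [M2 [io2 [z2 [g h]]]]]]]]]]]]]]]]]]].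
  by exists (@Frame _ _ U (Ruler io z) P b s l eps B (Ruler io' z') (@Code _ _ N (Ruler io2 z2) g)).
by exists N, M, io, z, P, b, s, l, eps, B, N', M', io', z', N2, M2, io2, z2, g.
Qed.

Lemma tr_sentence_correct (R : pzRingType) (A : l2_formula) : local_ring R -> small R ->
  l2_sentence A -> (denote (C := Mod R) (tr_sentence _ A) <-> l2_true R A).
Proof.
move=> localR smallR sA.
have sat (U : lmodule R) u0 val (freeU : @free_on R U u0 val)
    (F : frame (@Hom (Mod R)) U) (vr : nat -> R) vc vo (vp : pred_var -> l2_relation R) :
    isGood F -> (denote (C := Mod R) (tr F A (env0 (lhom_id U))) <-> l2_sat vr vc vo vp A).
  move=> goodF; have I : inv u0 val F [::] [::] [::] [::] (env0 (lhom_id U)) vr vc vo vp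
    (fun _ _ => vc 0%N) by split.
  exact (tr_correct localR freeU goodF sA I).
split=> [[U [/(UnitP localR smallR)[u0 [val freeU]] hF]] vr vc vo vp|h].
  have [F [/GoodP goodF h]] := (@ExFrameP R U (fun F => FAnd (fGood F) (tr F A (env0 (lhom_id U))))).1 hF.
  exact: ((sat _ _ _ freeU F vr vc vo vp goodF).1 h).
have [U [u0 [val freeU]]] := regular_exists smallR.
have [F goodF] := frame_exists localR smallR freeU.
exists U; split; first by apply/(UnitP localR smallR); exists u0, val.
apply/(@ExFrameP R U (fun F => FAnd (fGood F) (tr F A (env0 (lhom_id U))))); exists F; split; first exact/GoodP.
exact: ((sat _ _ _ freeU F (fun _ => 0) (fun _ => \pi_V leaf) (fun _ => \pi_V leaf)
  (fun _ _ _ => True) goodF).2 (h _ _ _ _)).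
Qed.

Lemma l2_true_compile (R : pzRingType) (A : l2_formula) : local_ring R -> small R ->
  l2_sentence A -> cat_sentence (compile (tr_sentence name A) 0) /\
    (cat_true (Mod R) (compile (tr_sentence name A) 0) <-> l2_true R A).
Proof.
move=> localR smallR sA; have [U _] := regular_exists smallR.
have [sC hC] := compile_sentence (C := Mod R) U (fun X Y => zhom X Y) (wf_tr_sentence (Mod R) A).
split=> //; exact: iff_trans hC (tr_sentence_correct localR smallR sA).
Qed.

(** * The category interpreted in second-order logic *)

Lemma wo_collapse (T : Type) (lt : T -> T -> Prop) : small T -> well_founded lt ->
  exists f : T -> V, forall x v, members (f x) v <-> exists2 y, lt y x & f y = v.
Proof.
move=> sT wf.
pose F x (h : forall y, lt y x -> V) : V :=
  projT1 (cid (small_set_of (fun y : {y | lt y x} => h (sval y) (svalP y)) (small_sig _ sT))).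
have FE x h v : members (F x h) v <-> exists y : {y | lt y x}, h (sval y) (svalP y) = v.
  by rewrite /F; case: cid => z /= ->; split=> [[y _ <-]|[y <-]]; exists y.
exists (Fix wf _ F) => x v; rewrite Fix_eq ?FE.
  by split=> [[[y yx] <-]|[y yx <-]]; [exists y|exists (exist _ y yx)].
by move=> {}x h k hk; congr F; apply: functional_extensionality_dep => y; apply: funext => yx.
Qed.

(** Collapsing a well-order of [T] gives an equipotent ordinal; a membership-minimal ordinal
    equipotent with [T] is a cardinal. *)
Lemma cardinal_exists (T : Type) : small T ->
  exists2 kappa, kappa \in Cn & exists h : T -> V, injective h /\ range h = members kappa.
Proof.
move=> sT; have [lt [wf tr tri]] := wo_exists T; have [f fE] := wo_collapse sT wf.
have fI : injective f.
  have ne x y : lt x y -> f x <> f y.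
    by move=> xy e; apply: (@wf_irr _ _ (f y) mem_wf); apply/fE; exists x.
  by move=> x y e; have [xy|//|yx] := tri x y; [case: (ne _ _ xy)|case: (ne _ _ yx)].
have [o oE] := small_set_of f sT.
pose Q v := ordinal v /\ exists h : T -> V, injective h /\ range h = members v.
have [kappa [[tk tk'] [h [hI hS]]] min] : exists2 v, Q v & forall w, members v w -> ~ Q w.
  apply: (wf_min mem_wf); exists o; split; last by exists f.
  split=> [v|v]; rewrite oE => /set_mem[x _ <-] w.
    by move=> /fE[y _ <-]; exists y.
  move=> /set_mem/fE[y yx <-] u /fE[z zy <-]; apply/fE.
  by exists z => //; exact: tr zy yx.
exists kappa; last by exists h.
apply/mem_set; split=> [//|v vk vkappa]; apply: (min v (set_mem vk)); split.
  split; first exact: tk'.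
  by move=> w /set_mem wv; apply/tk'/mem_set/(tk v vk).
have /card_set_bijP[g [gf gI gS]] : (members kappa #= members v)%card by rewrite card_eq_sym.
have hk t : members kappa (h t) by rewrite -hS; exists t.
exists (g \o h); split=> [s t /= e|].
  by apply/hI/gI => //; exact/mem_set.
apply/seteqP; split=> [_ [t _ <-]|w /gS[u]]; first exact/gf/hk.
by rewrite -hS => -[t _ <-] <-; exists t.
Qed.

(** * Modules and homomorphisms axiomatized in second-order logic *)

Section CategoryFormulas.

(** The language has no truth constants; a closed formula that holds because the ring is inhabited
    takes their place. *)
Definition l2_bool (b : bool) : l2_formula :=
  let T := L2ExRing 0 (L2EqRing 0 0) in if b then T else L2Not T.

(** The sorts keep the variables for additions, scalar multiplications and morphisms apart, so the
    index 0 can also name a morphism. *)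
Definition pAdd (s : nat) : pred_var := (0, [:: s; s; s], 0)%N.
Definition pScale (s : nat) : pred_var := (0, [:: s; s], 1)%N.
Definition pMor (f d c : nat) : pred_var := (f, [:: d; c], 0)%N.

Definition fmAdd (s i j k : nat) := L2Pred 0 [:: (i, s); (j, s); (k, s)] [::].
Definition fmScale (s r i j : nat) := L2Pred 0 [:: (i, s); (j, s)] [:: r].
Definition fmMor (f d c i j : nat) := L2Pred f [:: (i, d); (j, c)] [::].

Definition fmAll (s : nat) (xs : seq nat) (A : l2_formula) : l2_formula :=
  foldr (fun i => L2AllOrd (i, s)) A xs.

Definition fmAddOk (s : nat) : l2_formula :=
  let add := fmAdd s in let all := fmAll s in
  L2And (L2And
    (all [:: 0; 1]%N (L2ExOrd (2, s)%N (add 0 1 2)%N))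
    (all [:: 0; 1; 2; 3]%N
      (L2Imp (add 0 1 2)%N (L2Imp (add 0 1 3)%N (L2EqOrd (2, s)%N (3, s)%N)))))
  (L2And (L2And
    (all [:: 0; 1; 2; 3; 4; 5]%N
      (L2Imp (add 1 2 3)%N (L2Imp (add 0 3 4)%N (L2Imp (add 0 1 5)%N (add 5 2 4)%N))))
    (all [:: 0; 1; 2]%N (L2Imp (add 0 1 2)%N (add 1 0 2)%N)))
    (L2ExOrd (0, s)%N (L2And (all [:: 1]%N (add 0 1 1)%N)
      (all [:: 1]%N (L2ExOrd (2, s)%N (add 2 1 0)%N))))).

Definition fmScaleOk (s : nat) : l2_formula :=
  let add := fmAdd s in let sc := fmScale s in let all := fmAll s in
  L2And (L2And
    (L2AllRing 0 (all [:: 0]%N (L2ExOrd (1, s)%N (sc 0 0 1)%N)))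
    (L2AllRing 0 (all [:: 0; 1; 2]%N
      (L2Imp (sc 0 0 1)%N (L2Imp (sc 0 0 2)%N (L2EqOrd (1, s)%N (2, s)%N))))))
  (L2And (L2And
    (L2AllRing 0 (L2AllRing 1 (L2AllRing 2 (L2Imp (L2Mul 0 1 2)
      (all [:: 0; 1; 2]%N (L2Imp (sc 2 0 1)%N (L2Imp (sc 1 1 2)%N (sc 0 0 2)%N)))))))
    (* The element 1 is not in the language; it is singled out as a left identity of
       multiplication. *)
    (L2AllRing 0 (L2Imp (L2AllRing 1 (L2Mul 1 0 1)) (all [:: 0]%N (sc 0 0 0)%N))))
  (L2And
    (L2AllRing 0 (all [:: 0; 1; 2; 3; 4; 5]%N (L2Imp (add 0 1 2)%N
      (L2Imp (sc 0 0 3)%N (L2Imp (sc 0 1 4)%N (L2Imp (sc 0 2 5)%N (add 3 4 5)%N))))))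
    (L2AllRing 0 (L2AllRing 1 (L2AllRing 2 (L2Imp (L2Add 0 1 2)
      (all [:: 0; 1; 2; 3]%N (L2Imp (sc 1 0 1)%N (L2Imp (sc 2 0 2)%N
        (L2Imp (sc 0 0 3)%N (add 1 2 3)%N))))))))))%N.

Definition fmLinear (f d c : nat) : l2_formula :=
  let mor := fmMor f d c in
  L2And (L2And
    (fmAll d [:: 0]%N (L2ExOrd (1, c)%N (mor 0 1)%N))
    (fmAll d [:: 0]%N (fmAll c [:: 1; 2]%N
      (L2Imp (mor 0 1)%N (L2Imp (mor 0 2)%N (L2EqOrd (1, c)%N (2, c)%N))))))
  (L2And
    (fmAll d [:: 0; 1; 2]%N (fmAll c [:: 3; 4; 5]%N
      (L2Imp (mor 0 3)%N (L2Imp (mor 1 4)%N (L2Imp (mor 2 5)%N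
        (L2Imp (fmAdd d 0 1 2) (fmAdd c 3 4 5)))))))
    (L2AllRing 0 (fmAll d [:: 0; 1]%N (fmAll c [:: 2; 3]%N
      (L2Imp (mor 0 2)%N (L2Imp (mor 1 3)%N
        (L2Imp (fmScale d 0 0 1) (fmScale c 0 2 3)))))))).

End CategoryFormulas.
Arguments l2_bool b : simpl never.


Ltac l2simpl s :=
  rewrite /= /pred_of /= /eq_op /=; case: (s == s) (eqxx s) => // _.

Section Slots.
Variable R : pzRingType.

(* A slot is a module transported to the ordinals below a cardinal. *)
Record slot := Slot {
  so : lmodule R;
  sth : elements so -> V
}.
Arguments Slot so sth : clear implicits.

Definition slot_ok (S : slot) (kappa : V) (Pa Ps : l2_relation R) : Prop :=
  [/\ injective (sth (s := S)), range (sth (s := S)) = members kappa,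
      forall x y z : elements (so S), Pa [:: sth x; sth y; sth z] [::] <-> x + y = z &
      forall r (x y : elements (so S)), Ps [:: sth x; sth y] [:: r] <-> r *: x = y].

Lemma slot_exists (X : lmodule R) : exists2 kappa, kappa \in Cn &
  exists th Pa Ps, [/\ slot_ok (Slot X th) kappa Pa Ps,
    relation_on [:: kappa; kappa; kappa] 0 Pa & relation_on [:: kappa; kappa] 1 Ps].
Proof.
have [kappa kC [th [thI thS]]] := cardinal_exists (small_members (carrier X)).
have thk x : th x \in members kappa by rewrite -thS; apply/mem_set; exists x.
exists kappa => //; exists (th : elements X -> V).
exists (fun vs rs => exists x y : elements X, vs = [:: th x; th y; th (x + y)] /\ rs = [::]).
exists (fun vs rs => exists a (x : elements X), vs = [:: th x; th (a *: x)] /\ rs = [:: a]).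
split; first split=> //=.
- move=> x y z; split=> [[x' [y' [[/thI -> /thI -> /thI ->]]]]//|<-]; by exists x, y.
- move=> a x y; split=> [[b [x' [[/thI -> /thI ->] [->]]]]//|<-]; by exists a, x.
- by move=> vs rs [x [y [-> ->]]]; rewrite /= !thk.
- by move=> vs rs [a [x [-> ->]]]; rewrite /= !thk.
Qed.

Definition graph (S D : slot) (h : lhom (so S) (so D)) (P : l2_relation R) : Prop :=
  forall x y, P [:: sth x; sth y] [::] <-> h x = y.

Lemma graph_exists (S D : slot) kappa lambda Pa Ps Pa' Ps' (h : lhom (so S) (so D)) :
  slot_ok S kappa Pa Ps -> slot_ok D lambda Pa' Ps' ->
  exists2 P, relation_on [:: kappa; lambda] 0 P & graph h P.
Proof.
move=> [thI thS _ _] [thI' thS' _ _].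
exists (fun vs rs => exists x, vs = [:: sth x; sth (h x)] /\ rs = [::]).
  by move=> vs rs [x [-> ->]]; rewrite /= -thS -thS' !mem_set //.
move=> x y; split=> [[x' [[/thI -> /thI' ->]]]//|<-]; by exists x.
Qed.

Section Sat.
Variables (vr : nat -> R) (vc : nat -> V) (vo : ord_var -> V) (vp : pred_var -> l2_relation R).

Lemma slot_sat (S : slot) s : slot_ok S (vc s) (vp (pAdd s)) (vp (pScale s)) ->
  l2_sat vr vc vo vp (fmAddOk s) /\ l2_sat vr vc vo vp (fmScaleOk s).
Proof.
move=> [thI thS hA hS].
have thk x : sth (s := S) x \in members (vc s) by rewrite -thS; apply/mem_set; exists x.
have {}thS v : v \in members (vc s) -> exists x, sth (s := S) x = v.
  by rewrite -thS => /set_mem[x _ <-]; exists x.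
split; l2simpl s.
  split; split.
  - move=> _ /thS[x <-] _ /thS[y <-]; exists (sth (x + y)) => //; exact/hA.
  - by move=> _ /thS[x <-] _ /thS[y <-] _ /thS[z <-] _ /thS[t <-] /hA <- /hA <-.
  - split.
      move=> _ /thS[x <-] _ /thS[y <-] _ /thS[z <-] _ /thS[t <-] _ /thS[u <-] _ /thS[v <-].
      by move=> /hA <- /hA <- /hA <-; apply/hA; rewrite addrA.
    by move=> _ /thS[x <-] _ /thS[y <-] _ /thS[z <-] /hA <-; apply/hA; rewrite addrC.
  - exists (sth (s := S) 0) => //; split=> _ /thS[x <-]; first by apply/hA; rewrite add0r.
    by exists (sth (- x)) => //; apply/hA; rewrite addNr.
split; split.
- move=> a _ /thS[x <-]; exists (sth (a *: x)) => //; exact/hS.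
- by move=> a _ /thS[x <-] _ /thS[y <-] _ /thS[z <-] /hS <- /hS <-.
- split.
    move=> a b c -> _ /thS[x <-] _ /thS[y <-] _ /thS[z <-] /hS <- /hS <-.
    by apply/hS; rewrite scalerA.
  move=> a ha _ /thS[x <-]; apply/hS.
  by have := ha 1; rewrite mulr1 => <-; rewrite scale1r.
- split.
    move=> a _ /thS[x <-] _ /thS[y <-] _ /thS[z <-] _ /thS[t <-] _ /thS[u <-] _ /thS[v <-].
    by move=> /hA <- /hS <- /hS <- /hS <-; apply/hA; rewrite scalerDr.
  move=> a b c -> _ /thS[x <-] _ /thS[y <-] _ /thS[z <-] _ /thS[t <-].
  by move=> /hS <- /hS <- /hS <-; apply/hA; rewrite scalerDl.
Qed.

(** The relations make the members of the cardinal itself into a module. It is replaced by an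
    isomorphic copy outside [bad], because a new slot must not hold an object that is already
    named. *)
Lemma sat_slot (bad : seq (lmodule R)) s :
  l2_sat vr vc vo vp (fmAddOk s) -> l2_sat vr vc vo vp (fmScaleOk s) ->
  exists2 S, slot_ok S (vc s) (vp (pAdd s)) (vp (pScale s)) & ~ List.In (so S) bad.
Proof.
l2simpl s; move=> [[at_ af] [[aA aC] [z zk [z0 zN]]]] [[st sf] [[sA s1] [sDr sDl]]].
pose T : Type := members (vc s); pose v (t : T) : V := \val t.
have vP t : v t \in members (vc s) by exact: valP.
have vI : injective v by exact: val_inj.
have vS w : w \in members (vc s) -> exists t, v t = w by move=> h; exists (SigSub h).
have [add addE] : exists add : T * T -> T, forall p t,
    vp (pAdd s) [:: v p.1; v p.2; v t] [::] <-> add p = t.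
  have [|add addE] := @boolp.choice (T * T)%type T
      (fun p t => vp (pAdd s) [:: v p.1; v p.2; v t] [::]).
    by move=> [x y]; have [w /vS[t <-] h] := at_ _ (vP x) _ (vP y); exists t.
  exists add => p t; split=> [h|<-]; last exact: addE.
  exact/vI/(af _ (vP p.1) _ (vP p.2) _ (vP _) _ (vP _) (addE p) h).
have [sc scE] : exists sc : R * T -> T, forall p t,
    vp (pScale s) [:: v p.2; v t] [:: p.1] <-> sc p = t.
  have [|sc scE] := @boolp.choice (R * T)%type T
      (fun p t => vp (pScale s) [:: v p.2; v t] [:: p.1]).
    by move=> [a x]; have [w /vS[t <-] h] := st a _ (vP x); exists t.
  exists sc => p t; split=> [h|<-]; last exact: scE.
  exact/vI/(sf p.1 _ (vP p.2) _ (vP _) _ (vP _) (scE p) h).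
have {at_ af} addP x y : vp (pAdd s) [:: v x; v y; v (add (x, y))] [::] by exact/(addE (x, y)).
have {st sf} scP a x : vp (pScale s) [:: v x; v (sc (a, x))] [:: a] by exact/(scE (a, x)).
have [o ov] := vS z zk; rewrite -ov in zk z0 zN *.
have [|opp oppE] := @boolp.choice T T (fun x t => add (t, x) = o).
  move=> x; have [w /vS[t <-] h] := zN _ (vP x).
  by exists t; apply/(addE (t, x)).
have laddA : associative (fun x y => add (x, y)).
  move=> x y w; apply/esym/(addE (add (x, y), w)).
  exact: (aA _ (vP x) _ (vP y) _ (vP w) _ (vP _) _ (vP _) _ (vP _)
    (addP y w) (addP x (add (y, w))) (addP x y)).
have laddC : commutative (fun x y => add (x, y)).
  by move=> x y; apply/esym/(addE (y, x)); exact: (aC _ (vP x) _ (vP y) _ (vP _) (addP x y)).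
have ladd0 : left_id o (fun x y => add (x, y)).
  by move=> x; apply/(addE (o, x)); exact: z0 (vP x).
have lscA a b x : sc (a, sc (b, x)) = sc (a * b, x).
  apply/esym/(scE (a * b, x)).
  exact: (sA _ a b erefl _ (vP x) _ (vP _) _ (vP _) (scP b x) (scP a _)).
have lsc1 x : sc (1, x) = x.
  by apply/(scE (1, x)); apply: s1 (vP x) => r; rewrite mul1r.
have lscDr a x y : sc (a, add (x, y)) = add (sc (a, x), sc (a, y)).
  apply/esym/(addE (sc (a, x), sc (a, y))).
  exact: (sDr a _ (vP x) _ (vP y) _ (vP _) _ (vP _) _ (vP _) _ (vP _)
    (addP x y) (scP a x) (scP a y) (scP a _)).
have lscDl x a b : sc (a + b, x) = add (sc (a, x), sc (b, x)).
  apply/esym/(addE (sc (a, x), sc (b, x))).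
  exact: (sDl _ a b erefl _ (vP x) _ (vP _) _ (vP _) _ (vP _) (scP a x) (scP b x) (scP _ x)).
pose Y := @LModule R (vc s) o opp (fun x y => add (x, y)) (fun a x => sc (a, x))
  laddA laddC ladd0 oppE lscA lsc1 lscDr lscDl.
have [X [f [g [fK gK Xbad]]]] := lmodule_exists (T := elements Y) bad (small_members _).
exists (Slot X (v \o g)) => //; split=> /=.
- by move=> x y /vI/(can_inj gK).
- apply/seteqP; split=> [_ [x _ <-]|w /mem_set/vS[t <-]]; first exact/set_mem/vP.
  by exists (f t) => //=; rewrite fK.
- move=> x y w; apply: (iff_trans (addE (g x, g y) (g w))); rewrite -[add _]/(g x + g y).
  by rewrite -linearD; split=> [/(can_inj gK)|->].
- move=> a x y; apply: (iff_trans (scE (a, g x) (g y))); rewrite -[sc _]/(a *: g x).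
  by rewrite -linearZ; split=> [/(can_inj gK)|->].
Qed.

Lemma mor_sat (S D : slot) f d c (h : lhom (so S) (so D)) :
  slot_ok S (vc d) (vp (pAdd d)) (vp (pScale d)) ->
  slot_ok D (vc c) (vp (pAdd c)) (vp (pScale c)) ->
  graph h (vp (pMor f d c)) -> l2_sat vr vc vo vp (fmLinear f d c).
Proof.
move=> [thI thS hA hS] [_ thS' hA' hS'] hP.
have thk x : sth (s := D) x \in members (vc c) by rewrite -thS'; apply/mem_set; exists x.
have {}thS v : v \in members (vc d) -> exists x, sth (s := S) x = v.
  by rewrite -thS => /set_mem[x _ <-]; exists x.
have {}thS' v : v \in members (vc c) -> exists x, sth (s := D) x = v.
  by rewrite -thS' => /set_mem[x _ <-]; exists x.
l2simpl d; case: (c == c) (eqxx c) => // _; split; split.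
- by move=> _ /thS[x <-]; exists (sth (h x)) => //; exact/hP.
- by move=> _ /thS[x <-] _ /thS'[y <-] _ /thS'[z <-] /hP <- /hP <-.
- move=> _ /thS[x <-] _ /thS[y <-] _ /thS[z <-] _ /thS'[t <-] _ /thS'[u <-] _ /thS'[v <-].
  by move=> /hP <- /hP <- /hP <- /hA <-; apply/hA'; rewrite linearD.
- move=> a _ /thS[x <-] _ /thS[y <-] _ /thS'[z <-] _ /thS'[t <-].
  by move=> /hP <- /hP <- /hS <-; apply/hS'; rewrite linearZ.
Qed.

Lemma sat_mor (S D : slot) f d c :
  slot_ok S (vc d) (vp (pAdd d)) (vp (pScale d)) ->
  slot_ok D (vc c) (vp (pAdd c)) (vp (pScale c)) ->
  l2_sat vr vc vo vp (fmLinear f d c) ->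
  exists h : lhom (so S) (so D), graph h (vp (pMor f d c)).
Proof.
move=> [thI thS hA hS] [thI' thS' hA' hS'].
l2simpl d; case: (c == c) (eqxx c) => // _ [[ht hf] [hD hZ]].
have thk x : sth (s := S) x \in members (vc d) by rewrite -thS; apply/mem_set; exists x.
have thk' x : sth (s := D) x \in members (vc c) by rewrite -thS'; apply/mem_set; exists x.
have [|h hE] := @boolp.choice (elements (so S)) (elements (so D))
    (fun x y => vp (pMor f d c) [:: sth x; sth y] [::]).
  move=> x; have [w] := ht _ (thk x).
  by rewrite -[in X in X -> _]thS' => /set_mem[y _ <-] hy; exists y.
have [|h' h'E] := @linear_exists R _ _ h.
  move=> a x y; have hx := (hD _ (thk (a *: x)) _ (thk y) _ (thk (a *: x + y)) _ (thk' _)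
    _ (thk' _) _ (thk' _) (hE _) (hE _) (hE _)).
  have {hx}/hA' <- := hx ((hA _ _ _).2 erefl); congr (_ + _).
  by apply/esym/hS'; apply: (hZ a _ (thk x) _ (thk _) _ (thk' _) _ (thk' _) (hE _) (hE _)); exact/hS.
exists h' => x y; rewrite h'E; split=> [hxy|<-]; last exact: hE.
exact/thI'/(hf _ (thk x) _ (thk' _) _ (thk' _) (hE x) hxy).
Qed.

End Sat.
End Slots.

(** * Translation of category formulas *)

Section Interpretation.

(** The finite disjunction covers the objects already in slots, the other disjunct puts a new one
    into slot [n]. The continuation receives the slot of the object and the next free slot. *)
Definition l2_exOb (n : nat) (k : nat -> nat -> l2_formula) : l2_formula :=
  L2Or (foldr (fun s => L2Or (k s n)) (l2_bool false) (iota 0 n))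
    (L2ExCard n (L2ExPred (pAdd n) (L2ExPred (pScale n)
      (L2And (L2And (fmAddOk n) (fmScaleOk n)) (k n n.+1))))).

Definition l2_exMor (n f : nat) (k : nat -> nat -> nat -> l2_formula) : l2_formula :=
  l2_exOb n (fun d m => l2_exOb m (fun c m' =>
    L2ExPred (pMor f d c) (L2And (fmLinear f d c) (k d c m')))).

Definition fmEqMor (f g d c : nat) : l2_formula :=
  fmAll d [:: 0]%N (fmAll c [:: 1]%N
    (L2And (L2Imp (fmMor f d c 0 1) (fmMor g d c 0 1))
           (L2Imp (fmMor g d c 0 1) (fmMor f d c 0 1)))).

(** One implication suffices because all three relations are graphs of total functions. *)
Definition fmComp (h f g d b c : nat) : l2_formula :=
  fmAll d [:: 0]%N (fmAll b [:: 1]%N (fmAll c [:: 2]%N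
    (L2Imp (fmMor g d b 0 1) (L2Imp (fmMor f b c 1 2) (fmMor h d c 0 2))))).

Definition fmId (f s : nat) : l2_formula := fmAll s [:: 0]%N (fmMor f s s 0 0).

(* The object variable [X] denotes the module in the slot [os X]; the slots
   below [n] hold distinct modules, so that equality of objects is decided by
   [os]. *)
Fixpoint interp (A : cat_formula) (os : nat -> nat) (md : nat -> nat * nat)
    (n : nat) : l2_formula :=
  match A with
  | CatEqOb X Y => l2_bool (os X == os Y)
  | CatEqMor f g =>
      if md f == md g then fmEqMor f g (md f).1 (md f).2 else l2_bool false
  | CatMor f X Y => l2_bool (md f == (os X, os Y))
  | CatComp h f g =>
      if [&& (md g).1 == (md h).1, (md g).2 == (md f).1 & (md f).2 == (md h).2]
      then fmComp h f g (md h).1 (md f).1 (md h).2 else l2_bool false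
  | CatId f X =>
      if md f == (os X, os X) then fmId f (os X) else l2_bool false
  | CatNot A => L2Not (interp A os md n)
  | CatAnd A B => L2And (interp A os md n) (interp B os md n)
  | CatOr A B => L2Or (interp A os md n) (interp B os md n)
  | CatImp A B => L2Imp (interp A os md n) (interp B os md n)
  | CatAllOb X A => L2Not (l2_exOb n (fun s m =>
      L2Not (interp A [eta os with X |-> s] md m)))
  | CatExOb X A => l2_exOb n (fun s m => interp A [eta os with X |-> s] md m)
  | CatAllMor f A => L2Not (l2_exMor n f (fun d c m =>
      L2Not (interp A os [eta md with f |-> (d, c)] m)))
  | CatExMor f A => l2_exMor n f (fun d c m =>
      interp A os [eta md with f |-> (d, c)] m)
  end.

Lemma scoped_bool rings cards ords preds b : l2_scoped rings cards ords preds (l2_bool b).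
Proof. by case: b. Qed.

Definition scope_ok (n : nat) (cards : seq nat) (preds : seq pred_var) : Prop :=
  (forall s, (s \in cards) = (s < n)%N) /\
  (forall s, (s < n)%N -> (pAdd s \in preds) && (pScale s \in preds)).

Lemma scope_ok_new n cards preds : scope_ok n cards preds ->
  scope_ok n.+1 (n :: cards) (pScale n :: pAdd n :: preds).
Proof.
move=> [hc hp]; split=> s; first by rewrite in_cons hc ltnS [RHS]leq_eqVlt.
rewrite ltnS leq_eqVlt => /orP[/eqP ->|sn].
  by rewrite !in_cons !eqxx !orbT.
have /andP[h1 h2] := hp _ sn.
by rewrite !in_cons h1 h2 !orbT.
Qed.

Lemma scoped_module rings cards ords preds s : s \in cards -> pAdd s \in preds ->
  pScale s \in preds -> l2_scoped rings cards ords preds (L2And (fmAddOk s) (fmScaleOk s)).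
Proof.
move=> sc h1 h2; rewrite /= /pred_of /= -!/(pAdd _) -!/(pScale _) sc h1 h2.
by rewrite !in_cons !eqxx !orbT.
Qed.

Lemma scoped_linear rings cards ords preds f d c : d \in cards -> c \in cards ->
  pAdd d \in preds -> pScale d \in preds -> pAdd c \in preds -> pScale c \in preds ->
  pMor f d c \in preds -> l2_scoped rings cards ords preds (fmLinear f d c).
Proof.
move=> dc cc h1 h2 h3 h4 h5; rewrite /= /pred_of /= -!/(pAdd _) -!/(pScale _) -!/(pMor _ _ _).
by rewrite dc cc h1 h2 h3 h4 h5 !in_cons !eqxx !orbT.
Qed.

Lemma scoped_exOb rings n cards ords preds k : scope_ok n cards preds ->
  (forall s m cards' preds', (n <= m)%N -> (s < m)%N -> scope_ok m cards' preds' ->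
    {subset preds <= preds'} -> l2_scoped rings cards' ords preds' (k s m)) ->
  l2_scoped rings cards ords preds (l2_exOb n k).
Proof.
move=> ok h; have ok' := scope_ok_new ok; have [hc hp] := ok.
apply/andP; split.
  have : all (fun s => (s < n)%N) (iota 0 n) by apply/allP => s; rewrite mem_iota.
  elim: (iota 0 n) => [|s l IH] //= /andP[sn /IH ->]; rewrite andbT.
  exact: h.
apply/andP; split; first by rewrite hc ltnn.
apply/andP; split; first by rewrite /= mem_head.
apply/andP; split; first by rewrite /= mem_head.
apply/andP; split; first by apply: scoped_module; rewrite !in_cons ?eqxx ?orbT.
by apply: h ok' _ => // p; rewrite !in_cons => ->; rewrite !orbT.
Qed.

Lemma scoped_exMor rings n f cards ords preds k : scope_ok n cards preds ->
  (forall d c m cards' preds', (n <= m)%N -> (d < m)%N -> (c < m)%N ->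
    scope_ok m cards' preds' -> {subset pMor f d c :: preds <= preds'} ->
    l2_scoped rings cards' ords preds' (k d c m)) ->
  l2_scoped rings cards ords preds (l2_exMor n f k).
Proof.
move=> ok h; apply: scoped_exOb ok _ => d m cards1 preds1 nm dm ok1 sub1.
apply: scoped_exOb ok1 _ => c m' cards2 preds2 mm' cm ok2 sub2.
have [hc hp] := ok2; have dm' := leq_trans dm mm'.
have sub : {subset pMor f d c :: preds <= pMor f d c :: preds2}.
  by move=> p; rewrite !in_cons => /orP[->//|/sub1/sub2 ->]; rewrite orbT.
have := h d c m' cards2 (pMor f d c :: preds2) (leq_trans nm mm') dm' cm.
move=> /(_ _ sub) hk.
have {}hk : l2_scoped rings cards2 ords (pMor f d c :: preds2) (k d c m').
  by apply: hk; split=> // s /hp/andP[h1 h2]; rewrite !in_cons h1 h2 !orbT.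
have /andP[h1 h2] := hp _ dm'; have /andP[h3 h4] := hp _ cm.
apply/andP; split; first by rewrite /= !hc dm' cm.
by apply/andP; split=> //; apply: scoped_linear; rewrite ?hc // !in_cons ?h1 ?h2 ?h3 ?h4 ?eqxx ?orbT.
Qed.

Lemma interp_scoped A rings cards ords preds oss ms os md n : cat_scoped oss ms A ->
  scope_ok n cards preds -> (forall X, X \in oss -> (os X < n)%N) ->
  (forall f, f \in ms -> [&& (md f).1 < n, (md f).2 < n & pMor f (md f).1 (md f).2 \in preds]%N) ->
  l2_scoped rings cards ords preds (interp A os md n).
Proof.
elim: A rings cards ords preds oss ms os md n =>
  [X Y|f g|f X Y|h f g|f X|A IA|A IA B IB|A IA B IB|A IA B IB|X A IA|X A IA|f A IA|f A IA]
  rings cards ords preds oss ms os md n sc ok hos hms; have [hc hp] := ok.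
- exact: scoped_bool.
- rewrite [interp _ _ _ _]/=; case: eqP => [e|_]; last exact: scoped_bool.
  have /andP[/hms/and3P[h1 h2 h3] /hms/and3P[_ _ h4]] := sc; rewrite -e in h4.
  by rewrite /= !hc h1 h2 /= /pred_of /= -!/(pMor _ _ _) h3 h4 !in_cons !eqxx !orbT.
- exact: scoped_bool.
- rewrite [interp _ _ _ _]/=; case: and3P => [[/eqP e1 /eqP e2 /eqP e3]|_]; last exact: scoped_bool.
  have /and3P[/hms/and3P[h1 h2 h3] /hms/and3P[h4 h5 h6] /hms/and3P[h7 h8 h9]] := sc.
  rewrite e1 e2 in h9; rewrite e3 in h6.
  by rewrite /= !hc h1 h2 h4 /= /pred_of /= -!/(pMor _ _ _) h3 h6 h9 !in_cons !eqxx !orbT.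
- rewrite [interp _ _ _ _]/=; case: eqP => [e|_]; last exact: scoped_bool.
  have /andP[/hms/and3P[h1 h2 h3] _] := sc; rewrite e /= in h1 h3.
  by rewrite /= !hc h1 /= /pred_of /= -!/(pMor _ _ _) h3 !in_cons !eqxx.
- exact: IA sc ok hos hms.
- by have /andP[sA sB] := sc; apply/andP; split; [exact: IA sA ok hos hms|exact: IB sB ok hos hms].
- by have /andP[sA sB] := sc; apply/andP; split; [exact: IA sA ok hos hms|exact: IB sB ok hos hms].
- by have /andP[sA sB] := sc; apply/andP; split; [exact: IA sA ok hos hms|exact: IB sB ok hos hms].
- apply: scoped_exOb ok _ => s m cards' preds' nm sm ok' sub; apply: IA sc ok' _ _.
    by move=> Y /=; rewrite in_cons; case: (Y == X) => //= /hos h; exact: leq_trans nm.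
  move=> f /hms/and3P[h1 h2 /sub ->]; by rewrite !(leq_trans _ nm).
- apply: scoped_exOb ok _ => s m cards' preds' nm sm ok' sub; apply: IA sc ok' _ _.
    by move=> Y /=; rewrite in_cons; case: (Y == X) => //= /hos h; exact: leq_trans nm.
  move=> f /hms/and3P[h1 h2 /sub ->]; by rewrite !(leq_trans _ nm).
- apply: scoped_exMor ok _ => d c m cards' preds' nm dm cm ok' sub; apply: IA sc ok' _ _.
    by move=> Y /hos h; exact: leq_trans nm.
  move=> g /=; rewrite in_cons; case: eqP => [->|_ /= /hms/and3P[h1 h2 h3]] /=.
    by rewrite dm cm sub // mem_head.
  by rewrite !(leq_trans _ nm) // sub // in_cons h3 orbT.
- apply: scoped_exMor ok _ => d c m cards' preds' nm dm cm ok' sub; apply: IA sc ok' _ _.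
    by move=> Y /hos h; exact: leq_trans nm.
  move=> g /=; rewrite in_cons; case: eqP => [->|_ /= /hms/and3P[h1 h2 h3]] /=.
    by rewrite dm cm sub // mem_head.
  by rewrite !(leq_trans _ nm) // sub // in_cons h3 orbT.
Qed.

End Interpretation.

(** * Correctness of the translation of category formulas *)

Section InterpretationCorrect.
Variable R : pzRingType.
Implicit Types (sl : nat -> slot R) (vc : nat -> V) (vp : pred_var -> l2_relation R).

Lemma sat_bool (vr : nat -> R) vc vo vp b : l2_sat vr vc vo vp (l2_bool b) <-> b.
Proof. by case: b; split=> //= h; [exists 0|case: h; exists 0]. Qed.

Definition slots_ok n sl vc vp : Prop :=
  (forall s, (s < n)%N -> slot_ok (sl s) (vc s) (vp (pAdd s)) (vp (pScale s))) /\
  (forall s t, (s < n)%N -> (t < n)%N -> so (sl s) = so (sl t) -> s = t).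

(** A new slot affects only predicate variables that have it among their sorts, so operations and
    morphisms recorded over the old slots survive. *)
Definition extends n sl vp sl' vp' : Prop := forall s, (s < n)%N -> sl' s = sl s /\
  forall p : pred_var, all (fun k => (k < n)%N) p.1.2 -> vp' p = vp p.

Lemma pAdd_pScale s t : (pAdd s == pScale t) = false.
Proof. by apply/eqP => -[]. Qed.

Lemma slots_ok_new n sl vc vp S kappa Pa Ps : slots_ok n sl vc vp ->
  slot_ok S kappa Pa Ps -> (forall s, (s < n)%N -> so (sl s) <> so S) ->
  slots_ok n.+1 [eta sl with n |-> S] [eta vc with n |-> kappa]
    [eta [eta vp with pAdd n |-> Pa] with pScale n |-> Ps].
Proof.
move=> [ok inj] Sok Snew; split=> [s|s t]; rewrite !ltnS.
  rewrite leq_eqVlt => /orP[/eqP ->|sn] /=; first by rewrite !eqxx pAdd_pScale.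
  have ns : (s == n) = false by rewrite ltn_eqF.
  have n1 : (pAdd s == pAdd n) = false by apply/eqP => -[/eqP]; rewrite ns.
  have n2 : (pScale s == pScale n) = false by apply/eqP => -[/eqP]; rewrite ns.
  have n3 : (pScale s == pAdd n) = false by apply/eqP => -[].
  by rewrite ns n1 n2 n3 pAdd_pScale; exact: ok.
rewrite leq_eqVlt => /orP[/eqP ->|sn]; rewrite leq_eqVlt => /orP[/eqP ->|tn] //=.
- by rewrite eqxx ltn_eqF // => /esym/(Snew _ tn).
- by rewrite eqxx ltn_eqF // => /(Snew _ sn).
- by rewrite !ltn_eqF //; exact: inj.
Qed.

Lemma slots_ok_mor n sl vc vp f d c P : slots_ok n sl vc vp ->
  slots_ok n sl vc [eta vp with pMor f d c |-> P].
Proof.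
move=> [ok inj]; split=> // s sn /=.
have -> : (pAdd s == pMor f d c) = false by apply/eqP => -[].
have -> : (pScale s == pMor f d c) = false by apply/eqP => -[].
exact: ok.
Qed.

Lemma extends_new n sl vp S Pa Ps : extends n sl vp [eta sl with n |-> S]
  [eta [eta vp with pAdd n |-> Pa] with pScale n |-> Ps].
Proof.
move=> s sn /=; rewrite ltn_eqF //; split=> // -[[i ks] m] /= /allP h.
have -> : ((i, ks, m) == pScale n) = false.
  by apply/eqP => -[_ e _]; have := h n; rewrite e mem_head ltnn => /(_ isT).
have -> // : ((i, ks, m) == pAdd n) = false.
by apply/eqP => -[_ e _]; have := h n; rewrite e mem_head ltnn => /(_ isT).
Qed.

Lemma sat_ors (vr : nat -> R) vc vo vp (k : nat -> l2_formula) l :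
  l2_sat vr vc vo vp (foldr (fun s => L2Or (k s)) (l2_bool false) l) <->
  exists2 s, s \in l & l2_sat vr vc vo vp (k s).
Proof.
elim: l => [|s l IH]; first by split=> [/sat_bool|[]].
split=> [[h|/IH[t tl h]]|[t]].
- by exists s => //; exact: mem_head.
- by exists t => //; rewrite in_cons tl orbT.
- rewrite in_cons => /orP[/eqP -> h|tl h]; first by left.
  by right; apply/IH; exists t.
Qed.

(** An object is found in an old slot, or it fills the new one and is then distinct from all the
    others. Conversely the contents of the new slot are realized by a fresh module. As [Q] speaks of
    the object itself, the hypothesis on [k] has to hold for every admissible filling of the
    slots. *)
Lemma exObP n sl (vr : nat -> R) vc vo vp k (Q : lmodule R -> Prop) : slots_ok n sl vc vp ->
  (forall s m sl' vc' vp', (n <= m)%N -> (s < m)%N -> slots_ok m sl' vc' vp' ->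
    extends n sl vp sl' vp' -> (l2_sat vr vc' vo vp' (k s m) <-> Q (so (sl' s)))) ->
  (l2_sat vr vc vo vp (l2_exOb n k) <-> exists X, Q X).
Proof.
move=> ok hk.
have old s : (s < n)%N -> (l2_sat vr vc vo vp (k s n) <-> Q (so (sl s))).
  by move=> sn; apply: hk ok _ => // t tn; split.
have new S kappa Pa Ps : slot_ok S kappa Pa Ps -> (forall s, (s < n)%N -> so (sl s) <> so S) ->
    (l2_sat vr [eta vc with n |-> kappa] vo
      [eta [eta vp with pAdd n |-> Pa] with pScale n |-> Ps] (k n n.+1) <-> Q (so S)).
  move=> Sok Snew.
  have := hk n n.+1 _ _ _ (leqnSn n) (ltnSn n) (slots_ok_new ok Sok Snew) (@extends_new n sl vp S Pa Ps).
  by rewrite /= eqxx.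
split=> [[/sat_ors[s]|[kappa kC [Pa _ [Ps _ [[h1 h2] h]]]]]|[X QX]].
- by rewrite mem_iota => sn /old; exists (so (sl s)); auto.
- have [S Sok Sbad] := sat_slot [seq so (sl s) | s <- iota 0 n] h1 h2.
  move: Sok; rewrite /= !eqxx pAdd_pScale => Sok.
  exists (so S); apply/(new _ _ _ _ Sok) => // s sn e; apply: Sbad.
  have : s \in iota 0 n by rewrite mem_iota.
  rewrite -e; elim: (iota 0 n) => //= t l IH; rewrite in_cons => /orP[/eqP ->|/IH]; by [left|right].
have [[s sn e]|nX] := pselect (exists2 s, (s < n)%N & so (sl s) = X).
  left; apply/sat_ors; exists s; first by rewrite mem_iota.
  by apply/old; rewrite ?e.
right; have [kappa kC [th [Pa [Ps [Sok ra rs]]]]] := slot_exists X.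
exists kappa => //; exists Pa; first by rewrite /= eqxx.
exists Ps; first by rewrite /= eqxx.
split; last by apply/(new _ _ _ _ Sok) => // s sn e; apply: nX; exists s.
by have := slots_ok_new ok Sok; case=> [s sn e|h _]; [apply: nX; exists s|exact (@slot_sat R vr _ vo _ _ n (h n (ltnSn n)))].
Qed.

Lemma exMorP n f sl (vr : nat -> R) vc vo vp k (Q : mor (Mod R) -> Prop) :
  slots_ok n sl vc vp ->
  (forall d c m sl' vc' vp' (h : lhom (so (sl' d)) (so (sl' c))) P,
    (n <= m)%N -> (d < m)%N -> (c < m)%N -> slots_ok m sl' vc' vp' ->
    extends n sl vp sl' vp' -> graph h P ->
    (l2_sat vr vc' vo [eta vp' with pMor f d c |-> P] (k d c m) <-> Q (@Mor (Mod R) _ _ h))) ->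
  (l2_sat vr vc vo vp (l2_exMor n f k) <-> exists u, Q u).
Proof.
move=> ok hk.
have -> : (exists u, Q u) <-> exists X Y (h : lhom X Y), Q (@Mor (Mod R) X Y h).
  by split=> [[[X Y h] hQ]|[X [Y [h hQ]]]]; [exists X, Y, h|exists (@Mor (Mod R) X Y h)].
apply: exObP ok _ => d m sl1 vc1 vp1 nm dm ok1 ex1.
refine (@exObP m sl1 vr vc1 vo vp1 _
  (fun Y => exists h : lhom (so (sl1 d)) Y, Q (@Mor (Mod R) _ _ h)) ok1 _).
move=> c m' sl2 vc2 vp2 mm' cm ok2 ex2; rewrite -(ex2 d dm).1.
have dm' := leq_trans dm mm'.
have ex : extends n sl vp sl2 vp2.
  move=> s sn; have [e1 e2] := ex1 s sn; have [e3 e4] := ex2 s (leq_trans sn nm).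
  split=> [|p pn]; first by rewrite e3.
  by rewrite -e2 // e4 //; apply: sub_all pn => t tn; exact: leq_trans nm.
have okP P := slots_ok_mor f d c P ok2.
split=> [[P _ [lin h]]|[h hQ]].
  have [u uP] := sat_mor ((okP P).1 d dm') ((okP P).1 c cm) lin.
  rewrite /= eqxx in uP.
  by exists u; apply/(hk _ _ _ _ _ _ _ _ (leq_trans nm mm') dm' cm ok2 ex uP).
have [P rP hP] := graph_exists h (ok2.1 d dm') (ok2.1 c cm).
exists P => //; split; last by apply/(hk _ _ _ _ _ _ _ _ (leq_trans nm mm') dm' cm ok2 ex hP).
apply: (@mor_sat R vr vc2 vo _ _ _ f d c h ((okP P).1 d dm') ((okP P).1 c cm)).
by rewrite /= eqxx.
Qed.

Definition mors_ok n sl vp (md : nat -> nat * nat) (ms : seq nat) (vm : nat -> mor (Mod R)) :=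
  forall f, f \in ms -> [/\ ((md f).1 < n)%N, ((md f).2 < n)%N &
    exists2 h : lhom (so (sl (md f).1)) (so (sl (md f).2)), vm f = @Mor (Mod R) _ _ h &
      graph h (vp (pMor f (md f).1 (md f).2))].

Lemma mors_ok_extends n m sl vp sl' vp' md ms vm : (n <= m)%N -> extends n sl vp sl' vp' ->
  mors_ok n sl vp md ms vm -> mors_ok m sl' vp' md ms vm.
Proof.
move=> nm ex ok f /ok[h1 h2 h3]; have [e1 e] := ex _ h1; have [e2 _] := ex _ h2.
split; [exact: leq_trans nm|exact: leq_trans nm|].
by rewrite e1 e2 e //= h1 h2.
Qed.

(** The morphism variable is the index of its predicate variable, so rebinding it touches no other
    morphism, even between the same slots. *)
Lemma mors_ok_mor n sl vp md ms vm f d c (h : lhom (so (sl d)) (so (sl c))) P :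
  (d < n)%N -> (c < n)%N -> graph h P -> mors_ok n sl vp md ms vm ->
  mors_ok n sl [eta vp with pMor f d c |-> P] [eta md with f |-> (d, c)] (f :: ms)
    [eta vm with f |-> @Mor (Mod R) _ _ h].
Proof.
move=> dn cn hP ok g; rewrite in_cons /=; case: eqP => [->|gf] /=.
  by move=> _; split=> //; exists h => //; rewrite eqxx.
have -> : (pMor g (md g).1 (md g).2 == pMor f d c) = false by apply/eqP => -[/gf].
exact: ok.
Qed.

Definition obs_ok n sl (os : nat -> nat) (oss : seq nat) (vO : nat -> lmodule R) :=
  forall X, X \in oss -> (os X < n)%N /\ vO X = so (sl (os X)).

Lemma obs_ok_extends n m sl vp sl' vp' os oss vO : (n <= m)%N -> extends n sl vp sl' vp' ->
  obs_ok n sl os oss vO -> obs_ok m sl' os oss vO.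
Proof.
move=> nm ex ok X /ok[h1 h2]; have [e _] := ex _ h1.
by split; [exact: leq_trans nm|rewrite e].
Qed.

Lemma obs_ok_ob n sl os oss vO X s : (s < n)%N -> obs_ok n sl os oss vO ->
  obs_ok n sl [eta os with X |-> s] (X :: oss) [eta vO with X |-> so (sl s)].
Proof. by move=> sn ok Y; rewrite in_cons /=; case: (Y == X) => //= /ok. Qed.

Lemma is_comp_dom (C : category) (u v w : mor C) : is_comp u v w ->
  [/\ dom w = dom u, cod w = dom v & cod v = cod u].
Proof. by case. Qed.

Lemma slot_surj (S : slot R) kappa Pa Ps : slot_ok S kappa Pa Ps ->
  (forall x, sth (s := S) x \in members kappa) /\
  forall v, v \in members kappa -> exists x, sth (s := S) x = v.
Proof.
move=> [_ thS _ _]; rewrite -thS; split=> [x|v /set_mem[x _ <-]]; last by exists x.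
by apply/mem_set; exists x.
Qed.

Section Atoms.
Variables (n : nat) (sl : nat -> slot R) (vr : nat -> R) (vc : nat -> V).
Variables (vo : ord_var -> V) (vp : pred_var -> l2_relation R).
Hypothesis ok : slots_ok n sl vc vp.

Lemma sat_EqMor f g d c (h k : lhom (so (sl d)) (so (sl c))) : (d < n)%N -> (c < n)%N ->
  graph h (vp (pMor f d c)) -> graph k (vp (pMor g d c)) ->
  (l2_sat vr vc vo vp (fmEqMor f g d c) <-> h = k).
Proof.
move=> /ok.1/slot_surj[th1 thS1] /ok.1/slot_surj[th2 thS2] hP kP.
l2simpl d; case: (c == c) (eqxx c) => // _; split=> [e|e _ /thS1[x <-] _ /thS2[y <-]].
  by apply: linear_ext => x; apply/hP/(e _ (th1 x) _ (th2 _)).2/kP.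
by subst k; split=> [/hP/kP|/kP/hP].
Qed.

Lemma sat_Comp h f g d b c (u : lhom (so (sl d)) (so (sl c))) (v : lhom (so (sl b)) (so (sl c)))
    (w : lhom (so (sl d)) (so (sl b))) : (d < n)%N -> (b < n)%N -> (c < n)%N ->
  graph u (vp (pMor h d c)) -> graph v (vp (pMor f b c)) -> graph w (vp (pMor g d b)) ->
  (l2_sat vr vc vo vp (fmComp h f g d b c) <-> u = lhom_comp v w).
Proof.
move=> /ok.1/slot_surj[th1 thS1] /ok.1/slot_surj[th2 thS2] /ok.1/slot_surj[th3 thS3] uP vP wP.
l2simpl d; case: (b == b) (eqxx b) => // _; case: (c == c) (eqxx c) => // _.
split=> [e|e _ /thS1[x <-] _ /thS2[y <-] _ /thS3[z <-] /wP wx /vP vy].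
  apply: linear_ext => x; apply/uP/(e _ (th1 x) _ (th2 (w x)) _ (th3 (v (w x)))).
    exact/wP.
  exact/vP.
by apply/uP; rewrite e /= wx vy.
Qed.

Lemma sat_Id f s (h : lhom (so (sl s)) (so (sl s))) : (s < n)%N ->
  graph h (vp (pMor f s s)) -> (l2_sat vr vc vo vp (fmId f s) <-> h = lhom_id _).
Proof.
move=> /ok.1/slot_surj[th thS] hP; l2simpl s; split=> [e|e _ /thS[x <-]].
  by apply: linear_ext => x; apply/hP/e.
by apply/hP; rewrite e.
Qed.

End Atoms.

Lemma interp_sat A oss ms os md n sl (vr : nat -> R) vc vo vp vO vm : cat_scoped oss ms A ->
  slots_ok n sl vc vp -> obs_ok n sl os oss vO -> mors_ok n sl vp md ms vm ->
  (l2_sat vr vc vo vp (interp A os md n) <-> cat_sat (C := Mod R) vO vm A).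
Proof.
elim: A oss ms os md n sl vc vp vO vm =>
  [X Y|f g|f X Y|h f g|f X|A IA|A IA B IB|A IA B IB|A IA B IB|X A IA|X A IA|f A IA|f A IA]
  oss ms os md n sl vc vp vO vm sc ok hos hms; have [ok1 inj] := ok.
- have /andP[/hos[X1 e1] /hos[Y1 e2]] := sc.
  rewrite [interp _ _ _ _]/= sat_bool /= e1 e2.
  by split=> [/eqP ->//|/inj -> //].
- have /andP[/hms[f1 f2 [h eh hP]] /hms[g1 g2 [k ek kP]]] := sc.
  rewrite [interp _ _ _ _]/= [cat_sat _ _ _]/= eh ek; case: eqP => [e|ne].
    rewrite -e in k ek kP g1 g2 *; apply: (iff_trans (sat_EqMor vr vo ok f1 f2 hP kP)).
    by split=> [->//|/Mor_inj].
  rewrite sat_bool; split=> // e; case: ne.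
  have e1 := inj _ _ f1 g1 (congr1 (@dom (Mod R)) e).
  have e2 := inj _ _ f2 g2 (congr1 (@cod (Mod R)) e).
  by rewrite [md f]surjective_pairing [md g]surjective_pairing e1 e2.
- have /and3P[/hms[f1 f2 [h eh hP]] /hos[X1 eX] /hos[Y1 eY]] := sc.
  rewrite [interp _ _ _ _]/= [cat_sat _ _ _]/= eh eX eY sat_bool.
  have -> : (md f == (os X, os Y)) = ((md f).1 == os X) && ((md f).2 == os Y) by case: (md f).
  rewrite /=; split=> [/andP[/eqP -> /eqP ->]//|[/inj -> // /inj -> //]]; by rewrite !eqxx.
- have /and3P[/hms[h1 h2 [u eu uP]] /hms[f1 f2 [v ev vP]] /hms[g1 g2 [w ew wP]]] := sc.
  rewrite [interp _ _ _ _]/= [cat_sat _ _ _]/=.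
  case: and3P => [[/eqP e1 /eqP e2 /eqP e3]|ne]; last first.
    rewrite sat_bool; split=> // /is_comp_dom; rewrite eu ev ew /= => -[d1 d2 d3].
    by case: ne; split; apply/eqP; apply: inj.
  rewrite eu ev ew.
  move: u v w {eu ev ew} h1 h2 f1 f2 g1 g2 e1 e2 e3 uP vP wP.
  case: (md h) (md f) (md g) => [d c] [b c'] [d' b'] /= u v w h1 h2 f1 f2 g1 g2 e1 e2 e3.
  subst d' b' c' => uP vP wP; apply: (iff_trans (sat_Comp vr vo ok h1 f1 h2 uP vP wP)).
  rewrite is_comp_Mor; by split=> [->//|/Mor_inj].
- have /andP[/hms[f1 f2 [h eh hP]] /hos[X1 eX]] := sc.
  rewrite [interp _ _ _ _]/= [cat_sat _ _ _]/= eh eX; case: eqP => [e|ne]; last first.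
    rewrite sat_bool; split=> // e; case: ne.
    have e1 := inj _ _ f1 X1 (congr1 (@dom (Mod R)) e).
    have e2 := inj _ _ f2 X1 (congr1 (@cod (Mod R)) e).
    by rewrite [md f]surjective_pairing e1 e2.
  move: h {eh} f1 f2 hP; rewrite e /= => h f1 f2 hP.
  apply: (iff_trans (sat_Id vr vo ok f1 hP)); by split=> [->//|/Mor_inj].
- by have h := IA _ _ _ _ _ _ _ _ _ _ sc ok hos hms; split=> n' /h.
- have /andP[sA sB] := sc; have hA := IA _ _ _ _ _ _ _ _ _ _ sA ok hos hms.
  by have hB := IB _ _ _ _ _ _ _ _ _ _ sB ok hos hms; split=> -[/hA h1 /hB h2]; split.
- have /andP[sA sB] := sc; have hA := IA _ _ _ _ _ _ _ _ _ _ sA ok hos hms.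
  by have hB := IB _ _ _ _ _ _ _ _ _ _ sB ok hos hms;
    split=> [[/hA|/hB]|[/hA|/hB]]; [left|right|left|right].
- have /andP[sA sB] := sc; have hA := IA _ _ _ _ _ _ _ _ _ _ sA ok hos hms.
  by have hB := IB _ _ _ _ _ _ _ _ _ _ sB ok hos hms; split=> h /hA/h/hB.
(* Universal quantifiers are translated as negated existential ones, so the same lemma serves
   both. *)
- have hX : l2_sat vr vc vo vp (l2_exOb n (fun s m => L2Not (interp A [eta os with X |-> s] md m)))
      <-> exists x : lmodule R, ~ cat_sat (C := Mod R) [eta vO with X |-> x] vm A.
    apply: exObP ok _ => s m sl' vc' vp' nm sm ok' ex.
    have h := IA _ _ _ _ _ _ _ _ _ _ sc ok' (obs_ok_ob (X := X) sm (obs_ok_extends nm ex hos))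
      (mors_ok_extends nm ex hms).
    by split=> n' /h.
  split=> [h x|h /hX[x]]; last by apply.
  by apply: contrapT => nx; apply: h; apply/hX; exists x.
- apply: exObP ok _ => s m sl' vc' vp' nm sm ok' ex.
  exact: (IA _ _ _ _ _ _ _ _ _ _ sc ok' (obs_ok_ob (X := X) sm (obs_ok_extends nm ex hos))
      (mors_ok_extends nm ex hms)).
- have hX : l2_sat vr vc vo vp (l2_exMor n f (fun d c m =>
      L2Not (interp A os [eta md with f |-> (d, c)] m)))
      <-> exists u : mor (Mod R), ~ cat_sat (C := Mod R) vO [eta vm with f |-> u] A.
    apply: exMorP ok _ => d c m sl' vc' vp' u P nm dm cm ok' ex uP.
    have h := IA _ _ _ _ _ _ _ _ _ _ sc (slots_ok_mor f d c P ok') (obs_ok_extends nm ex hos)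
      (mors_ok_mor (f := f) dm cm uP (mors_ok_extends nm ex hms)).
    by split=> n' /h.
  split=> [h x|h /hX[x]]; last by apply.
  by apply: contrapT => nx; apply: h; apply/hX; exists x.
- apply: exMorP ok _ => d c m sl' vc' vp' u P nm dm cm ok' ex uP.
  exact: (IA _ _ _ _ _ _ _ _ _ _ sc (slots_ok_mor f d c P ok') (obs_ok_extends nm ex hos)
      (mors_ok_mor (f := f) dm cm uP (mors_ok_extends nm ex hms))).
Qed.

End InterpretationCorrect.

Definition interp_sentence (A : cat_formula) : l2_formula :=
  interp A (fun _ => 0%N) (fun _ => (0, 0)%N) 0.

Lemma l2_true_interp (R : pzRingType) (A : cat_formula) : small R -> cat_sentence A ->
  l2_sentence (interp_sentence A) /\ (l2_true R (interp_sentence A) <-> cat_true (Mod R) A).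
Proof.
move=> smallR sA; split; first by apply: interp_scoped sA _ _ _.
have sat (U : lmodule R) (vr : nat -> R) vc vo vp vO vm :
    l2_sat vr vc vo vp (interp_sentence A) <-> cat_sat (C := Mod R) vO vm A.
  (* No slot is in use yet, so the contents are arbitrary. *)
  pose sl (_ : nat) : slot R := @Slot R U (fun _ => \pi_V leaf).
  by apply: (@interp_sat R A [::] [::] (fun _ => 0%N) (fun _ => (0, 0)%N) 0%N sl vr vc vo vp vO vm sA).
split=> h; last first.
  have [U _] := regular_exists smallR.
  by move=> vr vc vo vp; apply/(sat U)/(h (fun _ => U) (fun _ => @Mor (Mod R) U U (lhom_id U))).
move=> vO vm; pose v0 := \pi_V leaf.
exact/(sat (vO 0%N))/(h (fun _ => 0) (fun _ => v0) (fun _ => v0) (fun _ _ _ => True)).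
Qed.

Theorem corollary3 (R1 R2 : pzRingType) (setR1 : is_set R1) (setR2 : is_set R2)
    (localR1 : local_ring R1) (localR2 : local_ring R2) :
  elementarily_equivalent (Mod R1) (Mod R2) <-> l2_equivalent R1 R2.
Proof.
have small1 := is_set_small setR1; have small2 := is_set_small setR2.
split=> h A sA.
  have [sC <-] := l2_true_compile localR1 small1 sA.
  by have [_ <-] := l2_true_compile localR2 small2 sA; exact: h.
have [sC <-] := l2_true_interp small1 sA.
by have [_ <-] := l2_true_interp small2 sA; exact: h.
Qed.
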